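(* Let $n\in\mathbb{N}$, $a>1$, let $h_0(n),\dots,h_n(n)$ be real numbers with $|h_j(n)|\le1$, and let $Z_0(n,a),\dots,Z_n(n,a)\in\mathbb{C}$. Then the solution of the Cauchy problem $$i\frac{\partial\psi(x,t)}{\partial t}=-\frac{\partial^2\psi(x,t)}{\partial x^2},\qquad \psi(x,0)=e^{-\frac{x^2}{2}}\sum_{j=0}^nZ_j(n,a)e^{ih_j(n)x}$$ ($x,t\in\mathbb{R}$) is given by $$\psi_n(x,t)=\frac{e^{-\frac{x^2}{2(1+2it)}}}{(1+2it)^{1/2}}\sum_{j=0}^nZ_j(n,a)\,e^{-\frac{h_j^2(n)}{2}+\frac{h_j^2(n)}{2(1+2it)}+ix\frac{h_j(n)}{1+2it}} .$$
   Context: $(1+2it)^{1/2}$ is the principal branch. ''The solution'' is understood in the $L^2$ sense: $\psi\in C(\mathbb{R}_t;L^2(\mathbb{R}_x))$, satisfying the equation in the sense of distributions, with the given initial value at $t=0$. *)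

(* Defs.v *)
From HB Require Import structures.
From mathcomp Require Import all_boot all_order all_algebra.
From mathcomp Require Import all_classical all_reals all_analysis.
From mathcomp Require Import complex.

Set Implicit Arguments.
Unset Strict Implicit.
Unset Printing Implicit Defensive.

Import Order.TTheory GRing.Theory Num.Theory.
Import numFieldNormedType.Exports.
Import ComplexField.

Local Open Scope classical_set_scope.
Local Open Scope ring_scope.
Local Open Scope complex_scope.

(* Complex numbers are R[i] from real-closed.  Its [sqrtc] is the principal
   square root (nonnegative real part; the root of a negative real r is
   i sqrt(-r)), whereas MathComp's generic [sqrtC] picks the root in the upper
   half plane and is not the principal branch. *)

Definition cexp (R : realType) (z : R[i]) : R[i] :=
  (expR (complex.Re z) * cos (complex.Im z)) +i*
  (expR (complex.Re z) * sin (complex.Im z)).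

Definition cintegral (R : realType) (f : R -> R[i]) : R[i] :=
  (\int[@lebesgue_measure R]_x complex.Re (f x)) +i*
  (\int[@lebesgue_measure R]_x complex.Im (f x)).

Definition inL2 (R : realType) (f : R -> R[i]) : Prop :=
  ((fun x => complex.Re (f x)) \in Lfun (@lebesgue_measure R) 2%:E) /\
  ((fun x => complex.Im (f x)) \in Lfun (@lebesgue_measure R) 2%:E).

Definition L2norm (R : realType) (f : R -> R[i]) : \bar R :=
  Lnorm (@lebesgue_measure R) 2%:E (fun x => (Normc.normc (f x))%:E).

(* [psi x t]; each [psi ^~ t] is a representative of an element of L^2(R_x). *)
Definition continuous_L2 (R : realType) (psi : R -> R -> R[i]) : Prop :=
  (forall t, inL2 (psi ^~ t)) /\
  (forall t0, L2norm (fun x => psi x t - psi x t0) @[t --> t0] --> 0%E).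

(* Points of the plane are pairs (x, t). *)
Definition dir_x (R : realType) : R * R := (1, 0).
Definition dir_t (R : realType) : R * R := (0, 1).

Fixpoint Ck (R : realType) (k : nat) (f : R * R -> R) : Prop :=
  continuous f /\
  (if k is m.+1 then
     ((forall p, derivable f p (dir_x R)) /\ Ck m ('D_(dir_x R) f)) /\
     ((forall p, derivable f p (dir_t R)) /\ Ck m ('D_(dir_t R) f))
   else True).

Definition smooth (R : realType) (f : R * R -> R) : Prop :=
  forall k, Ck k f.

Definition test_function (R : realType) (phi : R * R -> R[i]) : Prop :=
  smooth (fun p => complex.Re (phi p)) /\
  smooth (fun p => complex.Im (phi p)) /\
  compact (closure [set p | phi p != 0]).

Definition cderive (R : realType) (v : R * R) (phi : R * R -> R[i]) :
    R * R -> R[i] :=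
  fun p => ('D_v (fun q => complex.Re (phi q)) p) +i*
           ('D_v (fun q => complex.Im (phi q)) p).

(* The distribution on the plane defined by an element of C(R_t; L^2(R_x)).
   The integral is iterated because representatives chosen separately for each
   t need not be jointly measurable; the inner integral does not depend on the
   representatives and is continuous and compactly supported in t. *)
Definition distr_of (R : realType) (psi : R -> R -> R[i])
    (phi : R * R -> R[i]) : R[i] :=
  cintegral (fun t => cintegral (fun x => psi x t * phi (x, t))).

Definition distr_derive (R : realType) (v : R * R)
    (T : (R * R -> R[i]) -> R[i]) : (R * R -> R[i]) -> R[i] :=
  fun phi => - T (cderive v phi).

Definition is_solution (R : realType) (psi0 : R -> R[i])
    (psi : R -> R -> R[i]) : Prop :=
  continuous_L2 psi /\
  (forall phi, test_function phi ->
     'i%C * distr_derive (dir_t R) (distr_of psi) phi =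
     - distr_derive (dir_x R) (distr_derive (dir_x R) (distr_of psi)) phi) /\
  {ae @lebesgue_measure R, forall x, psi x 0 = psi0 x}.

(* Main.v *)
Require Import Defs.
From mathcomp Require Import all_boot all_order all_algebra.
From mathcomp Require Import all_classical all_reals all_analysis.
From mathcomp Require Import complex.
From mathcomp Require Import measurable_realfun.
From mathcomp Require Import ring lra.
Import Order.TTheory GRing.Theory Num.Theory.
Import numFieldNormedType.Exports.
Local Open Scope classical_set_scope.
Local Open Scope ring_scope.
Local Open Scope complex_scope.
Set Implicit Arguments.
Unset Strict Implicit.
Unset Printing Implicit Defensive.

(** The initial datum is a linear combination of Gaussians with complex centres: up
    to the factor [exp (- h^2 / 2)], the function [exp (- x^2 / 2 + i h x)] is
    [exp (- (x - i h)^2 / 2)].  The heat kernel of complex variance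
    [s = sigma + i (beta + gamma t)],
      [K (x, t) = s^(-1/2) exp (- (x - c - i eta)^2 / (2 s))],
    satisfies [K_t = (i gamma / 2) K_xx] as soon as [sigma > 0]
    ([cderive_kernel_t]).  With [sigma = 1], [beta = 0], [gamma = 2], [c = 0] and
    [eta = h_j] it solves the Schrodinger equation, and the announced formula is
    a linear combination of such kernels ([frequency_packetE]).

    Existence.  The kernels are smooth and dominated by a fixed Gaussian on every
    bounded time interval, so their slices form a continuous curve in L^2
    ([gauss_cL2]), and integration by parts against test functions shows that a
    classical solution is a solution in the sense of distributions
    ([classical_schrodinger]).

    Uniqueness is a duality argument, which has to work for solutions that are
    merely continuous in time with values in L^2.  If [G] is a Gaussian kernel
    with [i G_t = G_xx] (the case [gamma = -2]) and [psi] is any solution, then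
    formally [d/dt int psi G dx = int (i psi_xx G - i psi G_xx) dx = 0].  To make
    this rigorous the equation is tested against
    [phi (x, t) = w t * cut (l x) * G (x, t)], where [w] is a smooth window
    between two times [a] and [b].  As the edges of [w] sharpen, its derivative
    tends to the difference of the Dirac masses at [a] and [b]; the
    derivatives that fall on [cut (l x)] contribute [O (l)].  Hence
    [int psi G dx] takes the same value at all times ([pairing_constant]).

    Two solutions with the same initial datum therefore have the same integral
    against [G] at every time [t0].  Choosing [beta = 2 t0] makes the variance of
    [G] at time [t0] equal to the real number [sigma] ([kernel_focus]), so that
    the difference of the two solutions at [t0] is orthogonal to every real
    Gaussian.  A square-integrable function with this property vanishes almost
    everywhere ([gaussians_determine]): powers of [w = exp (- s (x - c)^2)] are
    again Gaussians, the polynomials [1 - (1 - w^m)^(2^m)] in [w] have no constant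
    term and tend to the indicator function of the ball where [2 w > 1], hence the
    function has mean zero over all balls, and Lebesgue's differentiation theorem
    concludes. *)

(** * Smooth functions on the plane *)

Section SmoothCalculus.
Context {R : realType}.
Implicit Types (f g : R * R -> R) (p v : R * R) (k : nat).

(** A directional derivative is the derivative of a function of one
    variable along a line; this is how the one-variable rules are brought
    to the plane without assuming differentiability there. *)
Lemma derive_line f p v : 'D_1 (fun s : R => f (s *: v + p)) 0 = 'D_v f p.
Proof.
rewrite /derive; set g1 := fun h => h^-1 *: _; set g2 := fun h => h^-1 *: _.
suff -> : g1 = g2 by [].
by rewrite funeqE /g1 /g2 => h /=; rewrite addr0 scale0r add0r [_%:A]mulr1.
Qed.

(** For an outer function of one variable the chain rule needs nothing but
    the directional derivative of the inner function: restrict to a line. *)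
Lemma is_derive_scomp f (h : R -> R) p v (df dh : R) :
  is_derive p v f df -> is_derive (f p) 1 h dh ->
  is_derive p v (h \o f) (dh * df).
Proof.
move=> [fd fE] hd.
pose c := fun s : R => f (s *: v + p).
have cE : is_derive (0 : R) 1 c df.
  apply: DeriveDef; first exact: (derivable1P f p v).1.
  by rewrite -fE -derive_line.
have c0 : c 0 = f p by rewrite /c scale0r add0r.
rewrite -c0 in hd.
have [hcd hcE] : is_derive (0 : R) 1 (h \o c) (dh * df) by exact: is_derive1_comp.
apply: DeriveDef; first exact: (derivable1P (h \o f) p v).2.
by rewrite -hcE -derive_line.
Qed.

Lemma Ck_continuous k f : Ck k f -> continuous f.
Proof. by case: k => [|k] []. Qed.

Lemma Ck0 f : continuous f -> Ck 0 f.
Proof. by move=> cf; split. Qed.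

Lemma CkS k f : Ck k.+1 f <-> [/\ continuous f,
  (forall p, derivable f p (dir_x R)), (forall p, derivable f p (dir_t R)),
  Ck k ('D_(dir_x R) f) & Ck k ('D_(dir_t R) f)].
Proof.
split; first by case=> cf [[dx Cx] [dt Ct]]; exact: And5 cf dx dt Cx Ct.
by case=> cf dx dt Cx Ct; exact: (conj cf (conj (conj dx Cx) (conj dt Ct))).
Qed.

Lemma dir_xE : ((dir_x R).1 = 1) * ((dir_x R).2 = 0). Proof. by []. Qed.
Lemma dir_tE : ((dir_t R).1 = 0) * ((dir_t R).2 = 1). Proof. by []. Qed.

(* Otherwise conversion unfolds the two directions and compares their
   coordinates. *)
#[local] Opaque Ck dir_x dir_t.

Lemma Ck_pred k f : Ck k.+1 f -> Ck k f.
Proof.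
elim: k f => [|k IH] f; first by move=> /Ck_continuous; exact: Ck0.
move=> /CkS[cf dx dt Cx Ct].
by apply/CkS; split; [exact: cf|exact: dx|exact: dt|exact: IH|exact: IH].
Qed.

Lemma Ck_derive k f : Ck k.+1 f ->
  [/\ forall p, is_derive p (dir_x R) f ('D_(dir_x R) f p),
   forall p, is_derive p (dir_t R) f ('D_(dir_t R) f p),
   Ck k ('D_(dir_x R) f) & Ck k ('D_(dir_t R) f)].
Proof.
move=> /CkS[cf dx dt Cx Ct].
by split=> [p|p||]; [exact: DeriveDef|exact: DeriveDef| |].
Qed.

(** The induction step of every smoothness proof below: exhibit the two
    partial derivatives. *)
Lemma Ck_step k f fx ft : continuous f ->
  (forall p, is_derive p (dir_x R) f (fx p)) ->
  (forall p, is_derive p (dir_t R) f (ft p)) ->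
  Ck k fx -> Ck k ft -> Ck k.+1 f.
Proof.
move=> cf dx dt Cx Ct; apply/CkS; split; first exact: cf.
- by move=> p; have [] := dx p.
- by move=> p; have [] := dt p.
- by have -> : 'D_(dir_x R) f = fx by apply/funext => p; have [] := dx p.
- by have -> : 'D_(dir_t R) f = ft by apply/funext => p; have [] := dt p.
Qed.

Lemma continuousD_plane f g :
  continuous f -> continuous g -> continuous (fun p => f p + g p).
Proof. by move=> cf cg p; exact: cvgD (cf p) (cg p). Qed.

Lemma continuousM_plane f g :
  continuous f -> continuous g -> continuous (fun p => f p * g p).
Proof. by move=> cf cg p; exact: cvgM (cf p) (cg p). Qed.

Lemma CkD k f g : Ck k f -> Ck k g -> Ck k (fun p => f p + g p).
Proof.
elim: k f g => [|k IH] f g Cf Cg; have cf := Ck_continuous Cf;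
  have cg := Ck_continuous Cg; first exact/Ck0/continuousD_plane.
have [fx ft Cfx Cft] := Ck_derive Cf; have [gx gt Cgx Cgt] := Ck_derive Cg.
apply: (Ck_step (continuousD_plane cf cg) (fun p => is_deriveD (fx p) (gx p))
  (fun p => is_deriveD (ft p) (gt p))); exact: IH.
Qed.

Lemma is_deriveM_plane f g p v (df dg : R) : is_derive p v f df ->
  is_derive p v g dg -> is_derive p v (fun q => f q * g q) (f p * dg + g p * df).
Proof. by move=> ? ?; apply: (is_derive_eq (f := f * g)). Qed.

Lemma CkM k f g : Ck k f -> Ck k g -> Ck k (fun p => f p * g p).
Proof.
elim: k f g => [|k IH] f g Cf Cg; have cf := Ck_continuous Cf;
  have cg := Ck_continuous Cg; first exact/Ck0/continuousM_plane.
have Cf' := Ck_pred Cf; have Cg' := Ck_pred Cg.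
have [fx ft Cfx Cft] := Ck_derive Cf; have [gx gt Cgx Cgt] := Ck_derive Cg.
apply: (Ck_step (continuousM_plane cf cg)
  (fun p => is_deriveM_plane (fx p) (gx p))
  (fun p => is_deriveM_plane (ft p) (gt p))); apply: CkD; exact: IH.
Qed.

Lemma Ck_cst k (c : R) : Ck k (fun=> c).
Proof.
elim: k c => [|k IH] c; first by apply: Ck0 => p; exact: cvg_cst.
apply: (@Ck_step _ _ (fun=> 0) (fun=> 0)).
- by move=> p; exact: cvg_cst.
- exact: IH.
- exact: IH.
Qed.

Lemma continuous_fst : continuous (fun p : R * R => p.1).
Proof. by move=> p; exact: cvg_fst. Qed.

Lemma continuous_snd : continuous (fun p : R * R => p.2).
Proof. by move=> p; exact: cvg_snd. Qed.

Lemma is_derive_coord1 p v : is_derive p v (fun q : R * R => q.1) v.1.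
Proof.
have [d e] : is_derive (0 : R) 1 (fun s : R => s * v.1 + p.1) v.1.
  by apply: is_derive_eq; rewrite scaler0 add0r addr0 [LHS]mulr1.
apply: DeriveDef; first exact: (derivable1P _ p v).2.
by rewrite -(derive_line (fun q : R * R => q.1)).
Qed.

Lemma is_derive_coord2 p v : is_derive p v (fun q : R * R => q.2) v.2.
Proof.
have [d e] : is_derive (0 : R) 1 (fun s : R => s * v.2 + p.2) v.2.
  by apply: is_derive_eq; rewrite scaler0 add0r addr0 [LHS]mulr1.
apply: DeriveDef; first exact: (derivable1P _ p v).2.
by rewrite -(derive_line (fun q : R * R => q.2)).
Qed.

Lemma smooth_continuous f : smooth f -> continuous f.
Proof. by move=> /(_ 0%N)/Ck_continuous. Qed.

Lemma smooth_cst (c : R) : smooth (fun=> c).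
Proof. by move=> k; exact: Ck_cst. Qed.

Lemma smooth_fst : smooth (fun p : R * R => p.1).
Proof.
case=> [|k]; first exact/Ck0/continuous_fst.
by apply: (Ck_step continuous_fst (fun p => is_derive_coord1 p _)
  (fun p => is_derive_coord1 p _)); exact: Ck_cst.
Qed.

Lemma smooth_snd : smooth (fun p : R * R => p.2).
Proof.
case=> [|k]; first exact/Ck0/continuous_snd.
by apply: (Ck_step continuous_snd (fun p => is_derive_coord2 p _)
  (fun p => is_derive_coord2 p _)); exact: Ck_cst.
Qed.

Lemma smoothD f g : smooth f -> smooth g -> smooth (fun p => f p + g p).
Proof. by move=> sf sg k; apply: CkD; [exact: sf|exact: sg]. Qed.

Lemma smoothM f g : smooth f -> smooth g -> smooth (fun p => f p * g p).
Proof. by move=> sf sg k; apply: CkM; [exact: sf|exact: sg]. Qed.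

Lemma smoothN f : smooth f -> smooth (fun p => - f p).
Proof.
move=> sf; have -> : (fun p => - f p) = (fun p => -1 * f p).
  by apply/funext => p; rewrite mulN1r.
by apply: smoothM => //; exact: smooth_cst.
Qed.

Lemma smoothB f g : smooth f -> smooth g -> smooth (fun p => f p - g p).
Proof. by move=> sf sg; apply: smoothD => //; exact: smoothN. Qed.

Lemma smooth_derive f : smooth f ->
  [/\ forall p, is_derive p (dir_x R) f ('D_(dir_x R) f p),
   forall p, is_derive p (dir_t R) f ('D_(dir_t R) f p),
   smooth ('D_(dir_x R) f) & smooth ('D_(dir_t R) f)].
Proof.
move=> sf; have [dx dt _ _] := Ck_derive (sf 1%N).
by split=> [//|//|k|k]; have [] := Ck_derive (sf k.+1).
Qed.

(** One-variable functions enter through families that are stable under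
    differentiation: sine and cosine together, or all the flat functions of
    the bump construction, are handled in one induction. *)
Lemma smooth_family (I : Type) (H H' : I -> R -> R) f :
  smooth f ->
  (forall i p, is_derive (f p) 1 (H i) (H' i (f p))) ->
  (forall k, (forall i, Ck k (H i \o f)) -> forall i, Ck k (H' i \o f)) ->
  forall i, smooth (H i \o f).
Proof.
move=> sf dH HH' i k; elim: k i => [|k IH] i;
  have cH : continuous (H i \o f).
- move=> p; apply: continuous_comp; first exact: smooth_continuous.
  by have [dHp _] := dH i p; apply/differentiable_continuous/derivable1_diffP.
- exact: Ck0.
- move=> p; apply: continuous_comp; first exact: smooth_continuous.
  by have [dHp _] := dH i p; apply/differentiable_continuous/derivable1_diffP.
have [dfx dft Cfx Cft] := Ck_derive (sf k.+1).
apply: (Ck_step cH (fun p => is_derive_scomp (dfx p) (dH i p))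
   (fun p => is_derive_scomp (dft p) (dH i p))).
- by apply: (CkM (f := H' i \o f)) => //; exact: HH'.
- by apply: (CkM (f := H' i \o f)) => //; exact: HH'.
Qed.

Lemma smooth_expR f : smooth f -> smooth (fun p => expR (f p)).
Proof.
move=> sf; apply: (@smooth_family unit (fun=> expR) (fun=> expR) f sf _ _ tt).
by move=> k H i; exact: H.
Qed.

Lemma smooth_cos_sin f : smooth f ->
  smooth (fun p => cos (f p)) /\ smooth (fun p => sin (f p)).
Proof.
move=> sf.
pose H (b : bool) : R -> R := if b then cos else sin.
pose H' (b : bool) : R -> R := if b then (fun x => - sin x) else cos.
have SH : forall b, smooth (H b \o f).
  apply: (@smooth_family bool H H' f sf).
  - by case=> p; [exact: is_derive_cos|exact: is_derive_sin].
  - move=> k IH [|]; last exact: (IH true).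
    have -> : H' true \o f = (fun p => (-1) * (H false \o f) p).
      by apply/funext => p; rewrite mulN1r.
    by apply: CkM; [exact: Ck_cst|exact: IH].
by split; [exact: SH true|exact: SH false].
Qed.

Lemma smoothV f : smooth f -> (forall p, f p != 0) ->
  smooth (fun p => (f p)^-1).
Proof.
move=> sf f0.
apply: (@smooth_family unit (fun=> GRing.inv) (fun _ x => - x^-1 ^+ 2) f sf _ _ tt).
- move=> _ p; have := is_deriveV (f0 p) (is_derive_id (f p) (1 : R)).
  by move=> H; apply: is_derive_eq; rewrite [LHS]mulr1 exprVn.
- move=> k H _.
  have -> : (fun x : R => - x^-1 ^+ 2) \o f =
      (fun p => -1 * ((GRing.inv \o f) p * (GRing.inv \o f) p)).
    by apply/funext => p; rewrite mulN1r /= expr2.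
  by apply: CkM; [exact: Ck_cst|apply: CkM; exact: (H tt)].
Qed.

Lemma smooth_sqrt f : smooth f -> (forall p, 0 < f p) ->
  smooth (fun p => Num.sqrt (f p)).
Proof.
move=> sf f0.
have sV : smooth (fun p => (2 * f p)^-1).
  apply: smoothV; first by apply: smoothM => //; exact: smooth_cst.
  by move=> p; rewrite mulf_neq0// gt_eqF.
apply: (@smooth_family unit (fun=> Num.sqrt)
  (fun _ x => Num.sqrt x * (2 * x)^-1) f sf _ _ tt).
- move=> _ p; have D := is_derive1_sqrt (f0 p); apply: is_derive_eq.
  have s0 : Num.sqrt (f p) != 0 by rewrite gt_eqF// sqrtr_gt0.
  rewrite -{3}(sqr_sqrtr (ltW (f0 p))); move: s0.
  by set q := Num.sqrt (f p) => s0; field.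
- move=> k H _; exact: (CkM (H tt) (sV k)).
Qed.

End SmoothCalculus.

(** * Complex-valued smooth functions *)

Notation cRe := complex.Re.
Notation cIm := complex.Im.

Section ComplexCalculus.
Context {R : realType}.
Implicit Types (z w : R[i]) (F G : R * R -> R[i]) (p v : R * R).

Lemma complex_ext z w : cRe z = cRe w -> cIm z = cIm w -> z = w.
Proof. by case: z w => [a b] [c d] /= -> ->. Qed.

Lemma cReD z w : cRe (z + w) = cRe z + cRe w. Proof. by case: z w => [? ?] []. Qed.
Lemma cImD z w : cIm (z + w) = cIm z + cIm w. Proof. by case: z w => [? ?] []. Qed.
Lemma cReN z : cRe (- z) = - cRe z. Proof. by case: z. Qed.
Lemma cImN z : cIm (- z) = - cIm z. Proof. by case: z. Qed.
Lemma cReB z w : cRe (z - w) = cRe z - cRe w. Proof. by rewrite cReD cReN. Qed.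
Lemma cImB z w : cIm (z - w) = cIm z - cIm w. Proof. by rewrite cImD cImN. Qed.
Lemma cReM z w : cRe (z * w) = cRe z * cRe w - cIm z * cIm w.
Proof. by case: z w => [? ?] []. Qed.
Lemma cImM z w : cIm (z * w) = cRe z * cIm w + cIm z * cRe w.
Proof. by case: z w => [? ?] []. Qed.

Definition cReIm := (cReD, cImD, cReN, cImN, cReM, cImM).

(** The squared modulus, which stays inside the real field and is
    polynomial in the components, so that estimates need no square roots. *)
Definition normsq z := cRe z ^+ 2 + cIm z ^+ 2.

Lemma normsq_ge0 z : 0 <= normsq z.
Proof. by rewrite addr_ge0// sqr_ge0. Qed.

Lemma normsq_gt0 z : z != 0 -> 0 < normsq z.
Proof.
move=> z0; rewrite lt_def normsq_ge0 andbT; apply: contra z0.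
rewrite paddr_eq0 ?sqr_ge0// !sqrf_eq0 => /andP[/eqP a /eqP b].
by apply/eqP/complex_ext; rewrite ?a ?b.
Qed.

Lemma normsqM z w : normsq (z * w) = normsq z * normsq w.
Proof. by rewrite /normsq cReM cImM; ring. Qed.

Lemma normsq1 : normsq (1 : R[i]) = 1.
Proof. by rewrite /normsq /= expr0n addr0 expr1n. Qed.

Lemma normsqV z : normsq z^-1 = (normsq z)^-1.
Proof.
have [->|z0] := eqVneq z 0; first by rewrite invr0 /normsq /= expr0n addr0 invr0.
apply: (@mulIf _ (normsq z)); first by rewrite gt_eqF// normsq_gt0.
by rewrite -normsqM mulVf// mulVf ?normsq1// gt_eqF// normsq_gt0.
Qed.

Lemma normc_sqr z : Normc.normc z ^+ 2 = normsq z.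
Proof. by case: z => a b /=; rewrite sqr_sqrtr// addr_ge0 ?sqr_ge0. Qed.

Lemma cReV z : cRe z^-1 = cRe z / normsq z. Proof. by case: z. Qed.
Lemma cImV z : cIm z^-1 = - (cIm z / normsq z). Proof. by case: z. Qed.

Lemma cexpD z w : cexp (z + w) = cexp z * cexp w.
Proof.
apply: complex_ext; rewrite /cexp cReD cImD expRD ?cReM ?cImM /= ?cosD ?sinD; ring.
Qed.

Lemma normsq_cexp z : normsq (cexp z) = expR (2 * cRe z).
Proof.
by rewrite /normsq /cexp /= !exprMn -mulrDr cos2Dsin2 mulr1 -expRM_natl mulr_natl.
Qed.

Definition csmooth F := smooth (fun p => cRe (F p)) /\ smooth (fun p => cIm (F p)).

Lemma csmooth_cst z : csmooth (fun=> z).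
Proof. by split; exact: smooth_cst. Qed.

Lemma csmoothD F G : csmooth F -> csmooth G -> csmooth (fun p => F p + G p).
Proof.
move=> [F1 F2] [G1 G2]; split; under eq_fun do rewrite ?cReD ?cImD; exact: smoothD.
Qed.

Lemma csmoothM F G : csmooth F -> csmooth G -> csmooth (fun p => F p * G p).
Proof.
move=> [F1 F2] [G1 G2]; split; under eq_fun do rewrite ?cReM ?cImM.
- by apply: smoothB; exact: smoothM.
- by apply: smoothD; exact: smoothM.
Qed.

Lemma csmooth_real (f : R * R -> R) : smooth f -> csmooth (fun p => (f p)%:C).
Proof. by move=> sf; split => //; exact: smooth_cst. Qed.

Lemma smooth_normsq F : csmooth F -> smooth (fun p => normsq (F p)).
Proof. by move=> [F1 F2]; apply: smoothD; rewrite /= ; under eq_fun do rewrite expr2; exact: smoothM. Qed.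

Lemma csmoothV F : csmooth F -> (forall p, F p != 0) -> csmooth (fun p => (F p)^-1).
Proof.
move=> sF F0; have sn : smooth (fun p => (normsq (F p))^-1).
  by apply: smoothV; [exact: smooth_normsq|move=> p; rewrite gt_eqF// normsq_gt0].
case: sF => F1 F2; split; under eq_fun do rewrite ?cReV ?cImV.
- exact: smoothM.
- by apply: smoothN; exact: smoothM.
Qed.

Lemma csmooth_cexp F : csmooth F -> csmooth (fun p => cexp (F p)).
Proof.
move=> [F1 F2]; have [c s] := smooth_cos_sin F2; have e := smooth_expR F1.
by split; exact: smoothM.
Qed.

Lemma csmooth_sum n (F : 'I_n -> R * R -> R[i]) : (forall j, csmooth (F j)) ->
  csmooth (fun p => \sum_(j < n) F j p).
Proof.
elim: n F => [|n IH] F sF.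
  by under eq_fun do rewrite big_ord0; exact: csmooth_cst.
by under eq_fun do rewrite big_ord_recr /=; apply: csmoothD => //; exact: IH.
Qed.

(** In the right half-plane the principal square root is smooth: its real
    part is the root of a positive function, and its imaginary part is
    recovered from the square. *)
Lemma sqrtc_re_gt0 z : 0 < cRe z ->
  [/\ cRe (sqrtc z) = Num.sqrt ((Num.sqrt (normsq z) + cRe z) / 2),
      0 < cRe (sqrtc z) & cIm (sqrtc z) = cIm z / (2 * cRe (sqrtc z))].
Proof.
move=> z0; have E : cRe (sqrtc z) = Num.sqrt ((Num.sqrt (normsq z) + cRe z) / 2).
  by case: z {z0} => a b.
have P : 0 < cRe (sqrtc z).
  by rewrite E sqrtr_gt0 divr_gt0// ltr_wpDl// sqrtr_ge0.
split => //; have := congr1 (@complex.Im R) (sqr_sqrtc z); rewrite expr2 cImM => <-.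
by field; rewrite gt_eqF.
Qed.

Lemma csmooth_sqrtc F : csmooth F -> (forall p, 0 < cRe (F p)) ->
  csmooth (fun p => sqrtc (F p)).
Proof.
move=> sF F0; have [F1 F2] := sF.
have sr : smooth (fun p => Num.sqrt (normsq (F p))).
  apply: smooth_sqrt; first exact: smooth_normsq.
  move=> p; apply: normsq_gt0; apply: contraTneq (F0 p) => ->.
  by rewrite ltxx.
have sR : smooth (fun p => cRe (sqrtc (F p))).
  have -> : (fun p => cRe (sqrtc (F p))) =
      (fun p => Num.sqrt ((Num.sqrt (normsq (F p)) + cRe (F p)) * 2^-1)).
    by apply/funext => p; have [] := sqrtc_re_gt0 (F0 p).
  apply: smooth_sqrt.
    by apply: smoothM; [exact: smoothD|exact: smooth_cst].
  by move=> p; rewrite divr_gt0// ltr_wpDl// sqrtr_ge0.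
split=> //.
have -> : (fun p => cIm (sqrtc (F p))) =
    (fun p => cIm (F p) * (2 * cRe (sqrtc (F p)))^-1).
  by apply/funext => p; have [_ _] := sqrtc_re_gt0 (F0 p).
apply: smoothM => //; apply: smoothV; first by apply: smoothM => //; exact: smooth_cst.
by move=> p; rewrite mulf_neq0//; have [_ /gt_eqF-> _] := sqrtc_re_gt0 (F0 p).
Qed.

Lemma csmooth_coord1 : csmooth (fun p => p.1%:C).
Proof. exact/csmooth_real/smooth_fst. Qed.

Lemma csmooth_coord2 : csmooth (fun p => p.2%:C).
Proof. exact/csmooth_real/smooth_snd. Qed.

Definition axis v := v = dir_x R \/ v = dir_t R.

Lemma smooth_is_derive (f : R * R -> R) p v : axis v -> smooth f ->
  is_derive p v f ('D_v f p).
Proof. by move=> [->|->] /smooth_derive[]. Qed.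

Lemma smooth_derive_axis (f : R * R -> R) v : axis v -> smooth f -> smooth ('D_v f).
Proof. by move=> [->|->] /smooth_derive[]. Qed.

Lemma csmooth_cderive F v : axis v -> csmooth F -> csmooth (cderive v F).
Proof. by move=> av [F1 F2]; split; exact: smooth_derive_axis. Qed.

Section Rules.
Variables (v : R * R) (av : axis v).

(** Reduces each rule for complex derivatives to the real rules on
    components. *)
Lemma cderive_eq F l p : is_derive p v (fun q => cRe (F q)) (cRe l) ->
  is_derive p v (fun q => cIm (F q)) (cIm l) -> cderive v F p = l.
Proof. by move=> [_ a] [_ b]; apply: complex_ext. Qed.

Lemma cderive_cst z p : cderive v (fun=> z) p = 0.
Proof. by apply: cderive_eq; exact: is_derive_cst. Qed.

Lemma cderive_coord1 p : cderive v (fun q => q.1%:C) p = v.1%:C.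
Proof. by apply: cderive_eq; [exact: is_derive_coord1|exact: is_derive_cst]. Qed.

Lemma cderive_coord2 p : cderive v (fun q => q.2%:C) p = v.2%:C.
Proof. by apply: cderive_eq; [exact: is_derive_coord2|exact: is_derive_cst]. Qed.

Lemma cderiveD F G p : csmooth F -> csmooth G ->
  cderive v (fun q => F q + G q) p = cderive v F p + cderive v G p.
Proof.
move=> [F1 F2] [G1 G2]; apply: cderive_eq; under eq_fun do rewrite ?cReD ?cImD.
- by rewrite cReD; apply: is_deriveD; exact: smooth_is_derive.
- by rewrite cImD; apply: is_deriveD; exact: smooth_is_derive.
Qed.

Lemma cderiveM F G p : csmooth F -> csmooth G ->
  cderive v (fun q => F q * G q) p = F p * cderive v G p + G p * cderive v F p.
Proof.
move=> [F1 F2] [G1 G2].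
have dF1 := smooth_is_derive p av F1; have dF2 := smooth_is_derive p av F2.
have dG1 := smooth_is_derive p av G1; have dG2 := smooth_is_derive p av G2.
apply: cderive_eq; under eq_fun do rewrite ?cReM ?cImM.
- apply: is_derive_eq (is_deriveB (is_deriveM_plane dF1 dG1)
    (is_deriveM_plane dF2 dG2)) _.
  by rewrite !cReIm /=; ring.
- apply: is_derive_eq (is_deriveD (is_deriveM_plane dF1 dG2)
    (is_deriveM_plane dF2 dG1)) _.
  by rewrite !cReIm /=; ring.
Qed.

Lemma cderiveZ z F p : csmooth F ->
  cderive v (fun q => z * F q) p = z * cderive v F p.
Proof.
move=> sF; rewrite cderiveM//; last exact: csmooth_cst.
by rewrite cderive_cst mulr0 addr0.
Qed.

Lemma cderive_sum n (F : 'I_n -> R * R -> R[i]) p : (forall j, csmooth (F j)) ->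
  cderive v (fun q => \sum_(j < n) F j q) p = \sum_(j < n) cderive v (F j) p.
Proof.
elim: n F => [|n IH] F sF.
  by under eq_fun do rewrite big_ord0; rewrite big_ord0 cderive_cst.
under eq_fun do rewrite big_ord_recr /=.
rewrite cderiveD ?IH ?big_ord_recr//.
exact: csmooth_sum.
Qed.

(** Differentiate [F * F^-1 = 1]. *)
Lemma cderiveV F p : csmooth F -> (forall q, F q != 0) ->
  cderive v (fun q => (F q)^-1) p = - cderive v F p / F p ^+ 2.
Proof.
move=> sF F0; have sV := csmoothV sF F0.
have /eqP : cderive v (fun q => F q * (F q)^-1) p = 0.
  by under eq_fun do rewrite divff//; exact: cderive_cst.
rewrite cderiveM// addr_eq0 => /eqP E.
apply: (mulfI (F0 p)); rewrite E; field; exact: F0.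
Qed.

Lemma cderive_cexp F p : csmooth F ->
  cderive v (fun q => cexp (F q)) p = cexp (F p) * cderive v F p.
Proof.
move=> [F1 F2].
have dF1 := smooth_is_derive p av F1; have dF2 := smooth_is_derive p av F2.
have dE := is_derive_scomp dF1 (is_derive_expR (cRe (F p))).
have dC := is_derive_scomp dF2 (is_derive_cos (cIm (F p))).
have dS := is_derive_scomp dF2 (is_derive_sin (cIm (F p))).
apply: cderive_eq.
- apply: is_derive_eq (is_deriveM_plane dE dC) _.
  by rewrite !cReIm /=; ring.
- apply: is_derive_eq (is_deriveM_plane dE dS) _.
  by rewrite !cReIm /=; ring.
Qed.

(** Differentiate [sqrtc F * sqrtc F = F], which avoids the explicit
    components of the square root. *)
Lemma cderive_sqrtc F p : csmooth F -> (forall q, 0 < cRe (F q)) ->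
  cderive v (fun q => sqrtc (F q)) p = cderive v F p / (2 * sqrtc (F p)).
Proof.
move=> sF F0; have sS := csmooth_sqrtc sF F0.
have S0 : sqrtc (F p) != 0.
  by have [_ + _] := sqrtc_re_gt0 (F0 p); apply: contraTneq => ->; rewrite ltxx.
have <- : cderive v (fun q => sqrtc (F q) * sqrtc (F q)) p = cderive v F p.
  have -> // : (fun q => sqrtc (F q) * sqrtc (F q)) = F.
  by apply/funext => q; rewrite -expr2 sqr_sqrtc.
by rewrite cderiveM//; field.
Qed.

End Rules.
End ComplexCalculus.

(** * Gaussian kernels of complex variance *)

Section Kernel.
Context {R : realType}.
Implicit Types (x y t : R) (p : R * R).

(** A common Gaussian majorant on every bounded time interval: it provides
    the dominating functions of all limits under the integral sign. *)
Definition gauss_bounded (c : R) (F : R * R -> R[i]) := forall T : R,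
  exists C d : R, [/\ 0 < C, 0 < d & forall x t, `|t| <= T ->
    normsq (F (x, t)) <= C * expR (- (d * (x - c) ^+ 2))].

Lemma normsqD_le (z w : R[i]) : normsq (z + w) <= 2 * normsq z + 2 * normsq w.
Proof.
rewrite /normsq !cReIm.
have := sqr_ge0 (cRe z - cRe w); have := sqr_ge0 (cIm z - cIm w).
by nra.
Qed.

Lemma gauss_bounded0 c : gauss_bounded c (fun=> 0).
Proof.
move=> T; exists 1, 1; split => // x t _.
by rewrite /normsq /= expr0n addr0 mul1r expR_ge0.
Qed.

Lemma gauss_boundedD c F G : gauss_bounded c F -> gauss_bounded c G ->
  gauss_bounded c (fun p => F p + G p).
Proof.
move=> bF bG T; have [C [d [C0 d0 CF]]] := bF T; have [C' [d' [C0' d0' CG]]] := bG T.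
exists (2 * C + 2 * C'), (Num.min d d'); split.
- by rewrite addr_gt0// mulr_gt0.
- by rewrite lt_min d0.
move=> x t tT; apply: (le_trans (normsqD_le _ _)); rewrite [X in _ <= X]mulrDl -!mulrA.
have E e : Num.min d d' <= e ->
    expR (- (e * (x - c) ^+ 2)) <= expR (- (Num.min d d' * (x - c) ^+ 2)).
  by move=> le; rewrite ler_expR lerN2 ler_wpM2r// sqr_ge0.
apply: lerD; rewrite ler_pM2l//.
- by apply: (le_trans (CF _ _ tT)); rewrite ler_pM2l// E// ge_min lexx.
- by apply: (le_trans (CG _ _ tT)); rewrite ler_pM2l// E// ge_min lexx orbT.
Qed.

(** The factor is [normsq z + 1] so that the constant stays positive for [z
    = 0]. *)
Lemma gauss_boundedZ c z F : gauss_bounded c F -> gauss_bounded c (fun p => z * F p).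
Proof.
move=> bF T; have [C [d [C0 d0 CF]]] := bF T.
exists ((normsq z + 1) * C), d; split => //.
  by rewrite mulr_gt0// ltr_wpDl// normsq_ge0.
move=> x t tT; rewrite normsqM -mulrA.
apply: ler_pM; rewrite ?normsq_ge0//; first by rewrite lerDl.
exact: CF.
Qed.

Lemma gauss_bounded_sum c n (F : 'I_n -> R * R -> R[i]) :
  (forall j, gauss_bounded c (F j)) ->
  gauss_bounded c (fun p => \sum_(j < n) F j p).
Proof.
elim: n F => [|n IH] F bF.
  by under eq_fun do rewrite big_ord0; exact: gauss_bounded0.
under eq_fun do rewrite big_ord_recr /=.
by exact: (gauss_boundedD (IH _ (fun j => bF (widen_ord (leqnSn n) j))) (bF _)).
Qed.

Variables (sigma beta gamma c eta : R).
Hypothesis sigma_gt0 : 0 < sigma.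

Definition kvar t : R[i] := sigma +i* (beta + gamma * t).
Definition karg x : R[i] := (x - c) +i* (- eta).

(** The complex heat kernel: a Gaussian of complex variance [kvar t]
    centred at the complex point [c + i eta]. Since the variance has the
    positive real part [sigma], its principal root is smooth and never
    vanishes. *)
Definition kernel p : R[i] :=
  cexp (- (karg p.1 ^+ 2 / (2 * kvar p.2))) / sqrtc (kvar p.2).

Lemma kvar_neq0 t : kvar t != 0.
Proof. by rewrite eq_complex /= gt_eqF. Qed.

Lemma sqrtc_kvar_neq0 t : sqrtc (kvar t) != 0.
Proof. by rewrite sqrtc_eq0 kvar_neq0. Qed.

Lemma csmooth_karg : csmooth (fun p => karg p.1).
Proof.
split; last exact: smooth_cst.
by apply: smoothB; [exact: smooth_fst|exact: smooth_cst].
Qed.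

Lemma csmooth_kvar : csmooth (fun p => kvar p.2).
Proof.
split; first exact: smooth_cst.
apply: smoothD; first exact: smooth_cst.
by apply: smoothM; [exact: smooth_cst|exact: smooth_snd].
Qed.

Lemma csmooth_kvarV : csmooth (fun p => (kvar p.2)^-1).
Proof. by apply: csmoothV; [exact: csmooth_kvar|move=> p; exact: kvar_neq0]. Qed.

Lemma csmooth_ksqrt : csmooth (fun p => sqrtc (kvar p.2)).
Proof. by apply: csmooth_sqrtc; [exact: csmooth_kvar|]. Qed.

Lemma csmooth_ksqrtV : csmooth (fun p => (sqrtc (kvar p.2))^-1).
Proof.
by apply: csmoothV; [exact: csmooth_ksqrt|move=> p; exact: sqrtc_kvar_neq0].
Qed.

(** The exponent of the kernel in product form, to which the product and
    inverse rules apply directly. *)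
Definition kexp p : R[i] := (- 2^-1) * ((karg p.1 * karg p.1) * (kvar p.2)^-1).

Lemma csmooth_kargM : csmooth (fun p => karg p.1 * karg p.1).
Proof. by apply: csmoothM; exact: csmooth_karg. Qed.

Lemma csmooth_kexp0 : csmooth (fun p => (karg p.1 * karg p.1) * (kvar p.2)^-1).
Proof. by apply: csmoothM; [exact: csmooth_kargM|exact: csmooth_kvarV]. Qed.

Lemma csmooth_kexp : csmooth kexp.
Proof. by apply: csmoothM; [exact: csmooth_cst|exact: csmooth_kexp0]. Qed.

Lemma kernelE : kernel = (fun p => cexp (kexp p) * (sqrtc (kvar p.2))^-1).
Proof.
apply/funext => p; rewrite /kernel /kexp; congr (cexp _ / _).
by have := kvar_neq0 p.2; set s := kvar _; set z := karg _ => s0; field.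
Qed.

Lemma csmooth_kernel : csmooth kernel.
Proof.
rewrite kernelE; apply: csmoothM; last exact: csmooth_ksqrtV.
exact/csmooth_cexp/csmooth_kexp.
Qed.

Lemma cderive_karg v p : axis v -> cderive v (fun q => karg q.1) p = v.1%:C.
Proof.
move=> av.
have -> : (fun q : R * R => karg q.1) = (fun q => q.1%:C + - (c +i* eta)).
  by apply/funext => q; apply: complex_ext => //=; rewrite sub0r.
rewrite cderiveD ?cderive_coord1 ?cderive_cst ?addr0//.
- exact: csmooth_coord1.
- exact: csmooth_cst.
Qed.

Lemma cderive_kvar v p : axis v ->
  cderive v (fun q => kvar q.2) p = (0 +i* gamma) * v.2%:C.
Proof.
move=> av.
have -> : (fun q : R * R => kvar q.2) =
    (fun q => (sigma +i* beta) + (0 +i* gamma) * q.2%:C).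
  by apply/funext => q; apply: complex_ext; rewrite !cReIm /=; ring.
have sc := csmooth_coord2 (R := R).
rewrite cderiveD ?cderive_cst ?add0r//.
- by rewrite cderiveZ// cderive_coord2.
- exact: csmooth_cst.
- by apply: csmoothM => //; exact: csmooth_cst.
Qed.

Lemma cderive_kernel v p : axis v -> cderive v kernel p = kernel p *
  (- (karg p.1 / kvar p.2) * v.1%:C + (karg p.1 ^+ 2 / (2 * kvar p.2 ^+ 2)
     - (2 * kvar p.2)^-1) * ((0 +i* gamma) * v.2%:C)).
Proof.
move=> av; rewrite kernelE.
rewrite (cderiveM av _ (csmooth_cexp csmooth_kexp) csmooth_ksqrtV).
rewrite (cderiveV av _ csmooth_ksqrt (fun q => sqrtc_kvar_neq0 q.2)).
rewrite (cderive_sqrtc av _ csmooth_kvar (fun=> sigma_gt0)).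
rewrite (cderive_cexp av _ csmooth_kexp).
rewrite (cderiveZ av _ _ csmooth_kexp0).
rewrite (cderiveM av _ csmooth_kargM csmooth_kvarV).
rewrite (cderiveM av _ csmooth_karg csmooth_karg).
rewrite (cderiveV av _ csmooth_kvar (fun q => kvar_neq0 q.2)).
rewrite !(cderive_karg _ av) !(cderive_kvar _ av).
have := sqr_sqrtc (kvar p.2); have := sqrtc_kvar_neq0 p.2.
set s := sqrtc (kvar p.2); set z := karg p.1; set E := cexp _.
set a := v.1%:C; set b := _ * _%:C => s0 <-.
by field.
Qed.

Lemma cderive_kernel_x : cderive (dir_x R) kernel =
  (fun p => - 1 * (karg p.1 * (kvar p.2)^-1 * kernel p)).
Proof.
apply/funext => p; rewrite cderive_kernel; last by left.
by rewrite !dir_xE mulr0 mulr0 addr0 mulr1; ring.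
Qed.

Lemma cderive_kernel_xx p : cderive (dir_x R) (cderive (dir_x R) kernel) p =
  (karg p.1 ^+ 2 / kvar p.2 ^+ 2 - (kvar p.2)^-1) * kernel p.
Proof.
have ax : axis (dir_x R) by left.
have szs : csmooth (fun p => karg p.1 * (kvar p.2)^-1).
  by apply: csmoothM; [exact: csmooth_karg|exact: csmooth_kvarV].
rewrite cderive_kernel_x (cderiveZ ax _ _ (csmoothM szs csmooth_kernel)).
rewrite (cderiveM ax _ szs csmooth_kernel) cderive_kernel_x.
rewrite (cderiveM ax _ csmooth_karg csmooth_kvarV).
rewrite (cderiveV ax _ csmooth_kvar (fun q => kvar_neq0 q.2)).
rewrite (cderive_karg _ ax) (cderive_kvar _ ax) !dir_xE.
by have := kvar_neq0 p.2; set s := kvar _ => s0; rewrite mulr0; field.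
Qed.

(** The heat equation with an imaginary diffusion constant: the time
    derivative acts through the variance only, and [d/ds] of the kernel is
    half its second space derivative. *)
Lemma cderive_kernel_t p : cderive (dir_t R) kernel p =
  (0 +i* (gamma / 2)) * cderive (dir_x R) (cderive (dir_x R) kernel) p.
Proof.
rewrite cderive_kernel_xx cderive_kernel; last by right.
rewrite !dir_tE mulr0 add0r mulr1.
have -> : 0 +i* gamma = 2 * (0 +i* (gamma / 2)) :> R[i].
  by apply: complex_ext; rewrite !cReIm /=; field.
by have := kvar_neq0 p.2; set s := kvar _ => s0; field.
Qed.

Lemma normsq_sqrtc_kvar t : sigma <= normsq (sqrtc (kvar t)).
Proof.
have E : normsq (sqrtc (kvar t)) ^+ 2 = sigma ^+ 2 + (beta + gamma * t) ^+ 2.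
  by rewrite expr2 -normsqM -expr2 sqr_sqrtc.
have S0 : 0 <= sigma by exact: ltW.
by rewrite -ler_sqr ?nnegrE ?normsq_ge0// E lerDl sqr_ge0.
Qed.

(** The squared modulus of the exponential is [exp (- (sigma (y^2 - eta^2)
    - 2 y eta tau) / (sigma^2 + tau^2))] with [y = x - c] and [tau = beta +
    gamma t]; the cross term is absorbed by completing a square, at the
    price of half the coefficient of [y^2]. *)
Lemma gauss_bounded_kernel : gauss_bounded c kernel.
Proof.
move=> T; pose M := (`|beta| + `|gamma| * T) ^+ 2.
have M0 : 0 <= M by exact: sqr_ge0.
(* [A] bounds the part of the exponent that does not involve [x], after the
   cross term has been split; [M] bounds [tau^2]. *)
pose A := eta ^+ 2 * (sigma + 2 * M / sigma) / sigma ^+ 2.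
exists (sigma^-1 * expR A), (sigma / (2 * (sigma ^+ 2 + M))); split.
- by rewrite mulr_gt0// ?invr_gt0// expR_gt0.
- by rewrite divr_gt0// mulr_gt0// ltr_pwDl// exprn_gt0.
move=> x t tT; set y := x - c; set tau := beta + gamma * t.
have tauM : tau ^+ 2 <= M.
  rewrite -real_normK ?num_real// ler_sqr ?nnegrE//.
    apply: (le_trans (ler_normD _ _)); rewrite lerD2l normrM.
    by rewrite ler_wpM2l.
  by rewrite addr_ge0// mulr_ge0// (le_trans _ tT).
rewrite kernelE normsqM normsqV normsq_cexp [X in X <= _]mulrC.
rewrite -[X in _ <= X]mulrA -expRD.
apply: ler_pM.
- by rewrite invr_ge0 normsq_ge0.
- exact: expR_ge0.
- by rewrite lef_pV2 ?posrE// ?normsq_sqrtc_kvar// (lt_le_trans _ (normsq_sqrtc_kvar t)).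
have D0 : 0 < sigma ^+ 2 + tau ^+ 2 by rewrite ltr_pwDl ?sqr_ge0// exprn_gt0.
have -> : 2 * cRe (kexp (x, t)) =
    - ((sigma * (y ^+ 2 - eta ^+ 2) - 2 * y * eta * tau) / (sigma ^+ 2 + tau ^+ 2)).
  have E1 : cRe (- 2^-1 : R[i]) = - 2^-1 by rewrite cReN cReV /normsq /=; field.
  have E2 : cIm (- 2^-1 : R[i]) = 0 by rewrite cImN cImV /normsq /=; field.
  rewrite /kexp cReM E1 E2 mul0r subr0 cReM cReV cImV.
  have -> : normsq (kvar (x, t).2) = sigma ^+ 2 + tau ^+ 2 by [].
  rewrite cReM cImM /= -/y -/tau.
  by field; rewrite gt_eqF.
rewrite ler_expR -lerN2 opprK opprB.
have S0 := sigma_gt0.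
have SV : 0 <= sigma^-1 by rewrite invr_ge0 ltW.
have key : sigma * y ^+ 2 / 2 - eta ^+ 2 * (sigma + 2 * M / sigma) <=
    sigma * (y ^+ 2 - eta ^+ 2) - 2 * y * eta * tau.
  have : 0 <= (sigma * y - 2 * eta * tau) ^+ 2 / (2 * sigma).
    by rewrite divr_ge0 ?sqr_ge0// mulr_ge0// ltW.
  have -> : (sigma * y - 2 * eta * tau) ^+ 2 / (2 * sigma) =
    sigma * y ^+ 2 / 2 - 2 * y * eta * tau + eta ^+ 2 * (2 * tau ^+ 2 / sigma).
    by field; rewrite gt_eqF.
  have : eta ^+ 2 * (2 * tau ^+ 2 / sigma) <= eta ^+ 2 * (2 * M / sigma).
    by rewrite ler_wpM2l ?sqr_ge0// ler_wpM2r// ler_pM2l.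
  by move=> H1 H2; lra.
apply: (@le_trans _ _ ((sigma * y ^+ 2 / 2 - eta ^+ 2 * (sigma + 2 * M / sigma))
   / (sigma ^+ 2 + tau ^+ 2))); last by rewrite ler_pM2r// invr_gt0.
rewrite mulrBl; apply: lerB.
- have -> : sigma / (2 * (sigma ^+ 2 + M)) * y ^+ 2 =
     sigma * y ^+ 2 / 2 / (sigma ^+ 2 + M).
    by field; rewrite gt_eqF// ltr_pwDl// exprn_gt0.
  rewrite ler_wpM2l//.
    by rewrite divr_ge0// mulr_ge0 ?sqr_ge0// ltW.
  by rewrite lef_pV2 ?posrE// ?lerD2l// ltr_pwDl// exprn_gt0.
- rewrite /A ler_wpM2l//.
    apply: mulr_ge0; first exact: sqr_ge0.
    by apply: addr_ge0; [exact: ltW|apply: mulr_ge0 => //; exact: mulr_ge0].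
  by rewrite lef_pV2 ?posrE// ?lerDl ?sqr_ge0// exprn_gt0.
Qed.

(** The derivative is the kernel times an affine function of [x]; half of
    the Gaussian decay absorbs this factor, because [d y^2 / 2 <= exp (d
    y^2 / 2)]. *)
Lemma gauss_bounded_kernel_x : gauss_bounded c (cderive (dir_x R) kernel).
Proof.
move=> T; have [C [d [C0 d0 CK]]] := gauss_bounded_kernel T.
have S0 := sigma_gt0.
exists (sigma ^- 2 * (2 / d + eta ^+ 2) * C), (d / 2); split.
- rewrite mulr_gt0// mulr_gt0 ?invr_gt0 ?exprn_gt0//.
  by rewrite ltr_pwDl ?sqr_ge0// divr_gt0.
- by rewrite divr_gt0.
move=> x t tT; rewrite cderive_kernel_x normsqM.
have -> : normsq (-1 : R[i]) = 1 by rewrite /normsq /=; ring.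
rewrite mul1r normsqM [X in X * _ <= _]normsqM normsqV; set y := x - c.
have -> : expR (- (d / 2 * y ^+ 2)) =
    expR (d / 2 * y ^+ 2) * expR (- (d * y ^+ 2)).
  by rewrite -expRD; congr expR; field.
rewrite [X in _ <= X](_ : _ = sigma ^- 2 * (2 / d + eta ^+ 2) *
   expR (d / 2 * y ^+ 2) * (C * expR (- (d * y ^+ 2)))); last by ring.
apply: ler_pM; rewrite ?normsq_ge0//; last exact: CK.
  by rewrite mulr_ge0// ?invr_ge0 normsq_ge0.
rewrite [X in _ <= X](_ : _ = (2 / d + eta ^+ 2) * expR (d / 2 * y ^+ 2) * sigma ^- 2);
  last by ring.
apply: ler_pM; rewrite ?invr_ge0 ?normsq_ge0//.
- rewrite /normsq /= sqrrN -/y mulrDl.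
  have yd : 0 <= d / 2 * y ^+ 2 by rewrite mulr_ge0 ?sqr_ge0// divr_ge0// ltW.
  have e1 := expR_ge1Dx (d / 2 * y ^+ 2).
  apply: lerD.
  + rewrite -ler_pdivrMl ?divr_gt0// invf_div (le_trans _ e1)//.
    by rewrite lerDr.
  + by rewrite ler_peMr ?sqr_ge0// (le_trans _ e1)// lerDl.
- by rewrite lef_pV2 ?posrE ?exprn_gt0 ?normsq_gt0 ?kvar_neq0// lerDl sqr_ge0.
Qed.

End Kernel.

(** * Integrable and square-integrable functions on the line *)

Section LebesgueLine.
Context {R : realType}.
Local Notation mu := (@lebesgue_measure R).
Implicit Types (f g h : R -> R).

(** Integrability of real functions on the whole line; complex integrals
    are handled through their two components. *)
Definition L1 f := mu.-integrable setT (EFin \o f).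
Definition rint f : R := (\int[mu]_x f x)%R.

Lemma L1_measurable f : L1 f -> measurable_fun setT f.
Proof. by move=> /integrableP[/measurable_EFinP]. Qed.

Lemma L1D f g : L1 f -> L1 g -> L1 (fun x => f x + g x).
Proof. by move=> If Ig; apply: eq_integrable (integrableD _ If Ig). Qed.

Lemma L1B f g : L1 f -> L1 g -> L1 (fun x => f x - g x).
Proof. by move=> If Ig; apply: eq_integrable (integrableB _ If Ig). Qed.

Lemma L1Z (k : R) f : L1 f -> L1 (fun x => k * f x).
Proof. by move=> If; apply: eq_integrable (integrableZl _ k If). Qed.

Lemma L10 : L1 (fun=> 0).
Proof. exact: integrable0. Qed.

Lemma L1_le f g : measurable_fun setT f -> (forall x, `|f x| <= g x) -> L1 g -> L1 f.
Proof.
move=> mf fg Ig; apply: le_integrable (Ig) => //; first exact/measurable_EFinP.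
by move=> x _ /=; rewrite lee_fin (le_trans (fg x))// ler_norm.
Qed.

Lemma L1_norm f : L1 f -> L1 (fun x => `|f x|).
Proof. by move=> If; exact: (integrable_norm If). Qed.

Lemma rintD f g : L1 f -> L1 g -> rint (fun x => f x + g x) = rint f + rint g.
Proof. by move=> If Ig; exact: RintegralD. Qed.

Lemma rintB f g : L1 f -> L1 g -> rint (fun x => f x - g x) = rint f - rint g.
Proof. by move=> If Ig; exact: RintegralB. Qed.

Lemma rintZ (k : R) f : L1 f -> rint (fun x => k * f x) = k * rint f.
Proof. by move=> If; exact: RintegralZl. Qed.

Lemma rintN f : L1 f -> rint (fun x => - f x) = - rint f.
Proof.
move=> If; rewrite -mulN1r -rintZ//; congr rint; apply/funext => x.
by rewrite mulN1r.
Qed.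

Lemma rint0 : rint (fun=> 0) = 0.
Proof. by rewrite /rint /Rintegral integral0. Qed.

Lemma rint_le f g : L1 f -> L1 g -> (forall x, f x <= g x) -> rint f <= rint g.
Proof. by move=> If Ig fg; apply: le_Rintegral. Qed.

Lemma rint_ge0 f : (forall x, 0 <= f x) -> 0 <= rint f.
Proof. by move=> f0; exact: Rintegral_ge0. Qed.

Lemma rint_norm f : L1 f -> `|rint f| <= rint (fun x => `|f x|).
Proof. by move=> If; exact: le_normr_Rintegral. Qed.

Lemma rint_norm_le f g : L1 f -> L1 g -> (forall x, `|f x| <= g x) ->
  `|rint f| <= rint g.
Proof.
move=> If Ig fg; apply: (le_trans (rint_norm If)).
by apply: rint_le => //; exact: L1_norm.
Qed.

Lemma rint_ae f g : L1 f -> L1 g -> {ae mu, forall x, f x = g x} -> rint f = rint g.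
Proof.
move=> If Ig fg; rewrite /rint /Rintegral; congr fine.
apply: ae_eq_integral => //.
- exact: measurable_int If.
- exact: measurable_int Ig.
- case: fg => N [mN N0 sub]; exists N; split => // x /= nfg; apply: sub => /= fgx.
  by apply: nfg => _; rewrite fgx.
Qed.

Lemma continuous_measurable f : continuous f -> measurable_fun setT f.
Proof. exact: continuous_measurable_fun. Qed.

Lemma L1_segment f (a b : R) : continuous f ->
  L1 (f \_ `[a, b]).
Proof.
move=> cf; have Iab : mu.-integrable `[a, b] (EFin \o f).
  apply: continuous_compact_integrable; first exact: segment_compact.
  exact: continuous_subspaceT.
rewrite /L1 -restrict_EFin.
by apply: (proj1 (integrable_mkcond _ _)).
Qed.

Lemma restrict_supported f (M a : R) : (forall x, M < `|x| -> f x = 0) -> M <= a ->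
  f \_ `[- a, a] = f.
Proof.
move=> f0 Ma; apply/funext => x; rewrite patchE; case: ifPn => //.
rewrite notin_setE /= in_itv /= -ler_norml => /negP; rewrite -ltNge => xa.
by rewrite f0// (le_lt_trans Ma).
Qed.

Lemma L1_compact f (M : R) : continuous f -> (forall x, M < `|x| -> f x = 0) -> L1 f.
Proof.
by move=> cf f0; rewrite -(restrict_supported f0 (lexx M)); exact: L1_segment.
Qed.

Lemma rint_segment f (M a : R) : (forall x, M < `|x| -> f x = 0) -> M <= a ->
  rint f = (\int[mu]_(x in `[(- a)%R, a]) f x)%R.
Proof. by move=> f0 Ma; rewrite Rintegral_mkcond (restrict_supported f0 Ma). Qed.

Lemma rint_FTC h h' (a b : R) : a < b -> (forall x : R, is_derive x 1 h (h' x)) ->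
  continuous h' -> (\int[mu]_(x in `[a, b]) h' x)%R = h b - h a.
Proof.
move=> ab dh ch'; rewrite /Rintegral (@continuous_FTC2 _ h' h)//.
- exact: continuous_subspaceT.
- have ch : continuous h.
    by move=> x; apply/differentiable_continuous/derivable1_diffP; have [] := dh x.
  split.
  + by move=> x _; have [] := dh x.
  + exact/cvg_at_right_filter/ch.
  + exact/cvg_at_left_filter/ch.
- by move=> x _; rewrite derive1E; have [] := dh x.
Qed.

Lemma derive_supported h h' (M : R) : (forall x : R, is_derive x 1 h (h' x)) ->
  (forall x, M < `|x| -> h x = 0) -> forall x, M < `|x| -> h' x = 0.
Proof.
move=> dh h0 x xM; have [dx <-] := dh x.
rewrite -(derive_cst (0 : R) x 1); apply: near_eq_derive.
have : \forall y \near x, M < `|y|.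
  by have := @norm_continuous _ _ x; move=> /cvgr_gt; apply.
by apply: filterS => y /h0.
Qed.

(** The boundary terms of an integration by parts vanish by compact
    support. *)
Lemma rint_derive_compact h h' (M : R) : (forall x : R, is_derive x 1 h (h' x)) ->
  continuous h' -> (forall x, M < `|x| -> h x = 0) -> rint h' = 0.
Proof.
move=> dh ch' h0; have M1 : M < `|M| + 1 by rewrite (le_lt_trans (ler_norm _))// ltrDl.
have M0 : 0 < `|M| + 1 by rewrite ltr_wpDl.
rewrite (rint_segment (derive_supported dh h0) (ltW M1)) (rint_FTC _ dh ch').
  by rewrite !h0 ?subr0// ?normrN gtr0_norm.
by rewrite gtrN.
Qed.

(** Up to a positive constant this is the density of a normal law. *)
Lemma L1_gauss (d c : R) : 0 < d -> L1 (fun x => expR (- (d * (x - c) ^+ 2))).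
Proof.
move=> d0; (* The standard deviation for which [1 / (2 s^2) = d]. *)
pose s : R := Num.sqrt (2 * d)^-1.
have s2 : s ^+ 2 = (2 * d)^-1 by rewrite sqr_sqrtr// invr_ge0 mulr_ge0// ltW.
have s0 : s != 0 by rewrite gt_eqF// sqrtr_gt0 invr_gt0 mulr_gt0.
have := L1Z (normal_peak s)^-1 (integrable_normal_pdf c s).
apply: eq_integrable => // x _ /=; congr EFin.
rewrite normal_pdfE// mulrA mulVf ?mul1r ?gt_eqF ?normal_peak_gt0//.
rewrite /normal_fun; congr expR; rewrite s2 -mulr_natr.
by field; rewrite gt_eqF.
Qed.

Definition L2 f := f \in Lfun mu 2%:E.

Lemma L2_measurable f : L2 f -> measurable_fun setT f.
Proof. by rewrite /L2 inE => /andP[/[!inE]]. Qed.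

Lemma L2_sqr f : L2 f -> L1 (fun x => f x ^+ 2).
Proof. exact: Lfun2_integrable_sqr. Qed.

(** The converse of [L2_sqr], for functions known to be measurable. *)
Lemma L2P f : measurable_fun setT f -> L1 (fun x => f x ^+ 2) -> L2 f.
Proof.
move=> mf /integrableP[_ f2]; rewrite /L2 inE; apply/andP; split; rewrite inE//=.
rewrite /finite_norm unlock; apply: poweR_lty.
apply: le_lt_trans f2; apply: ge0_le_integral => //.
- by move=> x _; exact: poweR_ge0.
- apply/measurable_EFinP.
  apply: (@measurableT_comp _ _ _ _ _ _ (fun x : R => x `^ 2)) => //.
  exact: measurableT_comp.
- apply: measurableT_comp => //; apply/measurable_EFinP.
  exact: measurable_funX.
- by move=> x _ /=; rewrite lee_fin normrX powR_mulrn.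
Qed.

Lemma L2_mul f g : L2 f -> L2 g -> L1 (fun x => f x * g x).
Proof. by move=> f2 g2; have /Lfun1_integrable := Lfun2_mul_Lfun1 f2 g2. Qed.

Lemma L2D f g : L2 f -> L2 g -> L2 (fun x => f x + g x).
Proof.
move=> f2 g2; have mf := L2_measurable f2; have mg := L2_measurable g2.
apply: L2P; first exact: measurable_funD.
apply: (L1_le (g := fun x => 2 * f x ^+ 2 + 2 * g x ^+ 2)).
- exact/measurable_funX/measurable_funD.
- move=> x; rewrite ger0_norm ?sqr_ge0//.
  by have := sqr_ge0 (f x - g x); nra.
- by apply: L1D; apply: L1Z; exact: L2_sqr.
Qed.

Lemma L2Z (k : R) f : L2 f -> L2 (fun x => k * f x).
Proof.
move=> f2; have mf := L2_measurable f2; apply: L2P.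
  exact: measurable_funM.
under eq_fun do rewrite exprMn.
exact/L1Z/L2_sqr.
Qed.

Lemma L2B f g : L2 f -> L2 g -> L2 (fun x => f x - g x).
Proof.
move=> f2 g2; have := L2D f2 (L2Z (-1) g2).
by under eq_fun do rewrite mulN1r.
Qed.

Lemma L2_compact f (M : R) : continuous f -> (forall x, M < `|x| -> f x = 0) -> L2 f.
Proof.
move=> cf f0; apply: L2P; first exact: continuous_measurable.
apply: (L1_compact (M := M)).
- by move=> x; under eq_fun do rewrite expr2; exact: cvgM (cf x) (cf x).
- by move=> x /f0->; rewrite expr0n.
Qed.

Lemma L2_gauss (d c : R) : 0 < d -> L2 (fun x => expR (- (d * (x - c) ^+ 2))).
Proof.
move=> d0; apply: L2P; first by apply: L1_measurable; exact: L1_gauss.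
under eq_fun do rewrite expr2 -expRD -opprD -mulrDl.
by apply: L1_gauss; rewrite addr_gt0.
Qed.

End LebesgueLine.

(** * Pairing curves in L^2 with functions of the plane *)

Section Pairings.
Context {R : realType}.
Local Notation mu := (@lebesgue_measure R).
Implicit Types (u : R -> R -> R) (f : R * R -> R).

(** The quadratic polynomial [s |-> int (f - s g)^2] is nonnegative, so its
    discriminant is not positive. *)
Lemma cauchy_schwarz (f g : R -> R) : L2 f -> L2 g ->
  (rint (fun x => f x * g x)) ^+ 2 <=
  rint (fun x => f x ^+ 2) * rint (fun x => g x ^+ 2).
Proof.
move=> f2 g2; have If := L2_sqr f2; have Ig := L2_sqr g2; have Ifg := L2_mul f2 g2.
set A := rint (fun x => f x ^+ 2); set B := rint _; set C := rint (fun x => g x ^+ 2).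
have C0 : 0 <= C by apply: rint_ge0 => x; exact: sqr_ge0.
have Q (s : R) : 0 <= A - 2 * s * B + s ^+ 2 * C.
  have -> : A - 2 * s * B + s ^+ 2 * C = rint (fun x => (f x - s * g x) ^+ 2).
    rewrite -!rintZ// -rintB//; last exact: L1Z.
    rewrite -rintD//; [|by apply: L1B => //; exact: L1Z|exact: L1Z].
    by congr rint; apply/funext => x; ring.
  by apply: rint_ge0 => x; exact: sqr_ge0.
have [C_eq0|C_neq0] := eqVneq C 0.
  have [->|B0] := eqVneq B 0; first by rewrite expr0n /= C_eq0 mulr0.
  (* Here the polynomial is affine in [s]; this [s] would make it equal to [-1]. *)
  have := Q ((A + 1) / (2 * B)); rewrite C_eq0 mulr0 addr0.
  have -> : 2 * ((A + 1) / (2 * B)) * B = A + 1 by field.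
  by rewrite opprD addrA subrr sub0r lerNr oppr0 ler10.
have Cp : 0 < C by rewrite lt_def C_neq0.
have := Q (B / C).
have -> : A - 2 * (B / C) * B + (B / C) ^+ 2 * C = A - B ^+ 2 / C by field.
by rewrite subr_ge0 ler_pdivrMr.
Qed.

Lemma continuous_slice_x f t : continuous f -> continuous (fun x => f (x, t)).
Proof.
move=> cf x.
have P : (fun y : R => (y, t)) @ nbhs x --> (nbhs x, nbhs t).
  by apply: cvg_pair; [exact: cvg_id|exact: cvg_cst].
exact: (cvg_comp _ f P (cf (x, t))).
Qed.

Lemma continuous_slice_t f x : continuous f -> continuous (fun t => f (x, t)).
Proof.
move=> cf t.
have P : (fun s : R => (x, s)) @ nbhs t --> (nbhs x, nbhs t).
  by apply: cvg_pair; [exact: cvg_cst|exact: cvg_id].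
exact: (cvg_comp _ f P (cf (x, t))).
Qed.

(** Compactness of the box [[-M, M] * [-T, T]]. *)
Lemma box_bounded f (M T : R) : continuous f -> exists2 C : R, 0 <= C &
  forall x t, `|x| <= M -> `|t| <= T -> `|f (x, t)| <= C.
Proof.
move=> cf.
have K : compact ((`[(- M)%R, M] : set R) `*` (`[(- T)%R, T] : set R)).
  by apply: compact_setX; exact: segment_compact.
have [D [Dr HD]] := compact_bounded (continuous_compact (continuous_subspaceT cf) K).
exists (`|D| + 1) => [|x t xM tT]; first by rewrite addr_ge0.
apply: (HD (`|D| + 1)); first by rewrite (le_lt_trans (ler_norm _))// ltrDl.
by exists (x, t) => //; split; rewrite /= in_itv /= -ler_norml.
Qed.

(** The real version of a continuous curve in L^2, with the square of the
    norm in place of the norm. *)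
Definition cL2 u := (forall t, L2 (u ^~ t)) /\
  forall t0, rint (fun x => (u x t - u x t0) ^+ 2) @[t --> t0] --> 0.

Definition xsupported (M : R) f := forall x t, M < `|x| -> f (x, t) = 0.

Definition supported (M : R) f :=
  forall x t, M < `|x| \/ M < `|t| -> f (x, t) = 0.

Lemma supported_x M f : supported M f -> xsupported M f.
Proof. by move=> sf x t xM; apply: sf; left. Qed.

(** The indicator function of [[-M, M]], as an integrable dominating
    function for functions supported there. *)
Definition boxf (M x : R) : R := if `|x| <= M then 1 else 0.

Lemma L1_boxf M : L1 (boxf M).
Proof.
have -> : boxf M = (fun=> 1 : R) \_ `[(- M)%R, M]; last first.
  by apply: L1_segment => x; exact: cvg_cst.
apply/funext => x; rewrite patchE /boxf ler_norml; case: ifPn => xM; case: ifPn => //.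
- by rewrite notin_setE /= in_itv /= xM.
- by rewrite inE /= in_itv /= (negbTE xM).
Qed.

Lemma L2_boxf M : L2 (boxf M).
Proof.
apply: L2P; first by apply: L1_measurable; exact: L1_boxf.
have -> : (fun x => boxf M x ^+ 2) = boxf M; last exact: L1_boxf.
by apply/funext => x; rewrite /boxf; case: ifP; rewrite ?expr1n ?expr0n.
Qed.

Lemma cvg0_sqr (a b : R -> R) (t0 : R) : (\forall t \near t0, a t ^+ 2 <= b t) ->
  b t @[t --> t0] --> 0 -> a t @[t --> t0] --> 0.
Proof.
move=> ab b0; apply: norm_cvg0.
have : Num.sqrt (b t) @[t --> t0] --> 0.
  rewrite -[X in _ --> X](sqrtr0 R).
  by apply: (cvg_comp b Num.sqrt b0); exact: sqrt_continuous.
apply: squeeze_cvgr (cvg_cst 0); apply: filterS ab => t /= ab.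
by rewrite normr_ge0 -sqrtr_sqr ler_wsqrtr.
Qed.

Lemma L2_slice M f t : continuous f -> xsupported M f -> L2 (fun x => f (x, t)).
Proof.
move=> cf sf; apply: (L2_compact (M := M)); first exact: continuous_slice_x.
by move=> x; exact: sf.
Qed.

Lemma L1_pairing M (v : R -> R) f t : L2 v -> continuous f -> xsupported M f ->
  L1 (fun x => v x * f (x, t)).
Proof. by move=> v2 cf sf; apply: L2_mul => //; exact: L2_slice sf. Qed.

Lemma in_itv_norm (t0 t : R) : `](t0 - 1), (t0 + 1)[%classic t -> `|t| <= `|t0| + 1.
Proof.
rewrite /= in_itv /= => /andP[t1 t2]; rewrite -[t](subrK t0) addrC.
apply: (le_trans (ler_normD _ _)); rewrite lerD2l ler_norml.
by apply/andP; split; lra.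
Qed.

Lemma mem_itv_center (t0 : R) : t0 \in `](t0 - 1), (t0 + 1)[%classic.
Proof. by rewrite inE /= in_itv /=; apply/andP; split; lra. Qed.

Lemma near_norm_le (t0 : R) : \forall t \near t0, `|t| <= `|t0| + 1.
Proof.
have /cvgr_lt : `|t| @[t --> t0] --> `|t0| by exact: norm_continuous.
by move=> /(_ (`|t0| + 1)); rewrite ltrDl => /(_ ltr01); apply: filterS => t /ltW.
Qed.

(** Dominated convergence: on a bounded time interval [f] is bounded by a
    constant on the support. *)
Lemma fixed_pairing_continuous M (v : R -> R) f : L2 v -> continuous f ->
  xsupported M f -> continuous (fun t => rint (fun x => v x * f (x, t))).
Proof.
move=> v2 cf sf t0.
have [C C0 HC] := box_bounded M (`|t0| + 1) cf.
have mv := L2_measurable v2.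
have IB : L1 (fun x => C * (`|v x| * boxf M x)).
  apply: L1Z; apply: L2_mul; last exact: L2_boxf.
  apply: L2P; first exact: measurableT_comp.
  by under eq_fun do rewrite real_normK ?num_real//; exact: L2_sqr.
have cw x : continuous (fun t => v x * f (x, t)).
  by move=> t; apply: cvgM; [exact: cvg_cst|exact: continuous_slice_t].
apply: (@continuity_under_integral _ _ _ mu (fun t x => v x * f (x, t)) setT
  measurableT (t0 - 1) (t0 + 1) _ _ (fun x => C * (`|v x| * boxf M x)) IB _ t0
  (mem_itv_center t0)).
- by move=> t _; exact: (L1_pairing t v2 cf sf).
- by apply: aeW => x _ t _; exact: cw.
- move=> t /in_itv_norm tT; apply: aeW => x _; rewrite normrM /boxf.
  case: ifPn => [xM|]; first by rewrite mulr1 mulrC ler_wpM2r// HC.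
  by rewrite -ltNge => /(sf x t)->; rewrite normr0 !mulr0.
Qed.

(** Write [u t = (u t - u t0) + u t0]: the first part is small in L^2 and
    is paired by the Cauchy-Schwarz inequality with functions of bounded
    norm, the second does not depend on [t]. *)
Lemma pairing_continuous M u f : cL2 u -> continuous f -> xsupported M f ->
  continuous (fun t => rint (fun x => u x t * f (x, t))).
Proof.
move=> [u2 uc] cf sf t0.
have [C C0 HC] := box_bounded M (`|t0| + 1) cf.
pose d t x := u x t - u x t0.
have d2 t : L2 (d t) by exact: L2B.
have E : (fun t => rint (fun x => u x t * f (x, t))) =
    (fun t => rint (fun x => d t x * f (x, t)) + rint (fun x => u x t0 * f (x, t))).
  apply/funext => t; rewrite -rintD; [|exact: (L1_pairing _ (d2 t) cf sf)
    |exact: (L1_pairing _ (u2 t0) cf sf)].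
  by congr rint; apply/funext => x; rewrite /d; ring.
rewrite /continuous_at E.
rewrite -[X in _ --> X]add0r.
apply: cvgD; last exact: (fixed_pairing_continuous (u2 t0) cf sf).
pose D := C ^+ 2 * rint (boxf M).
have D0 : 0 <= D.
  apply: mulr_ge0; first exact: sqr_ge0.
  by apply: rint_ge0 => x; rewrite /boxf; case: ifP.
apply: (cvg0_sqr (b := fun t => rint (fun x => d t x ^+ 2) * D)).
  apply: filterS (near_norm_le t0) => t tT.
  apply: (le_trans (cauchy_schwarz (d2 t) (L2_slice t cf sf))).
  apply: ler_wpM2l; first by apply: rint_ge0 => x; exact: sqr_ge0.
  rewrite /D -rintZ; last exact: L1_boxf.
  apply: rint_le; [exact: (L2_sqr (L2_slice t cf sf))|exact: (L1Z _ (L1_boxf M))|move=> x].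
  rewrite /boxf; case: ifPn => [xM|].
    by rewrite mulr1 -[leLHS]real_normK ?num_real// ler_sqr ?nnegrE// HC.
  by rewrite -ltNge => /(sf x t)->; rewrite expr0n mulr0.
by rewrite -[X in _ --> X](mul0r D); apply: cvgM; [exact: uc|exact: cvg_cst].
Qed.

(** Dominated convergence for a function that is continuous in time and has
    a Gaussian majorant on bounded time intervals. *)
Lemma cL2_gauss u (c : R) : (forall x, continuous (u x)) ->
  (forall t, measurable_fun setT (u ^~ t)) ->
  (forall T, exists C d : R, [/\ 0 < C, 0 < d & forall x t, `|t| <= T ->
     u x t ^+ 2 <= C * expR (- (d * (x - c) ^+ 2))]) -> cL2 u.
Proof.
move=> cu mu_ ub.
have u2 t : L2 (u ^~ t).
  have [C [d [C0 d0 HC]]] := ub `|t|.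
  apply: L2P => //; apply: L1_le; last exact: (L1Z C (L1_gauss c d0)).
    exact: measurable_funX.
  by move=> x; rewrite ger0_norm ?sqr_ge0// HC.
split=> // t0; have [C [d [C0 d0 HC]]] := ub (`|t0| + 1).
have t0T : `|t0| <= `|t0| + 1 by rewrite lerDl.
pose w t x := (u x t - u x t0) ^+ 2.
have IC : L1 (fun x => (4 * C) * expR (- (d * (x - c) ^+ 2))).
  exact: (L1Z _ (L1_gauss c d0)).
have cw x : continuous (w ^~ x).
  move=> t; rewrite /w; under eq_fun do rewrite expr2.
  by apply: cvgM; (apply: cvgB; [exact: cu|exact: cvg_cst]).
have E : rint (w t0) = 0.
  by rewrite -[RHS]rint0; congr rint; apply/funext => x; rewrite /w subrr expr0n.
rewrite -[X in _ --> X]E.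
apply: (@continuity_under_integral _ _ _ mu w setT measurableT
  (t0 - 1) (t0 + 1) _ _ _ IC _ t0 (mem_itv_center t0)).
- by move=> t _; apply: L2_sqr; exact: L2B.
- by apply: aeW => x _ t _; exact: cw.
- move=> t /in_itv_norm tT; apply: aeW => x _; rewrite /w ger0_norm ?sqr_ge0//.
  apply: (@le_trans _ _ (2 * u x t ^+ 2 + 2 * u x t0 ^+ 2)).
    by have := sqr_ge0 (u x t + u x t0); nra.
  by have := HC x t tT; have := HC x t0 t0T; nra.
Qed.

(** Difference quotients of a slice are literally those of the function of
    the plane in the direction of the axis. *)
Lemma is_derive_slice_x f (x t l : R) : is_derive (x, t) (dir_x R) f l ->
  is_derive x 1 (fun y => f (y, t)) l.
Proof.
have E : (fun s : R => s^-1 *: (((fun y => f (y, t)) \o shift x) (s *: 1) - f (x, t)))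
    = (fun s => s^-1 *: ((f \o shift (x, t)) (s *: dir_x R) - f (x, t))).
  apply/funext => s /=; congr (_ *: (f _ - _)).
  have -> : s *: dir_x R + (x, t) = (s *: 1 + x, s *: 0 + t) by [].
  by rewrite scaler0 add0r.
by move=> [d dE]; apply: DeriveDef; rewrite /derivable /derive E.
Qed.

Lemma is_derive_slice_t f (x t l : R) : is_derive (x, t) (dir_t R) f l ->
  is_derive t 1 (fun s => f (x, s)) l.
Proof.
have E : (fun s : R => s^-1 *: (((fun s => f (x, s)) \o shift t) (s *: 1) - f (x, t)))
    = (fun s => s^-1 *: ((f \o shift (x, t)) (s *: dir_t R) - f (x, t))).
  apply/funext => s /=; congr (_ *: (f _ - _)).
  have -> : s *: dir_t R + (x, t) = (s *: 0 + x, s *: 1 + t) by [].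
  by rewrite scaler0 add0r.
by move=> [d dE]; apply: DeriveDef; rewrite /derivable /derive E.
Qed.

Lemma rint_dx f f' M t : (forall p, is_derive p (dir_x R) f (f' p)) ->
  continuous f' -> xsupported M f -> rint (fun x => f' (x, t)) = 0.
Proof.
move=> df cf' sf.
apply: (rint_derive_compact (M := M) (fun x => is_derive_slice_x (df (x, t)))).
- exact: continuous_slice_x.
- by move=> x; exact: sf.
Qed.

Lemma xsupported_dt f f' M : (forall p, is_derive p (dir_t R) f (f' p)) ->
  xsupported M f -> xsupported M f'.
Proof.
move=> df sf x t xM; have [_ <-] := is_derive_slice_t (df (x, t)).
have -> : (fun s => f (x, s)) = cst 0 by apply/funext => s; rewrite sf.
by rewrite derive_cst.
Qed.

(** Differentiation under the integral sign; the derivative is bounded on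
    the box that contains the support. *)
Lemma rint_dt_derive f f' M (t : R) : (forall p, is_derive p (dir_t R) f (f' p)) ->
  continuous f -> continuous f' -> xsupported M f ->
  is_derive t 1 (fun s => rint (fun x => f (x, s))) (rint (fun x => f' (x, t))).
Proof.
move=> df cf cf' sf; have sf' := xsupported_dt df sf.
have [C C0 HC] := box_bounded M (`|t| + 1) cf'.
pose w (s x : R) := f (x, s).
have dw (s x : R) : is_derive s 1 (w^~ x) (f' (x, s)) by exact: is_derive_slice_t.
have dwE s x : partial1of2 w s x = f' (x, s).
  by rewrite partial1of2E; have [] := dw s x.
have Iw s : L1 (w s).
  by apply: (L1_compact (M := M)); [exact: continuous_slice_x|move=> x; exact: sf].
have IC : L1 (fun x => C * boxf M x) by exact: (L1Z _ (L1_boxf M)).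
have C_ge0 x : 0 <= C * boxf M x by rewrite mulr_ge0// /boxf; case: ifP.
have It : `](t - 1), (t + 1)[%classic t by exact/set_mem/mem_itv_center.
have dom (s x : R) : `](t - 1), (t + 1)[%classic s -> setT x ->
    `|partial1of2 w s x| <= C * boxf M x.
  move=> /in_itv_norm sT _; rewrite dwE /boxf; case: ifPn => [xM|].
    by rewrite mulr1 HC.
  by rewrite -ltNge => /(sf' x s)->; rewrite normr0 mulr0.
have dw1 (s x : R) : `](t - 1), (t + 1)[%classic s -> setT x -> derivable (w^~ x) s 1.
  by move=> _ _; have [] := dw s x.
apply: DeriveDef.
- exact: (derivable_under_integral measurableT It (fun s _ => Iw s) dw1 C_ge0 IC dom).
- rewrite -derive1E.
  rewrite (differentiation_under_integral measurableT It (fun s _ => Iw s) dw1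
    C_ge0 IC dom).
  by congr rint; apply/funext => x; rewrite dwE.
Qed.

Lemma rint_continuous f M : continuous f -> xsupported M f ->
  continuous (fun t => rint (fun x => f (x, t))).
Proof.
move=> cf sf; have := fixed_pairing_continuous (L2_boxf M) cf sf.
have -> // : (fun t => rint (fun x => boxf M x * f (x, t))) =
   (fun t => rint (fun x => f (x, t))).
apply/funext => t; congr rint; apply/funext => x; rewrite /boxf; case: ifPn.
  by rewrite mul1r.
by rewrite -ltNge => /(sf x t)->; rewrite mulr0.
Qed.

Lemma rint_rint_dt f f' M : (forall p, is_derive p (dir_t R) f (f' p)) ->
  continuous f -> continuous f' -> supported M f ->
  rint (fun t => rint (fun x => f' (x, t))) = 0.
Proof.
move=> df cf cf' sf; have sfx := supported_x sf.
apply: (rint_derive_compact (M := M) (fun t => rint_dt_derive t df cf cf' sfx)).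
- exact: (rint_continuous cf' (xsupported_dt df sfx)).
- move=> t tM; rewrite -[RHS]rint0; congr rint; apply/funext => x.
  by rewrite sf//; right.
Qed.

(** The integral is iterated because the slices of [u] at different times
    need not fit together measurably. *)
Definition pair u f := rint (fun t => rint (fun x => u x t * f (x, t))).

Lemma pair_outer M u f : cL2 u -> continuous f -> supported M f ->
  L1 (fun t => rint (fun x => u x t * f (x, t))).
Proof.
move=> cu cf sf; apply: (L1_compact (M := M)).
  exact: (pairing_continuous cu cf (supported_x sf)).
move=> t tM; rewrite -[RHS]rint0; congr rint; apply/funext => x.
by rewrite sf ?mulr0//; right.
Qed.

Lemma L1_slice M f t : continuous f -> xsupported M f -> L1 (fun x => f (x, t)).
Proof.
move=> cf sf; apply: (L1_compact (M := M)); first exact: continuous_slice_x.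
by move=> x; exact: sf.
Qed.

Lemma L1_rint M f : continuous f -> supported M f ->
  L1 (fun t => rint (fun x => f (x, t))).
Proof.
move=> cf sf; apply: (L1_compact (M := M)).
  exact: (rint_continuous cf (supported_x sf)).
move=> t tM; rewrite -[RHS]rint0; congr rint; apply/funext => x.
by rewrite sf//; right.
Qed.

Lemma rint_rintD M f g : continuous f -> continuous g -> supported M f ->
  supported M g -> rint (fun t => rint (fun x => f (x, t) + g (x, t))) =
  rint (fun t => rint (fun x => f (x, t))) + rint (fun t => rint (fun x => g (x, t))).
Proof.
move=> cf cg sf sg.
rewrite -rintD; [|exact: (L1_rint cf sf)|exact: (L1_rint cg sg)].
congr rint; apply/funext => t; rewrite rintD//.
- exact: (L1_slice t cf (supported_x sf)).
- exact: (L1_slice t cg (supported_x sg)).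
Qed.

Lemma supportedM M f g : supported M f -> supported M (fun p => f p * g p).
Proof. by move=> sf x t /sf ->; rewrite mul0r. Qed.

Lemma supportedMr M f g : supported M f -> supported M (fun p => g p * f p).
Proof. by move=> sf x t /sf ->; rewrite mulr0. Qed.

(** Integration by parts in either variable comes down to the vanishing of
    the integral of the derivative of [g * f]. *)
Lemma pair_parts M (g g' f f' : R * R -> R) : continuous g -> continuous g' ->
  continuous f -> continuous f' -> supported M f -> supported M f' ->
  rint (fun t => rint (fun x => g (x, t) * f' (x, t) + f (x, t) * g' (x, t))) = 0 ->
  pair (fun x t => g (x, t)) f' = - pair (fun x t => g' (x, t)) f.
Proof.
move=> cg cg' cf cf' sf sf'.
rewrite (rint_rintD (continuousM_plane cg cf') (continuousM_plane cf cg')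
  (supportedMr g sf') (supportedM g' sf)) => /eqP.
rewrite addr_eq0 => /eqP; rewrite /pair => ->; congr (- _); congr rint.
by apply/funext => t; congr rint; apply/funext => x; rewrite mulrC.
Qed.

Lemma pair_dt M (g g' f f' : R * R -> R) :
  (forall p, is_derive p (dir_t R) g (g' p)) -> continuous g -> continuous g' ->
  (forall p, is_derive p (dir_t R) f (f' p)) -> continuous f -> continuous f' ->
  supported M f -> supported M f' ->
  pair (fun x t => g (x, t)) f' = - pair (fun x t => g' (x, t)) f.
Proof.
move=> dg cg cg' df cf cf' sf sf'.
apply: (pair_parts cg cg' cf cf' sf sf').
apply: (rint_rint_dt (fun p => is_deriveM_plane (dg p) (df p))
  (continuousM_plane cg cf) _ (supportedMr g sf)).
exact: (continuousD_plane (continuousM_plane cg cf') (continuousM_plane cf cg')).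
Qed.

Lemma pair_dx M (g g' f f' : R * R -> R) :
  (forall p, is_derive p (dir_x R) g (g' p)) -> continuous g -> continuous g' ->
  (forall p, is_derive p (dir_x R) f (f' p)) -> continuous f -> continuous f' ->
  supported M f -> supported M f' ->
  pair (fun x t => g (x, t)) f' = - pair (fun x t => g' (x, t)) f.
Proof.
move=> dg cg cg' df cf cf' sf sf'.
apply: (pair_parts cg cg' cf cf' sf sf').
rewrite -[RHS]rint0; congr rint; apply/funext => t.
apply: (rint_dx t (fun p => is_deriveM_plane (dg p) (df p)) _
  (supported_x (supportedMr g sf))).
exact: (continuousD_plane (continuousM_plane cg cf') (continuousM_plane cf cg')).
Qed.

End Pairings.

(** * The equation in the sense of distributions *)

Section Distributions.
Context {R : realType}.
Local Notation mu := (@lebesgue_measure R).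
Implicit Types (psi : R -> R -> R[i]) (phi : R * R -> R[i]).

Definition reP psi : R -> R -> R := fun x t => cRe (psi x t).
Definition imP psi : R -> R -> R := fun x t => cIm (psi x t).

Lemma rintE (f : R -> R) : L1 f -> (\int[mu]_x (f x)%:E)%E = (rint f)%:E.
Proof. by move=> If; rewrite /rint /Rintegral fineK//; exact: integrable_fin_num. Qed.

Lemma L2normE (F : R -> R[i]) : L2 (fun x => cRe (F x)) -> L2 (fun x => cIm (F x)) ->
  L2norm F = (Num.sqrt (rint (fun x => cRe (F x) ^+ 2) + rint (fun x => cIm (F x) ^+ 2)))%:E.
Proof.
move=> a2 b2; rewrite /L2norm unlock.
have -> : (\int[mu]_x (`|(Normc.normc (F x))%:E| `^ 2))%E =
   (rint (fun x => cRe (F x) ^+ 2) + rint (fun x => cIm (F x) ^+ 2))%:E.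
  rewrite -rintD; [|exact: L2_sqr|exact: L2_sqr].
  rewrite -rintE; last by apply: L1D; exact: L2_sqr.
  apply: eq_integral => x _ /=; rewrite powR_mulrn// real_normK ?num_real//.
  by rewrite normc_sqr.
rewrite /= powR12_sqrt// addr_ge0//; apply: rint_ge0 => x; exact: sqr_ge0.
Qed.

Lemma cvg0_of_sqrt (s : R -> R) (t0 : R) : (forall t, 0 <= s t) ->
  Num.sqrt (s t) @[t --> t0] --> 0 -> s t @[t --> t0] --> 0.
Proof.
move=> s0 H; have -> : s = (fun t => Num.sqrt (s t) * Num.sqrt (s t)).
  by apply/funext => t; rewrite -expr2 sqr_sqrtr.
by rewrite -[X in _ --> X](mulr0 0); exact: cvgM.
Qed.

(** The complex L^2 distance is the square root of the sum of the real
    squared distances, and a sum of nonnegative functions tends to zero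
    exactly when both do. *)
Lemma continuous_L2P psi :
  continuous_L2 psi <-> cL2 (reP psi) /\ cL2 (imP psi).
Proof.
have E t t0 : (L2 (reP psi ^~ t) -> L2 (reP psi ^~ t0) -> L2 (imP psi ^~ t) ->
    L2 (imP psi ^~ t0) -> L2norm (fun x => psi x t - psi x t0) =
   (Num.sqrt (rint (fun x => (reP psi x t - reP psi x t0) ^+ 2)
     + rint (fun x => (imP psi x t - imP psi x t0) ^+ 2)))%:E).
  move=> a1 a2 b1 b2; rewrite L2normE.
  - by congr (Num.sqrt (rint _ + rint _))%:E; apply/funext => x; rewrite ?cReB ?cImB.
  - by under eq_fun do rewrite cReB; exact: L2B.
  - by under eq_fun do rewrite cImB; exact: L2B.
split=> [[i2 c2]|[[a2 ac] [b2 bc]]].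
- have a2 t : L2 (reP psi ^~ t) by have [] := i2 t.
  have b2 t : L2 (imP psi ^~ t) by have [] := i2 t.
  have S0 t0 : (rint (fun x => (reP psi x t - reP psi x t0) ^+ 2)
     + rint (fun x => (imP psi x t - imP psi x t0) ^+ 2)) @[t --> t0] --> 0.
    apply: cvg0_of_sqrt => [t|].
      by apply: addr_ge0; apply: rint_ge0 => x; exact: sqr_ge0.
    have := c2 t0; under eq_fun do rewrite E//.
    by move=> /fine_cvgP[_].
  split; split=> // t0; apply: squeeze_cvgr (cvg_cst 0) (S0 t0);
    apply: nearW => t /=; apply/andP; split.
  + by apply: rint_ge0 => x; exact: sqr_ge0.
  + by rewrite lerDl; apply: rint_ge0 => x; exact: sqr_ge0.
  + by apply: rint_ge0 => x; exact: sqr_ge0.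
  + by rewrite lerDr; apply: rint_ge0 => x; exact: sqr_ge0.
- split=> [t|t0]; first by split; [exact: a2|exact: b2].
  have S : (rint (fun x => (reP psi x t - reP psi x t0) ^+ 2)
     + rint (fun x => (imP psi x t - imP psi x t0) ^+ 2)) @[t --> t0] --> 0.
    by rewrite -[X in _ --> X](addr0 0); apply: cvgD; [exact: ac|exact: bc].
  under eq_fun do rewrite E//; apply: cvg_EFin; first exact: nearW.
  rewrite -[X in _ --> X](sqrtr0 R).
  by apply: (cvg_comp _ Num.sqrt S); exact: sqrt_continuous.
Qed.

Lemma supported_dx (f f' : R * R -> R) M : (forall p, is_derive p (dir_x R) f (f' p)) ->
  supported M f -> supported M f'.
Proof.
move=> df sf x t [xM|tM].
  apply: (derive_supported (M := M) (fun x => is_derive_slice_x (df (x, t)))) => //.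
  by move=> y yM; apply: sf; left.
have [_ <-] := is_derive_slice_x (df (x, t)).
have -> : (fun y => f (y, t)) = cst 0 by apply/funext => y; rewrite sf//; right.
by rewrite derive_cst.
Qed.

Lemma supported_dt (f f' : R * R -> R) M : (forall p, is_derive p (dir_t R) f (f' p)) ->
  supported M f -> supported M f'.
Proof.
move=> df sf x t [xM|tM]; last first.
  apply: (derive_supported (M := M) (fun t => is_derive_slice_t (df (x, t)))) => //.
  by move=> y yM; apply: sf; right.
have [_ <-] := is_derive_slice_t (df (x, t)).
have -> : (fun s => f (x, s)) = cst 0 by apply/funext => y; rewrite sf//; left.
by rewrite derive_cst.
Qed.

Definition csupported M phi := supported M (fun p => cRe (phi p)) /\
  supported M (fun p => cIm (phi p)).

(** A compact support is bounded, and the maximum norm of the plane bounds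
    both coordinates. *)
Lemma test_function_supported phi : test_function phi ->
  csmooth phi /\ exists M, csupported M phi.
Proof.
move=> [s1 [s2 cpt]]; split; first by split.
have [D [_ HD]] := compact_bounded cpt.
suff H x t : `|D| + 1 < `|x| \/ `|D| + 1 < `|t| -> phi (x, t) = 0.
  by exists (`|D| + 1); split=> x t /H ->.
move=> xt; apply/eqP; apply: contraPT isT => phi0 _.
have : `|(x, t)| <= `|D| + 1.
  apply: HD; first by rewrite (le_lt_trans (ler_norm _))// ltrDl.
  exact: subset_closure.
rewrite prod_normE /= ge_max => /andP[xD tD].
by case: xt; rewrite ltNge ?xD ?tD.
Qed.

Lemma csupported_cderive M v phi : axis v -> csmooth phi -> csupported M phi ->
  csupported M (cderive v phi).
Proof.
move=> av [s1 s2] [u1 u2]; split; case: av => ->.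
- by have [d _ _ _] := smooth_derive s1; exact: supported_dx d u1.
- by have [_ d _ _] := smooth_derive s1; exact: supported_dt d u1.
- by have [d _ _ _] := smooth_derive s2; exact: supported_dx d u2.
- by have [_ d _ _] := smooth_derive s2; exact: supported_dt d u2.
Qed.

(** Expresses the complex distribution through real pairings, for which
    integration by parts is available. *)
Lemma distr_ofE M psi phi : cL2 (reP psi) -> cL2 (imP psi) -> csmooth phi ->
  csupported M phi -> let f1 p := cRe (phi p) in let f2 p := cIm (phi p) in
  distr_of psi phi = (pair (reP psi) f1 - pair (imP psi) f2) +i*
                     (pair (reP psi) f2 + pair (imP psi) f1).
Proof.
move=> a2 b2 [s1 s2] [u1 u2] f1 f2.
have c1 := smooth_continuous s1; have c2 := smooth_continuous s2.
have In u f t : cL2 u -> continuous f -> supported M f -> L1 (fun x => u x t * f (x, t)).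
  by move=> [u2' _] cf sf; exact: (L1_pairing _ (u2' t) cf (supported_x sf)).
apply: complex_ext => /=.
- rewrite /pair -rintB; [|exact: pair_outer c1 u1|exact: pair_outer c2 u2].
  congr rint; apply/funext => t; rewrite -rintB; [|exact: In|exact: In].
  by congr rint; apply/funext => x; rewrite cReM.
- rewrite /pair -rintD; [|exact: pair_outer c2 u2|exact: pair_outer c1 u1].
  congr rint; apply/funext => t; rewrite -rintD; [|exact: In|exact: In].
  by congr rint; apply/funext => x; rewrite cImM.
Qed.

(** The equation of the Cauchy problem tested against a single function. *)
Definition schrodinger_on psi phi :=
  'i%C * distr_derive (dir_t R) (distr_of psi) phi =
     - distr_derive (dir_x R) (distr_derive (dir_x R) (distr_of psi)) phi.

(** The equation splits into its real and imaginary parts, which exchange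
    the two components of the solution. *)
Lemma complex_schrodinger_eq (a b c d : R) :
  'i%C * - (a +i* b) = - - - (c +i* d) <-> (c = - b /\ d = a).
Proof.
rewrite opprK; split=> [E|[-> ->]].
  have E1 := congr1 (@complex.Re R) E; have E2 := congr1 (@complex.Im R) E.
  by move: E1 E2; rewrite cReM cImM /= => E1 E2; split; lra.
by apply: complex_ext; rewrite !cReIm /=; ring.
Qed.

Lemma schrodinger_onP M psi phi : cL2 (reP psi) -> cL2 (imP psi) -> csmooth phi ->
  csupported M phi ->
  let ft1 p := cRe (cderive (dir_t R) phi p) in
  let ft2 p := cIm (cderive (dir_t R) phi p) in
  let fx1 p := cRe (cderive (dir_x R) (cderive (dir_x R) phi) p) in
  let fx2 p := cIm (cderive (dir_x R) (cderive (dir_x R) phi) p) in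
  schrodinger_on psi phi <->
  (pair (reP psi) fx1 - pair (imP psi) fx2 = - (pair (reP psi) ft2 + pair (imP psi) ft1)
  /\ pair (reP psi) fx2 + pair (imP psi) fx1 = pair (reP psi) ft1 - pair (imP psi) ft2).
Proof.
move=> a2 b2 sp up ft1 ft2 fx1 fx2.
have ax : axis (dir_x R) by left.
have at_ : axis (dir_t R) by right.
rewrite /schrodinger_on /distr_derive.
rewrite (distr_ofE a2 b2 (csmooth_cderive at_ sp) (csupported_cderive at_ sp up)).
have sx := csmooth_cderive ax sp; have ux := csupported_cderive ax sp up.
rewrite (distr_ofE a2 b2 (csmooth_cderive ax sx) (csupported_cderive ax sx ux)).
exact: complex_schrodinger_eq.
Qed.

Lemma pair_ext (u v : R -> R -> R) f : (forall x t, u x t = v x t) ->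
  pair u f = pair v f.
Proof. by move=> uv; have -> // : u = v; apply/funext => x; apply/funext => t. Qed.

(** The linear algebra that combines eight integrations by parts into the
    two real equations. It is stated for abstract numbers because the
    actual terms are large. *)
Lemma weak_equation_of_adjoints (x1 x2 x3 x4 t1 t2 t3 t4 A1 A2 A3 A4 : R) :
  x1 = A1 -> x2 = A2 -> x3 = A3 -> x4 = A4 ->
  t1 = A4 -> t2 = - A3 -> t3 = A2 -> t4 = - A1 ->
  x1 - x2 = - (t3 + t4) /\ x3 + x4 = t1 - t2.
Proof. by do 8! move=> ->; split; ring. Qed.

(** Moving all derivatives from the test function to [F] turns the weak
    equation into the pointwise one. *)
Lemma classical_schrodinger (F : R * R -> R[i]) phi : csmooth F ->
  (forall p, cderive (dir_t R) F p =
     'i%C * cderive (dir_x R) (cderive (dir_x R) F) p) ->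
  let psi := fun x t => F (x, t) in cL2 (reP psi) -> cL2 (imP psi) ->
  test_function phi -> schrodinger_on psi phi.
Proof.
move=> sF FE psi a2 b2 /test_function_supported[sp [M up]].
apply/(schrodinger_onP a2 b2 sp up).
have ax : axis (dir_x R) by left.
have at_ : axis (dir_t R) by right.
have sx := csmooth_cderive ax sp; have ux := csupported_cderive ax sp up.
have sxx := csmooth_cderive ax sx; have uxx := csupported_cderive ax sx ux.
have st := csmooth_cderive at_ sp; have ut := csupported_cderive at_ sp up.
have sFx := csmooth_cderive ax sF; have sFxx := csmooth_cderive ax sFx.
have sFt := csmooth_cderive at_ sF.
have PT (g f : R * R -> R) : smooth g -> smooth f -> supported M f ->
   pair (fun x t => g (x, t)) ('D_(dir_t R) f) = - pair (fun x t => 'D_(dir_t R) g (x, t)) f.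
  move=> sg sf uf; have [_ dg _ sg'] := smooth_derive sg.
  have [_ df _ sf'] := smooth_derive sf.
  by apply: (pair_dt dg _ _ df _ _ uf (supported_dt df uf)); exact: smooth_continuous.
have PX (g f : R * R -> R) : smooth g -> smooth f -> supported M f ->
   pair (fun x t => g (x, t)) ('D_(dir_x R) f) = - pair (fun x t => 'D_(dir_x R) g (x, t)) f.
  move=> sg sf uf; have [dg _ sg' _] := smooth_derive sg.
  have [df _ sf' _] := smooth_derive sf.
  by apply: (pair_dx dg _ _ df _ _ uf (supported_dx df uf)); exact: smooth_continuous.
have PXX (g f : R * R -> R) : smooth g -> smooth f -> supported M f ->
   pair (fun x t => g (x, t)) ('D_(dir_x R) ('D_(dir_x R) f)) =
   pair (fun x t => 'D_(dir_x R) ('D_(dir_x R) g) (x, t)) f.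
  move=> sg sf uf; have [dg _ sg' _] := smooth_derive sg.
  have [df _ sf' _] := smooth_derive sf.
  by rewrite (PX _ _ sg sf' (supported_dx df uf)) (PX _ _ sg' sf uf) opprK.
have [F1 F2] := sF; have [p1 p2] := sp; have [u1 u2] := up.
have Ft1 p : 'D_(dir_t R) (fun q => cRe (F q)) p =
    - 'D_(dir_x R) ('D_(dir_x R) (fun q => cIm (F q))) p.
  by have := congr1 (@complex.Re R) (FE p); rewrite cReM /= mul0r mul1r sub0r.
have Ft2 p : 'D_(dir_t R) (fun q => cIm (F q)) p =
    'D_(dir_x R) ('D_(dir_x R) (fun q => cRe (F q))) p.
  by have := congr1 (@complex.Im R) (FE p); rewrite cImM /= mul0r mul1r add0r.
have PN (g f : R * R -> R) : smooth g -> smooth f -> supported M f ->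
   pair (fun x t => - g (x, t)) f = - pair (fun x t => g (x, t)) f.
  move=> sg sf uf; rewrite /pair -rintN; last first.
    apply: (L1_rint (M := M) (f := fun p => g p * f p)).
      by apply: continuousM_plane; exact: smooth_continuous.
    exact: supportedMr.
  congr rint; apply/funext => t; rewrite -rintN; last first.
    apply: (L1_slice (M := M) (f := fun p => g p * f p)).
      by apply: continuousM_plane; exact: smooth_continuous.
    by apply: supported_x; exact: supportedMr.
  by congr rint; apply/funext => x; rewrite mulNr.
have [G1 G2] := sFxx.
pose u1xx x t := 'D_(dir_x R) ('D_(dir_x R) (fun q => cRe (F q))) (x, t).
pose u2xx x t := 'D_(dir_x R) ('D_(dir_x R) (fun q => cIm (F q))) (x, t).
have D1 f : smooth f -> supported M f ->
    - pair (fun x t => 'D_(dir_t R) (fun q => cRe (F q)) (x, t)) f = pair u2xx f.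
  move=> sf uf; apply: (etrans _ (etrans (congr1 -%R (PN _ _ G2 sf uf)) (opprK _))).
  by apply: (congr1 -%R); apply: pair_ext => x t; exact: Ft1.
have D2 f : - pair (fun x t => 'D_(dir_t R) (fun q => cIm (F q)) (x, t)) f =
    - pair u1xx f.
  by apply: (congr1 -%R); apply: pair_ext => x t; exact: Ft2.
exact: (weak_equation_of_adjoints (PXX _ _ F1 p1 u1) (PXX _ _ F2 p2 u2) (PXX _ _ F1 p2 u2)
  (PXX _ _ F2 p1 u1) (etrans (PT _ _ F1 p1 u1) (D1 _ p1 u1))
  (etrans (PT _ _ F2 p2 u2) (D2 _)) (etrans (PT _ _ F1 p2 u2) (D1 _ p2 u2))
  (etrans (PT _ _ F2 p1 u1) (D2 _))).
Qed.
End Distributions.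

(** * Flat functions and smooth steps *)

Section Bumps.
Context {R : realType}.
Implicit Types (x y t : R) (k : nat).

(** The derivatives of [exp (- 1 / x)], extended by [0], are linear
    combinations of these functions, with the same extension; hence they
    form a family to which [smooth_family] applies. *)
Definition flat k x : R := if 0 < x then x^-1 ^+ k * expR (- x^-1) else 0.

Lemma flat_le0 k x : x <= 0 -> flat k x = 0.
Proof. by move=> x0; rewrite /flat ltNge x0. Qed.

Lemma flat_gt0 k x : 0 < x -> 0 < flat k x.
Proof. by move=> x0; rewrite /flat x0 mulr_gt0 ?expR_gt0// exprn_gt0// invr_gt0. Qed.

Lemma flat_ge0 k x : 0 <= flat k x.
Proof. by have [/flat_le0->//|/(flat_gt0 k)/ltW] := leP x 0. Qed.

(** With [y = 1 / x], the exponential series gives [y^k / k! <= exp y]. *)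
Lemma flat_bound k x : flat k x <= k`!%:R.
Proof.
rewrite /flat; case: ifPn => // x0; set y := x^-1.
have y0 : 0 <= y by rewrite invr_ge0 ltW.
rewrite expRN ler_pdivrMr ?expR_gt0//.
case: k => [|k]; first by rewrite expr0 mul1r (le_trans _ (expR_ge1Dx y))// lerDl.
rewrite -ler_pdivrMl ?ltr0n ?fact_gt0// mulrC.
by apply: le_trans (expR_ge1Dxn k y0); rewrite lerDr.
Qed.

Lemma flat_norm k x : `|flat k x| <= k`!%:R.
Proof. by rewrite ger0_norm ?flat_ge0 ?flat_bound. Qed.

Lemma flat_sqr k x : flat k x = x ^+ 2 * flat k.+2 x.
Proof.
rewrite /flat; case: ifPn => x0; last by rewrite mulr0.
by rewrite mulrA -[k.+2]add2n exprD mulrA -exprMn divff ?gt_eqF// expr1n mul1r.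
Qed.

Definition dflat k x : R := flat k.+2 x - k%:R * flat k.+1 x.

(** Away from the origin this is the product rule. At the origin the
    quotient [flat k x / x = x * flat k.+2 x] tends to [0]. *)
Lemma is_derive_flat k x : is_derive x (1 : R) (flat k) (dflat k x).
Proof.
have [x0|x0|->] := ltgtP x 0.
- rewrite /dflat !flat_le0 ?ltW// mulr0 subr0.
  have N : \near x, cst 0 x = flat k x.
    by apply: filterS (lt_nbhsl x0) => y y0; rewrite flat_le0// ltW.
  exact: near_eq_is_derive N (is_derive_cst _ _ _).
- have N : \near x, x^-1 ^+ k * expR (- x^-1) = flat k x.
    have x0' : - x < 0 by rewrite oppr_lt0.
    apply: filterS (Nlt_nbhsl x0') => y; rewrite oppr_lt0 => y0.
    by rewrite /flat y0.
  apply: near_eq_is_derive N _.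
  have xn : x != 0 by rewrite gt_eqF.
  have dV := is_deriveV xn (is_derive_id x (1 : R)).
  set y := x^-1.
  have dE := is_derive1_comp (is_derive_expR (- y)) (is_deriveNid y (1 : R)).
  have dX : is_derive y (1 : R) (fun y : R => y ^+ k) (k%:R * y ^+ k.-1).
    apply: DeriveDef; first exact: exprn_derivable.
    by rewrite exp_derive [LHS]mulr1.
  have dh : is_derive y (1 : R) (fun y : R => y ^+ k * expR (- y))
      (k%:R * y ^+ k.-1 * expR (- y) - y ^+ k * expR (- y)).
    apply: is_derive_eq (is_deriveM dX dE) _.
    rewrite -[(expR \o -%R) y]/(expR (- y)).
    by rewrite /GRing.scale /=; ring.
  apply: is_derive_eq (is_derive1_comp dh dV) _.
  rewrite /dflat /flat x0 -/y /GRing.scale /= mulr1 -exprVn -/y.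
  by case: k {dX dh} => [|k] /=; rewrite ?exprS; ring.
- rewrite /dflat !flat_le0// mulr0 subr0; apply/is_derive1_caratheodory.
  exists (fun z => z * flat k.+2 z); split.
  + by move=> z; rewrite [flat k 0]flat_le0// !subr0 flat_sqr; ring.
  + have N0 : `|z| * (k.+2)`!%:R @[z --> (0 : R)] --> (0 : R).
      rewrite -[X in _ --> X](mul0r (k.+2`!%:R : R)); apply: cvgM; last exact: cvg_cst.
      by rewrite -[X in _ --> X](@normr0 _ R); exact: norm_continuous.
    have Z0 : z * flat k.+2 z @[z --> (0 : R)] --> (0 : R).
      apply: norm_cvg0; apply: squeeze_cvgr (cvg_cst 0) N0; apply: nearW => z /=.
      by rewrite normr_ge0 normrM ler_wpM2l// flat_norm.
    by rewrite /prop_for /continuous_at mul0r.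
  + by rewrite mul0r.
Qed.

Lemma smooth_flat k (f : R * R -> R) : smooth f -> smooth (fun p => flat k (f p)).
Proof.
move=> sf; apply: (@smooth_family _ nat flat dflat f sf).
- by move=> i p; exact: is_derive_flat.
- move=> m IH i.
  have -> : dflat i \o f =
      (fun p => (flat i.+2 \o f) p + (- i%:R) * (flat i.+1 \o f) p).
    by apply/funext => p; rewrite /dflat /= mulNr.
  by apply: CkD => //; apply: CkM => //; exact: Ck_cst.
Qed.

(** At least one of [x] and [1 - x] is positive, hence the denominator
    never vanishes. *)
Definition flat_den x : R := flat 0 x + flat 0 (1 - x).

Lemma flat_den_gt0 x : 0 < flat_den x.
Proof.
rewrite /flat_den; have [x0|x0] := leP x 0.
  by rewrite ltr_wpDl ?flat_ge0// flat_gt0// subr_gt0 (le_lt_trans x0).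
by rewrite ltr_pwDl ?flat_ge0// flat_gt0.
Qed.

(** A smooth function equal to [0] on the left of [0] and to [1] on the
    right of [1]. *)
Definition step x : R := flat 0 x * (flat_den x)^-1.

Definition dstep x : R :=
  (flat 2 x * flat 0 (1 - x) + flat 0 x * flat 2 (1 - x)) * (flat_den x)^-1 ^+ 2.

Lemma step_le0 x : x <= 0 -> step x = 0.
Proof. by move=> x0; rewrite /step flat_le0// mul0r. Qed.

Lemma step_ge1 x : 1 <= x -> step x = 1.
Proof.
move=> x1; rewrite /step; have := flat_den_gt0 x; rewrite /flat_den.
by rewrite [flat 0 (1 - x)]flat_le0 ?subr_le0// addr0 => h; rewrite divff// gt_eqF.
Qed.

Lemma step_ge0 x : 0 <= step x.
Proof. by rewrite /step divr_ge0 ?flat_ge0// ltW// flat_den_gt0. Qed.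

Lemma step_le1 x : step x <= 1.
Proof.
by rewrite /step ler_pdivrMr ?flat_den_gt0// mul1r /flat_den lerDl flat_ge0.
Qed.

Lemma dstep_ge0 x : 0 <= dstep x.
Proof.
by rewrite /dstep mulr_ge0 ?sqr_ge0// addr_ge0// mulr_ge0 ?flat_ge0.
Qed.

Lemma dstep_out x : x <= 0 \/ 1 <= x -> dstep x = 0.
Proof.
move=> [x0|x1]; first by rewrite /dstep !(flat_le0 _ x0) !mul0r addr0 mul0r.
have x1' : 1 - x <= 0 by rewrite subr_le0.
by rewrite /dstep !(flat_le0 _ x1') !mulr0 addr0 mul0r.
Qed.

Lemma is_derive_step x : is_derive x (1 : R) step (dstep x).
Proof.
have d0 := is_derive_flat 0 x.
have d1 : is_derive x (1 : R) (fun y => flat 0 (1 - y)) (- dflat 0 (1 - x)).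
  have dm : is_derive x (1 : R) (fun y : R => 1 - y) (- 1).
    apply: is_derive_eq (is_deriveB (is_derive_cst (1 : R) x 1) (is_derive_id x (1 : R))) _.
    by rewrite sub0r.
  by apply: is_derive_eq (@is_derive1_comp R (flat 0) (fun y => 1 - y) x _ _
    (is_derive_flat 0 (1 - x)) dm) _; rewrite mulrN1.
have dn : flat_den x != 0 by rewrite gt_eqF// flat_den_gt0.
have dV := is_deriveV dn (is_deriveD d0 d1).
apply: is_derive_eq (is_deriveM d0 dV) _.
rewrite /dstep /dflat /GRing.scale /= !mul0r !subr0; move: dn; rewrite /flat_den => dn.
by field.
Qed.

Lemma smooth_step (f : R * R -> R) : smooth f -> smooth (fun p => step (f p)).
Proof.
move=> sf; apply: smoothM; first exact: smooth_flat.
apply: smoothV => [|p]; last by rewrite gt_eqF// flat_den_gt0.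
apply: smoothD; first exact: smooth_flat.
by apply: smooth_flat; apply: smoothB => //; exact: smooth_cst.
Qed.

(** The step rescaled to climb from [0] to [1] between the times [a] and [a
    + e]. *)
Definition tstep (a e t : R) : R := step (e^-1 * (t - a)).
Definition dtstep (a e t : R) : R := e^-1 * dstep (e^-1 * (t - a)).

Lemma smooth_tstep a e : smooth (fun p : R * R => tstep a e p.2).
Proof.
apply: smooth_step; apply: smoothM; first exact: smooth_cst.
by apply: smoothB; [exact: smooth_snd|exact: smooth_cst].
Qed.

Lemma is_derive_tstep a e t : is_derive t (1 : R) (tstep a e) (dtstep a e t).
Proof.
have dl : is_derive t (1 : R) (fun s : R => e^-1 * (s - a)) e^-1.
  apply: is_derive_eq (is_deriveM (is_derive_cst e^-1 t 1)
    (is_deriveB (is_derive_id t (1 : R)) (is_derive_cst a t 1))) _.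
  by rewrite subr0 scaler0 addr0 [LHS]mulr1.
apply: is_derive_eq (@is_derive1_comp R step (fun s => e^-1 * (s - a)) t _ _
  (is_derive_step (e^-1 * (t - a))) dl) _.
by rewrite mulrC.
Qed.

Lemma is_derive_tstep_plane a e p :
  is_derive p (dir_t R) (fun q : R * R => tstep a e q.2) (dtstep a e p.2).
Proof.
have H := is_derive_scomp (is_derive_coord2 p (dir_t R)) (is_derive_tstep a e p.2).
by apply: is_derive_eq H _; rewrite dir_tE mulr1.
Qed.

Lemma continuous_dtstep a e : continuous (dtstep a e).
Proof.
have [_ _ _ sd] := smooth_derive (smooth_tstep a e).
have E : 'D_(dir_t R) (fun p : R * R => tstep a e p.2) = (fun p => dtstep a e p.2).
  by apply/funext => p; have [] := is_derive_tstep_plane a e p.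
rewrite E in sd => t.
exact: (@continuous_slice_t R (fun p => dtstep a e p.2) 0 (smooth_continuous sd) t).
Qed.

Lemma dtstep_ge0 a e t : 0 < e -> 0 <= dtstep a e t.
Proof. by move=> e0; rewrite mulr_ge0 ?dstep_ge0// invr_ge0 ltW. Qed.

Lemma tstep_left a e t : 0 < e -> t <= a -> tstep a e t = 0.
Proof.
by move=> e0 ta; rewrite /tstep step_le0// pmulr_rle0 ?invr_gt0// subr_le0.
Qed.

Lemma tstep_right a e t : 0 < e -> a + e <= t -> tstep a e t = 1.
Proof.
by move=> e0 ta; rewrite /tstep step_ge1// mulrC ler_pdivlMr// mul1r lerBrDl.
Qed.

Lemma dtstep_out a e t : 0 < e -> t <= a \/ a + e <= t -> dtstep a e t = 0.
Proof.
move=> e0 ta; rewrite /dtstep dstep_out ?mulr0//; case: ta => ta; [left|right].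
- by rewrite pmulr_rle0 ?invr_gt0// subr_le0.
- by rewrite mulrC ler_pdivlMr// mul1r lerBrDl.
Qed.

Lemma dtstep_supported a e t : 0 < e -> `|a| + e < `|t| -> dtstep a e t = 0.
Proof.
move=> e0 ta; apply: dtstep_out => //.
have [t0|t0] := leP 0 t.
  right; move: ta; rewrite (ger0_norm t0) => /ltW; apply: le_trans.
  by rewrite lerD2r ler_norm.
left; move: ta; rewrite (ltr0_norm t0) => ta.
have := ler_norm (- a); rewrite normrN => na.
by lra.
Qed.

Lemma L1_dtstep a e : 0 < e -> L1 (dtstep a e).
Proof.
move=> e0; apply: (L1_compact (M := `|a| + e)); first exact: continuous_dtstep.
by move=> t; exact: dtstep_supported.
Qed.

(** The total increase of the step. *)
Lemma rint_dtstep a e : 0 < e -> rint (dtstep a e) = 1.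
Proof.
move=> e0; set M := `|a| + e.
have M0 : 0 < M by rewrite ltr_wpDl.
have aM : a <= M - e by rewrite addrK ler_norm.
have aM' : - M <= a - e.
  by have := ler_norm (- a); rewrite normrN /M => na; lra.
rewrite (rint_segment (fun t => @dtstep_supported a e t e0) (lexx M)).
rewrite (rint_FTC _ (is_derive_tstep a e)); last exact: continuous_dtstep.
  rewrite tstep_right// ?tstep_left ?subr0//; first by lra.
  by rewrite -lerBrDr.
by lra.
Qed.

(** As [e] tends to [0], [dtstep a e] approaches the Dirac mass at [a]: it
    is nonnegative, has integral [1] and lives on [[a, a + e]]. *)
Lemma dtstep_dirac (s : R -> R) (a d : R) : continuous s -> 0 < d ->
  exists2 e0, 0 < e0 & forall e, 0 < e -> e <= e0 ->
    `|rint (fun t => dtstep a e t * s t) - s a| <= d.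
Proof.
move=> cs d0; have /cvgrPdist_le /(_ d d0) [e0 /= e00 He] := cs a.
exists (e0 / 2) => [|e e_gt0 ee]; first by rewrite divr_gt0.
have Id := L1_dtstep a e_gt0.
have Is : L1 (fun t => dtstep a e t * s t).
  apply: (L1_compact (M := `|a| + e)).
    by move=> t; apply: cvgM; [exact: continuous_dtstep|exact: cs].
  by move=> t /(dtstep_supported e_gt0)->; rewrite mul0r.
have -> : rint (fun t => dtstep a e t * s t) - s a =
    rint (fun t => dtstep a e t * s t - s a * dtstep a e t).
  by rewrite (rintB Is (L1Z (s a) Id)) (rintZ (s a) Id) rint_dtstep// mulr1.
have -> : d = rint (fun t => d * dtstep a e t) 
  by rewrite (rintZ d Id) rint_dtstep// mulr1.
apply: (rint_norm_le (L1B Is (L1Z (s a) Id)) (L1Z d Id)) => t.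
have [ta|ta] := boolP ((t <= a) || (a + e <= t)).
  by rewrite dtstep_out ?mul0r ?mulr0 ?subrr ?normr0//; exact/orP.
rewrite mulrC -mulrBl normrM [X in _ * X]ger0_norm ?dtstep_ge0//.
rewrite ler_wpM2r ?dtstep_ge0// distrC He//=.
move: ta; rewrite negb_or -!ltNge => /andP[at_ ta].
by rewrite distrC gtr0_norm ?subr_gt0//; lra.
Qed.

End Bumps.

(** * Cutoffs in space and windows in time *)

Section CutoffsAndWindows.
Context {R : realType}.
Local Notation mu := (@lebesgue_measure R).
Implicit Types (x y t a b e l : R) (psi : R -> R -> R[i]) (u : R -> R -> R).

(** A bump on [[-1/2, 1/2]]. Its value at the origin is some positive
    number; it is not normalised, since it cancels at the end. *)
Definition cut y : R := flat 0 (2^-1 + y) * flat 0 (2^-1 - y).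
Definition dcut y : R :=
  flat 2 (2^-1 + y) * flat 0 (2^-1 - y) - flat 0 (2^-1 + y) * flat 2 (2^-1 - y).
Definition ddcut y : R :=
  dflat 2 (2^-1 + y) * flat 0 (2^-1 - y) - 2 * (flat 2 (2^-1 + y) * flat 2 (2^-1 - y))
  + flat 0 (2^-1 + y) * dflat 2 (2^-1 - y).

Lemma is_derive_flat_add k y : is_derive y (1 : R) (fun z => flat k (2^-1 + z))
  (dflat k (2^-1 + y)).
Proof.
have dm : is_derive y (1 : R) (fun z : R => 2^-1 + z) 1.
  apply: is_derive_eq (is_deriveD (is_derive_cst (2^-1 : R) y 1)
    (is_derive_id y (1 : R))) _.
  by rewrite add0r.
by apply: is_derive_eq (@is_derive1_comp R (flat k) (fun z => 2^-1 + z) y _ _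
    (is_derive_flat k (2^-1 + y)) dm) _; rewrite mulr1.
Qed.

Lemma is_derive_flat_sub k y : is_derive y (1 : R) (fun z => flat k (2^-1 - z))
  (- dflat k (2^-1 - y)).
Proof.
have dm : is_derive y (1 : R) (fun z : R => 2^-1 - z) (- 1).
  apply: is_derive_eq (is_deriveB (is_derive_cst (2^-1 : R) y 1)
    (is_derive_id y (1 : R))) _.
  by rewrite sub0r.
by apply: is_derive_eq (@is_derive1_comp R (flat k) (fun z => 2^-1 - z) y _ _
    (is_derive_flat k (2^-1 - y)) dm) _; rewrite mulrN1.
Qed.

Lemma is_derive_cut y : is_derive y (1 : R) cut (dcut y).
Proof.
apply: is_derive_eq (is_deriveM (is_derive_flat_add 0 y) (is_derive_flat_sub 0 y)) _.
by rewrite /dcut /dflat /GRing.scale /=; ring.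
Qed.

Lemma is_derive_dcut y : is_derive y (1 : R) dcut (ddcut y).
Proof.
apply: is_derive_eq (is_deriveB
  (is_deriveM (is_derive_flat_add 2 y) (is_derive_flat_sub 0 y))
  (is_deriveM (is_derive_flat_add 0 y) (is_derive_flat_sub 2 y))) _.
by rewrite /ddcut /dflat /GRing.scale /=; ring.
Qed.

Lemma cut_norm y : `|cut y| <= 1.
Proof.
rewrite /cut normrM -[leRHS]mulr1; apply: ler_pM => //; exact: (flat_norm 0).
Qed.

Lemma cut_out y : 2^-1 <= `|y| -> cut y = 0.
Proof.
move=> hy; rewrite /cut; have [y0|y0] := leP 0 y.
  by rewrite [flat 0 (_ - _)]flat_le0 ?mulr0//; move: hy; rewrite ger0_norm// subr_le0.
rewrite flat_le0 ?mul0r//; move: hy; rewrite ltr0_norm// => hy; lra.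
Qed.

Lemma cut0_gt0 : 0 < cut 0.
Proof. by rewrite /cut addr0 subr0 mulr_gt0// flat_gt0// invr_gt0. Qed.

Lemma flat2_le y : 0 <= flat 2 y <= 2.
Proof. by rewrite flat_ge0 /=; exact: (flat_bound 2). Qed.
Lemma flat0_le y : 0 <= flat 0 y <= 1.
Proof. by rewrite flat_ge0 /=; exact: (flat_bound 0). Qed.

Lemma dcut_norm y : `|dcut y| <= 2.
Proof.
rewrite /dcut; have /andP[p0 p1] := flat2_le (2^-1 + y).
have /andP[q0 q1] := flat0_le (2^-1 - y); have /andP[r0 r1] := flat0_le (2^-1 + y).
have /andP[s0 s1] := flat2_le (2^-1 - y).
by rewrite ler_norml; apply/andP; split; nra.
Qed.

Lemma dflat2_norm y : `|dflat 2 y| <= 36.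
Proof.
rewrite /dflat; apply: (le_trans (ler_normB _ _)).
(* [4! + 2 * 3!], from the bounds on the flat functions. *)
have -> : (36 : R) = 24 + 12 by ring.
apply: lerD; first exact: (flat_norm 4).
rewrite normrM ger0_norm// (_ : 12 = 2 * 6 :> R); last by ring.
by rewrite ler_pM2l//; exact: (flat_norm 3).
Qed.

Lemma ddcut_norm y : `|ddcut y| <= 80.
Proof.
rewrite /ddcut; apply: (le_trans (ler_normD _ _)).
rewrite (_ : 80 = 36 * 1 + 2 * (2 * 2) + 1 * 36 :> R); last by ring.
apply: lerD; last by rewrite normrM ler_pM// ?dflat2_norm//; exact: (flat_norm 0).
apply: (le_trans (ler_normB _ _)); apply: lerD.
  by rewrite normrM ler_pM// ?dflat2_norm//; exact: (flat_norm 0).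
rewrite normrM [X in X * _]ger0_norm// ler_pM2l// normrM.
by apply: ler_pM => //; exact: (flat_norm 2).
Qed.

Lemma continuous_cut : continuous cut.
Proof.
move=> x; apply/differentiable_continuous/derivable1_diffP.
by have [] := is_derive_cut x.
Qed.

(** As the parameter [l] tends to [0] the cutoff flattens, and each
    derivative in [x] gains a factor [l]. *)
Definition cutoff l (p : R * R) : R := cut (l * p.1).

Lemma smooth_cutoff l : smooth (cutoff l).
Proof.
have sl : smooth (fun p : R * R => l * p.1).
  by apply: smoothM; [exact: smooth_cst|exact: smooth_fst].
by apply: smoothM; apply: smooth_flat;
  [apply: smoothD|apply: smoothB] => //; exact: smooth_cst.
Qed.

Lemma is_derive_scale_fst l p :
  is_derive p (dir_x R) (fun q : R * R => l * q.1) l.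
Proof.
apply: is_derive_eq (is_deriveM_plane (is_derive_cst l p (dir_x R))
  (is_derive_coord1 p (dir_x R))) _.
by rewrite dir_xE mulr0 addr0 mulr1.
Qed.

Lemma is_derive_cutoff l p :
  is_derive p (dir_x R) (cutoff l) (l * dcut (l * p.1)).
Proof.
apply: is_derive_eq (is_derive_scomp (is_derive_scale_fst l p)
  (is_derive_cut (l * p.1))) _.
by rewrite mulrC.
Qed.

Lemma is_derive_dcutoff l p :
  is_derive p (dir_x R) (fun q : R * R => l * dcut (l * q.1)) (l ^+ 2 * ddcut (l * p.1)).
Proof.
apply: is_derive_eq (is_deriveM_plane (is_derive_cst l p (dir_x R))
  (is_derive_scomp (is_derive_scale_fst l p) (is_derive_dcut (l * p.1)))) _.
by rewrite /= mulr0 addr0; ring.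
Qed.

Lemma xsupported_cutoff l : 0 < l -> xsupported l^-1 (cutoff l).
Proof.
move=> l0 x t xl; rewrite /cutoff /= cut_out// normrM gtr0_norm//.
have : 1 <= l * `|x| by rewrite -ler_pdivrMl// mulr1 ltW.
by apply: le_trans; rewrite invf_le1// ler1n.
Qed.

(** Dominated convergence with majorant [|v|]. *)
Lemma cut_limit (v : R -> R) : L1 v ->
  rint (fun x => cut (l * x) * v x) @[l --> (0 : R)] --> cut 0 * rint v.
Proof.
move=> Iv; rewrite -rintZ//.
have -> : rint (fun x => cut 0 * v x) = rint (fun x => cut (0 * x) * v x).
  by congr rint; apply/funext => x; rewrite mul0r.
have cw x : continuous (fun l => cut (l * x) * v x).
  move=> l; apply: cvgM; last exact: cvg_cst.
  apply: (cvg_comp (fun l => l * x) cut); last exact: continuous_cut.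
  by apply: cvgM; [exact: cvg_id|exact: cvg_cst].
have dom l x : `|cut (l * x) * v x| <= `|v x|.
  by rewrite normrM ler_piMl// cut_norm.
apply: (@continuity_under_integral _ _ _ mu (fun l x => cut (l * x) * v x) setT
  measurableT (0 - 1) (0 + 1) _ _ (fun x => `|v x|) (L1_norm Iv) _ 0
  (mem_itv_center 0)).
- move=> l _; apply: (L1_le _ (dom l) (L1_norm Iv)).
  apply: measurable_funM; last exact: L1_measurable.
  apply: continuous_measurable => x.
  apply: (cvg_comp (fun x => l * x) cut); last exact: continuous_cut.
  by apply: cvgM; [exact: cvg_cst|exact: cvg_id].
- by apply: aeW => x _ l _; exact: cw.
- by move=> l _; apply: aeW => x _; exact: dom.
Qed.

Lemma window_norm a b e t : `|tstep a e t - tstep b e t| <= 1.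
Proof.
have := step_ge0 (e^-1 * (t - a)); have := step_le1 (e^-1 * (t - a)).
have := step_ge0 (e^-1 * (t - b)); have := step_le1 (e^-1 * (t - b)).
rewrite /tstep => *; rewrite ler_norml; apply/andP; split; lra.
Qed.

Lemma window_out a b e t M : 0 < e <= 1 -> `|a| + 1 <= M -> `|b| + 1 <= M ->
  M < `|t| -> tstep a e t - tstep b e t = 0.
Proof.
move=> /andP[e0 e1] aM bM; have [t0|t0] := leP 0 t.
  rewrite ger0_norm// => tM; have := ler_norm a; have := ler_norm b => ? ?.
  by rewrite !tstep_right// ?subrr//; lra.
rewrite ltr0_norm// => tM; have := ler_norm (- a); have := ler_norm (- b).
by rewrite !normrN => ? ?; rewrite !tstep_left// ?subrr//; lra.
Qed.

(** Passing from weak to pointwise information in time. If the derivative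
    of [s] is [q], up to a sign, when tested against the windows with edges
    at [a] and [b], and [q] is bounded by [K], then [s] changes between [a]
    and [b] by at most [K] times the length of an interval that contains
    both: the derivative of the window tends to the difference of the two
    Dirac masses. *)
Lemma window_drift (s q : R -> R) a b M K k : continuous s -> continuous q ->
  `|k| = 1 -> `|a| + 1 <= M -> `|b| + 1 <= M -> 0 <= K ->
  (forall t, `|t| <= M -> `|q t| <= K) ->
  (forall e, 0 < e <= 1 -> rint (fun t => (dtstep a e t - dtstep b e t) * s t) =
     k * rint (fun t => (tstep a e t - tstep b e t) * q t)) ->
  `|s a - s b| <= K * rint (boxf M).
Proof.
move=> cs cq k1 aM bM K0 qK W; apply/ler_addgt0Pr => d d0.
have d2 : 0 < d / 2 by rewrite divr_gt0.
have [ea ea0 Ha] := dtstep_dirac a cs d2; have [eb eb0 Hb] := dtstep_dirac b cs d2.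
(* Small enough for both edges of the window, and at most [1] so that the
   window stays inside [[-M, M]]. *)
pose e := Num.min (Num.min ea eb) 1.
have e0 : 0 < e by rewrite !lt_min ea0 eb0 ltr01.
have e1 : e <= 1 by rewrite ge_min lexx orbT.
have {}Ha := Ha e e0 (_ : e <= ea); have {}Hb := Hb e e0 (_ : e <= eb).
have He : e <= ea by rewrite !ge_min lexx.
have He' : e <= eb by rewrite !ge_min lexx !orbT.
have Is c : L1 (fun t => dtstep c e t * s t).
  apply: (L1_compact (M := `|c| + e)).
    by move=> t; apply: cvgM; [exact: continuous_dtstep|exact: cs].
  by move=> t /(dtstep_supported e0)->; rewrite mul0r.
have e01 : 0 < e <= 1 by rewrite e0.
have := W e e01.
have -> : (fun t => (dtstep a e t - dtstep b e t) * s t) =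
    (fun t => dtstep a e t * s t - dtstep b e t * s t).
  by apply/funext => t; rewrite mulrBl.
rewrite rintB// => E.
have B : `|k * rint (fun t => (tstep a e t - tstep b e t) * q t)| <= K * rint (boxf M).
  rewrite normrM k1 mul1r -rintZ; last exact: L1_boxf.
  have ctw c : continuous (tstep c e).
    move=> t; apply/differentiable_continuous/derivable1_diffP.
    by have [] := is_derive_tstep c e t.
  apply: rint_norm_le.
  - apply: (L1_compact (M := M)) => [t|t tM]; last by rewrite (window_out e01 aM bM tM) mul0r.
    by apply: cvgM; [apply: cvgB; exact: ctw|exact: cq].
  - exact: (L1Z _ (L1_boxf M)).
  - move=> t; rewrite /boxf; case: ifPn => [tM|].
      by rewrite mulr1 normrM -[leRHS]mul1r ler_pM// ?window_norm// qK.
    by rewrite -ltNge => tM; rewrite (window_out e01 aM bM tM) mul0r normr0 mulr0.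
rewrite -E in B; have {}Ha := Ha He; have {}Hb := Hb He'.
move: Ha Hb B; set A1 := rint _; set B1 := rint _.
rewrite !ler_norml => /andP[a1 a2] /andP[b1 b2] /andP[c1 c2].
by apply/andP; split; lra.
Qed.

End CutoffsAndWindows.

(** * Conservation of the pairing with an adjoint solution *)

Section ConservationLaw.
Context {R : realType}.
Local Notation mu := (@lebesgue_measure R).
Implicit Types (x y t a b e l M : R) (psi : R -> R -> R[i]) (u : R -> R -> R).

(** Convergence in norm implies weak convergence. *)
Lemma cvg_weak u (v : R -> R) t0 : cL2 u -> L2 v ->
  rint (fun x => (u x t - u x t0) * v x) @[t --> t0] --> 0.
Proof.
move=> [u2 uc] v2.
have b0 : rint (fun x => (u x t - u x t0) ^+ 2) * rint (fun x => v x ^+ 2)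
    @[t --> t0] --> (0 : R).
  rewrite -[X in _ --> X](mul0r (rint (fun x => v x ^+ 2))).
  by apply: cvgM; [exact: uc|exact: cvg_cst].
have CS t : rint (fun x => (u x t - u x t0) * v x) ^+ 2 <=
    rint (fun x => (u x t - u x t0) ^+ 2) * rint (fun x => v x ^+ 2).
  by apply: cauchy_schwarz => //; exact: L2B.
by apply: (cvg0_sqr _ b0); exists 1 => //= t _; exact: CS.
Qed.

Lemma cL2_sqr_continuous u : cL2 u -> continuous (fun t => rint (fun x => u x t ^+ 2)).
Proof.
move=> cu t0; have [u2 uc] := cu; pose d t x := u x t - u x t0.
have d2 t : L2 (d t) by exact: L2B.
have E : (fun t => rint (fun x => u x t ^+ 2)) = (fun t =>
    rint (fun x => d t x ^+ 2) + 2 * rint (fun x => d t x * u x t0)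
    + rint (fun x => u x t0 ^+ 2)).
  apply/funext => t.
  have I1 := L2_sqr (d2 t); have I2 := L2_mul (d2 t) (u2 t0).
  have I3 := L2_sqr (u2 t0).
  rewrite -rintZ// -rintD//; last exact: L1Z.
  rewrite -rintD//; last by apply: L1D => //; exact: L1Z.
  by congr rint; apply/funext => x; rewrite /d; ring.
have Z := cvg_weak t0 cu (u2 t0).
rewrite /continuous_at E -[X in _ --> X]add0r.
have -> : (0 : R) + rint (fun x => u x t0 ^+ 2) =
  0 + 2 * 0 + rint (fun x => u x t0 ^+ 2) by rewrite mulr0 addr0.
by apply: cvgD; [apply: cvgD; [exact: uc|apply: cvgM; [exact: cvg_cst|exact: Z]]
  |exact: cvg_cst].
Qed.

(** A continuous curve in L^2 is bounded on compact time intervals. *)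
Lemma cL2_bounded u T : cL2 u -> exists2 K : R, 0 <= K &
  forall t, `|t| <= T -> rint (fun x => u x t ^+ 2) <= K.
Proof.
move=> /cL2_sqr_continuous cn.
have [D [Dr HD]] := compact_bounded
  (continuous_compact (continuous_subspaceT cn) (@segment_compact R (- T) T)).
exists (`|D| + 1) => [|t tT]; first by rewrite addr_ge0.
apply: (le_trans (ler_norm _)); apply: (HD (`|D| + 1)).
  by rewrite (le_lt_trans (ler_norm _))// ltrDl.
by exists t => //; rewrite /= in_itv /= -ler_norml.
Qed.

(** Each component is dominated by the squared modulus. *)
Lemma gauss_cL2 (c : R) (F : R * R -> R[i]) : csmooth F -> gauss_bounded c F ->
  cL2 (reP (fun x t => F (x, t))) /\ cL2 (imP (fun x t => F (x, t))).
Proof.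
move=> [s1 s2] bF.
have H (f : R * R -> R) : smooth f -> (forall p, f p ^+ 2 <= normsq (F p)) ->
    cL2 (fun x t => f (x, t)).
  move=> /smooth_continuous cf fF; apply: (cL2_gauss (c := c)).
  - by move=> x; exact: continuous_slice_t.
  - by move=> t; apply: continuous_measurable; exact: continuous_slice_x.
  - move=> T; have [C [d [C0 d0 HC]]] := bF T; exists C, d; split => // x t tT.
    exact: le_trans (fF (x, t)) (HC x t tT).
split.
- by apply: (H (fun p => cRe (F p))) => // p; rewrite lerDl sqr_ge0.
- by apply: (H (fun p => cIm (F p))) => // p; rewrite lerDr sqr_ge0.
Qed.

(** The closure of the set where the function does not vanish is a closed
    subset of a compact box. *)
Lemma supported_test_function M (phi : R * R -> R[i]) : csmooth phi ->
  csupported M phi -> test_function phi.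
Proof.
move=> [s1 s2] [u1 u2]; split=> //; split=> //.
have K : compact ((`[(- M)%R, M] : set R) `*` (`[(- M)%R, M] : set R)).
  by apply: compact_setX; exact: segment_compact.
apply: (subclosed_compact _ K); first exact: closed_closure.
have cK : closed ((`[(- M)%R, M] : set R) `*` (`[(- M)%R, M] : set R)).
  by apply: compact_closed K; exact: norm_hausdorff.
rewrite [X in _ `<=` X](closure_id _).1//; apply: closureS => -[x t] /= phi0.
have [xt|] := pselect (M < `|x| \/ M < `|t|).
  have z0 : phi (x, t) = 0 by apply: complex_ext; [exact: u1|exact: u2].
  by move: phi0; rewrite z0 eqxx.
move=> /not_orP[/negP + /negP]; rewrite -!leNgt => xM tM.
by split; rewrite /= in_itv /= -ler_norml.
Qed.

Lemma pairDr M u (f g : R * R -> R) : cL2 u -> continuous f -> continuous g ->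
  supported M f -> supported M g ->
  pair u (fun p => f p + g p) = pair u f + pair u g.
Proof.
move=> cu cf cg sf sg; rewrite /pair -rintD; [|exact: pair_outer cf sf|exact: pair_outer cg sg].
congr rint; apply/funext => t; rewrite -rintD.
- by congr rint; apply/funext => x; rewrite mulrDr.
- exact: (L1_pairing _ (cu.1 t) cf (supported_x sf)).
- exact: (L1_pairing _ (cu.1 t) cg (supported_x sg)).
Qed.

Lemma pairNr M u (f : R * R -> R) : cL2 u -> continuous f -> supported M f ->
  pair u (fun p => - f p) = - pair u f.
Proof.
move=> cu cf sf; rewrite /pair -rintN; last exact: pair_outer cf sf.
congr rint; apply/funext => t; rewrite -rintN.
- by congr rint; apply/funext => x; rewrite mulrN.
- exact: (L1_pairing _ (cu.1 t) cf (supported_x sf)).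
Qed.

Lemma cRe_scale (k : R) (z : R[i]) : cRe (k%:C * z) = k * cRe z.
Proof. by rewrite cReM /= mul0r subr0. Qed.

Lemma cIm_scale (k : R) (z : R[i]) : cIm (k%:C * z) = k * cIm z.
Proof. by rewrite cImM /= mul0r addr0. Qed.

(** Stated for abstract numbers, like the next one, so that the pairings
    below are treated as atoms. *)
Lemma complexD_components (a1 a2 b1 b2 c1 c2 d1 d2 : R) :
  (a1 + a2 - (b1 + b2)) +i* (c1 + c2 + (d1 + d2)) =
  ((a1 - b1) +i* (c1 + d1)) + ((a2 - b2) +i* (c2 + d2)).
Proof. by apply: complex_ext => /=; ring. Qed.

Lemma complexi_components (a b c d : R) :
  (- c - b) +i* (a + - d) = 'i%C * ((a - d) +i* (c + b)).
Proof. by apply: complex_ext; rewrite ?cReM ?cImM /=; ring. Qed.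

Section Solution.
Variable psi : R -> R -> R[i].
Hypotheses (cu : cL2 (reP psi)) (cv : cL2 (imP psi)).

Lemma distr_ofD M (F G : R * R -> R[i]) : csmooth F -> csmooth G ->
  csupported M F -> csupported M G ->
  distr_of psi (fun p => F p + G p) = distr_of psi F + distr_of psi G.
Proof.
move=> sF sG uF uG; have sFG := csmoothD sF sG.
have uFG : csupported M (fun p => F p + G p).
  by split=> x t xt; rewrite ?cReD ?cImD ?(uF.1 _ _ xt) ?(uG.1 _ _ xt)
    ?(uF.2 _ _ xt) ?(uG.2 _ _ xt) addr0.
rewrite (distr_ofE cu cv sFG uFG) (distr_ofE cu cv sF uF) (distr_ofE cu cv sG uG).
have -> : (fun p => cRe (F p + G p)) = (fun p => cRe (F p) + cRe (G p)).
  by apply/funext => p; rewrite cReD.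
have -> : (fun p => cIm (F p + G p)) = (fun p => cIm (F p) + cIm (G p)).
  by apply/funext => p; rewrite cImD.
have F1 := smooth_continuous sF.1; have F2 := smooth_continuous sF.2.
have G1 := smooth_continuous sG.1; have G2 := smooth_continuous sG.2.
rewrite (pairDr cu F1 G1 uF.1 uG.1) (pairDr cv F1 G1 uF.1 uG.1).
rewrite (pairDr cu F2 G2 uF.2 uG.2) (pairDr cv F2 G2 uF.2 uG.2).
exact: complexD_components.
Qed.

Lemma csupported_i M (F : R * R -> R[i]) : csupported M F ->
  csupported M (fun p => 'i%C * F p).
Proof.
move=> uF; split=> x t xt; rewrite ?cReM ?cImM /= ?(uF.1 _ _ xt) ?(uF.2 _ _ xt).
- by rewrite !mulr0 subrr.
- by rewrite !mulr0 addr0.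
Qed.

Lemma distr_ofi M (F : R * R -> R[i]) : csmooth F -> csupported M F ->
  distr_of psi (fun p => 'i%C * F p) = 'i%C * distr_of psi F.
Proof.
move=> sF uF; have siF := csmoothM (csmooth_cst 'i%C) sF.
rewrite (distr_ofE cu cv siF (csupported_i uF)) (distr_ofE cu cv sF uF).
have -> : (fun p => cRe ('i%C * F p)) = (fun p => - cIm (F p)).
  by apply/funext => p; rewrite cReM /=; ring.
have -> : (fun p => cIm ('i%C * F p)) = (fun p => cRe (F p)).
  by apply/funext => p; rewrite cImM /=; ring.
have F1 := smooth_continuous sF.1; have F2 := smooth_continuous sF.2.
rewrite (pairNr cu F2 uF.2) (pairNr cv F2 uF.2).
exact: complexi_components.
Qed.

(** The bilinear pairing, without complex conjugation: its conservation is
    the adjoint form of the equation. *)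
Definition cpairing (F : R * R -> R[i]) t : R[i] :=
  cintegral (fun x => psi x t * F (x, t)).

Definition cxsupported M (F : R * R -> R[i]) :=
  xsupported M (fun p => cRe (F p)) /\ xsupported M (fun p => cIm (F p)).

Lemma L1_product t (F : R -> R[i]) : L2 (fun x => cRe (F x)) ->
  L2 (fun x => cIm (F x)) -> L1 (fun x => cRe (psi x t * F x)) /\
  L1 (fun x => cIm (psi x t * F x)).
Proof.
move=> F1 F2; have u2 := cu.1 t; have v2 := cv.1 t; split.
- by under eq_fun do rewrite cReM; apply: L1B; exact: L2_mul.
- by under eq_fun do rewrite cImM; apply: L1D; exact: L2_mul.
Qed.

Lemma cpairing_continuous M F : csmooth F -> cxsupported M F ->
  continuous (fun t => cRe (cpairing F t)) /\ continuous (fun t => cIm (cpairing F t)).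
Proof.
move=> [s1 s2] [x1 x2].
have F1 := smooth_continuous s1; have F2 := smooth_continuous s2.
have I (w : R -> R -> R) f t : cL2 w -> continuous f -> xsupported M f ->
    L1 (fun x => w x t * f (x, t)).
  by move=> cw cf xf; exact: (L1_pairing _ (cw.1 t) cf xf).
split.
- have -> : (fun t => cRe (cpairing F t)) = (fun t =>
     rint (fun x => reP psi x t * cRe (F (x, t))) - rint (fun x => imP psi x t * cIm (F (x, t)))).
    apply/funext => t; rewrite -rintB; [|exact: (I _ _ t cu F1 x1)|exact: (I _ _ t cv F2 x2)].
    by rewrite /cpairing /=; congr rint; apply/funext => x; rewrite cReM.
  by move=> t; apply: cvgB; [exact: (pairing_continuous cu F1 x1)
    |exact: (pairing_continuous cv F2 x2)].
- have -> : (fun t => cIm (cpairing F t)) = (fun t =>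
     rint (fun x => reP psi x t * cIm (F (x, t))) + rint (fun x => imP psi x t * cRe (F (x, t)))).
    apply/funext => t; rewrite -rintD; [|exact: (I _ _ t cu F2 x2)|exact: (I _ _ t cv F1 x1)].
    by rewrite /cpairing /=; congr rint; apply/funext => x; rewrite cImM.
  by move=> t; apply: cvgD; [exact: (pairing_continuous cu F2 x2)
    |exact: (pairing_continuous cv F1 x1)].
Qed.

Lemma cxsupported_L2 M F t : csmooth F -> cxsupported M F ->
  L2 (fun x => cRe (F (x, t))) /\ L2 (fun x => cIm (F (x, t))).
Proof.
move=> [s1 s2] [x1 x2]; split.
- exact: (L2_slice t (smooth_continuous s1) x1).
- exact: (L2_slice t (smooth_continuous s2) x2).
Qed.

(** A factor that depends on time only can be taken out of the inner
    integral. *)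
Lemma distr_of_window M (w : R -> R) F : csmooth F -> cxsupported M F ->
  distr_of psi (fun p => (w p.2)%:C * F p) =
  rint (fun t => w t * cRe (cpairing F t)) +i* rint (fun t => w t * cIm (cpairing F t)).
Proof.
move=> sF xF; apply: complex_ext => /=; congr rint; apply/funext => t.
- have [F1 F2] := cxsupported_L2 t sF xF; have [I1 _] := L1_product t F1 F2.
  rewrite /cpairing /= -rintZ//.
  by congr rint; apply/funext => x; rewrite mulrCA cRe_scale.
- have [F1 F2] := cxsupported_L2 t sF xF; have [_ I2] := L1_product t F1 F2.
  rewrite /cpairing /= -rintZ//.
  by congr rint; apply/funext => x; rewrite mulrCA cIm_scale.
Qed.

Lemma csupported_window M (w : R -> R) F : (forall t, M < `|t| -> w t = 0) ->
  cxsupported M F -> csupported M (fun p => (w p.2)%:C * F p).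
Proof.
move=> w0 [x1 x2]; split=> x t [xM|tM]; rewrite ?cRe_scale ?cIm_scale.
- by rewrite x1 ?mulr0.
- by rewrite w0 ?mul0r.
- by rewrite x2 ?mulr0.
- by rewrite w0 ?mul0r.
Qed.

Lemma cxsupported_scale M (f : R * R -> R) F : xsupported M f ->
  cxsupported M (fun p => (f p)%:C * F p).
Proof. by move=> xf; split=> x t xM; rewrite ?cRe_scale ?cIm_scale xf ?mul0r. Qed.

Lemma cxsupportedD M F G : cxsupported M F -> cxsupported M G ->
  cxsupported M (fun p => F p + G p).
Proof.
move=> [f1 f2] [g1 g2]; split=> x t xM.
- by rewrite cReD f1 ?g1 ?addr0.
- by rewrite cImD f2 ?g2 ?addr0.
Qed.

Lemma cxsupported_le M M' F : M <= M' -> cxsupported M F -> cxsupported M' F.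
Proof.
by move=> MM' [f1 f2]; split=> x t xM; [apply: f1|apply: f2]; exact: le_lt_trans xM.
Qed.

Lemma cderive_real v (f : R * R -> R) p : axis v -> smooth f ->
  cderive v (fun q => (f q)%:C) p = ('D_v f p)%:C.
Proof.
move=> av sf; apply: cderive_eq; first exact: smooth_is_derive.
exact: is_derive_cst.
Qed.

(** Groups the terms in which the derivatives fall on the cutoff [k]. *)
Lemma second_derivative_expansion (w k k1 k2 g g1 g2 : R[i]) :
  w * (k * g2 + g1 * k1 + (g * k2 + k1 * g1)) =
  w * (k * g2) + w * (k1 * (2 * g1) + k2 * g).
Proof. by ring. Qed.

Lemma time_derivative_expansion (i w dw k g dg : R[i]) :
  i * (w * (k * dg + g * 0) + (k * g) * dw) =
  w * (k * (i * dg)) + i * (dw * (k * g)).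
Proof. by ring. Qed.

Section Adjoint.
Variables (G : R * R -> R[i]) (c : R).
Hypotheses (sG : csmooth G)
  (GE : forall p, 'i%C * cderive (dir_t R) G p =
     cderive (dir_x R) (cderive (dir_x R) G) p)
  (bG : gauss_bounded c G) (bGx : gauss_bounded c (cderive (dir_x R) G)).

Notation Gx := (cderive (dir_x R) G).

Definition cutG l p : R[i] := (cutoff l p)%:C * G p.

(** The commutator of the second space derivative with the cutoff, applied
    to [G]: every term contains a derivative of the cutoff, hence a factor
    [l]. *)
Definition cut_error l p : R[i] :=
  (l * dcut (l * p.1))%:C * (2 * Gx p) + (l ^+ 2 * ddcut (l * p.1))%:C * G p.

Let ax : axis (dir_x R). Proof. by left. Qed.
Let at_ : axis (dir_t R). Proof. by right. Qed.

Lemma dcutoffE l : 'D_(dir_x R) (cutoff l) = (fun p => l * dcut (l * p.1)).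
Proof. by apply/funext => p; have [] := is_derive_cutoff l p. Qed.

Lemma ddcutoffE l : 'D_(dir_x R) (fun p : R * R => l * dcut (l * p.1)) =
  (fun p => l ^+ 2 * ddcut (l * p.1)).
Proof. by apply/funext => p; have [] := is_derive_dcutoff l p. Qed.

Lemma smooth_dcutoff l : smooth (fun p : R * R => l * dcut (l * p.1)).
Proof. by rewrite -dcutoffE; apply: smooth_derive_axis => //; exact: smooth_cutoff. Qed.

Lemma smooth_ddcutoff l : smooth (fun p : R * R => l ^+ 2 * ddcut (l * p.1)).
Proof. by rewrite -ddcutoffE; apply: smooth_derive_axis => //; exact: smooth_dcutoff. Qed.

Lemma csmooth_cutG l : csmooth (cutG l).
Proof. by apply: csmoothM => //; apply: csmooth_real; exact: smooth_cutoff. Qed.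

Lemma csmooth_cut_error l : csmooth (cut_error l).
Proof.
apply: csmoothD; apply: csmoothM => //.
- by apply: csmooth_real; exact: smooth_dcutoff.
- by apply: csmoothM; [exact: csmooth_cst|exact: csmooth_cderive].
- by apply: csmooth_real; exact: smooth_ddcutoff.
Qed.

Lemma xsupported_dcutoff l : 0 < l ->
  xsupported l^-1 (fun p => l * dcut (l * p.1)).
Proof.
move=> l0 x t xl; have := @derive_supported R (fun y => cutoff l (y, t))
  (fun y => l * dcut (l * y)) l^-1
  (fun y => is_derive_slice_x (is_derive_cutoff l (y, t))).
by apply => // y; exact: xsupported_cutoff.
Qed.

Lemma xsupported_ddcutoff l : 0 < l ->
  xsupported l^-1 (fun p => l ^+ 2 * ddcut (l * p.1)).
Proof.
move=> l0 x t xl; have := @derive_supported R (fun y => l * dcut (l * y))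
  (fun y => l ^+ 2 * ddcut (l * y)) l^-1
  (fun y => is_derive_slice_x (is_derive_dcutoff l (y, t))).
by apply => // y; exact: (xsupported_dcutoff l0 (x := y) t).
Qed.

Lemma cxsupported_cutG l : 0 < l -> cxsupported l^-1 (cutG l).
Proof. by move=> l0; apply: cxsupported_scale; exact: xsupported_cutoff. Qed.

Lemma cxsupported_cut_error l : 0 < l -> cxsupported l^-1 (cut_error l).
Proof.
move=> l0; apply: cxsupportedD; apply: cxsupported_scale.
  exact: xsupported_dcutoff.
exact: xsupported_ddcutoff.
Qed.

(** Both sides of the equation produce the same main term, because [i G_t =
    G_xx]; what remains is the cutoff error in space and the derivative of
    the window in time. *)
Lemma cutoff_test_function (w dw : R -> R) l p :
  smooth (fun q : R * R => w q.2) ->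
  (forall q, is_derive q (dir_t R) (fun q : R * R => w q.2) (dw q.2)) ->
  let phi q := (w q.2)%:C * cutG l q in
  let main := (w p.2)%:C * ((cutoff l p)%:C * cderive (dir_x R) Gx p) in
  cderive (dir_x R) (cderive (dir_x R) phi) p = main + (w p.2)%:C * cut_error l p /\
  'i%C * cderive (dir_t R) phi p = main + 'i%C * ((dw p.2)%:C * cutG l p).
Proof.
move=> sw dwE phi main.
have scw := csmooth_real sw; have scc := csmooth_real (smooth_cutoff l).
have sc1 := csmooth_real (smooth_dcutoff l).
have sGx := csmooth_cderive ax sG.
have wx q : cderive (dir_x R) (fun q => (w q.2)%:C) q = 0.
  rewrite cderive_real//.
  have -> : 'D_(dir_x R) (fun q => w q.2) q = 0; last by [].
  rewrite -derive_line (_ : (fun s : R => _) = cst (w q.2)) ?derive_cst//.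
  apply/funext => s; congr w.
  have -> : (s *: dir_x R + q).2 = s *: 0 + q.2 by [].
  by rewrite scaler0 add0r.
have wt q : cderive (dir_t R) (fun q => (w q.2)%:C) q = (dw q.2)%:C.
  by rewrite cderive_real//; congr (_%:C); have [] := dwE q.
have ct q : cderive (dir_t R) (fun q => (cutoff l q)%:C) q = 0.
  rewrite cderive_real//; last exact: smooth_cutoff.
  have -> : 'D_(dir_t R) (cutoff l) q = 0; last by [].
  rewrite -derive_line (_ : (fun s : R => _) = cst (cutoff l q)) ?derive_cst//.
  apply/funext => s; rewrite /cutoff; congr (cut (_ * _)).
  have -> : (s *: dir_t R + q).1 = s *: 0 + q.1 by [].
  by rewrite scaler0 add0r.
have cx q : cderive (dir_x R) (fun q => (cutoff l q)%:C) q = (l * dcut (l * q.1))%:C.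
  rewrite (cderive_real q ax (smooth_cutoff l)); congr (_%:C).
  by have [] := is_derive_cutoff l q.
have c1x q : cderive (dir_x R) (fun q : R * R => (l * dcut (l * q.1))%:C) q =
    (l ^+ 2 * ddcut (l * q.1))%:C.
  rewrite (cderive_real q ax (smooth_dcutoff l)); congr (_%:C).
  by have [] := is_derive_dcutoff l q.
have phix : cderive (dir_x R) phi = (fun q => (w q.2)%:C *
    ((cutoff l q)%:C * Gx q + G q * (l * dcut (l * q.1))%:C)).
  apply/funext => q; rewrite (cderiveM ax _ scw (csmooth_cutG l)) wx mulr0 addr0.
  by rewrite (cderiveM ax _ scc sG) cx.
split.
- have s1 := csmoothM scc sGx; have s2 := csmoothM sG sc1.
  rewrite phix (cderiveM ax _ scw (csmoothD s1 s2)) wx mulr0 addr0.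
  rewrite (cderiveD ax _ s1 s2) (cderiveM ax _ scc sGx) (cderiveM ax _ sG sc1) cx c1x.
  exact: second_derivative_expansion.
- rewrite (cderiveM at_ _ scw (csmooth_cutG l)) wt (cderiveM at_ _ scc sG) ct.
  by rewrite /main -GE; exact: time_derivative_expansion.
Qed.

Lemma cut_error_normsq l p : 0 < l <= 1 ->
  normsq (cut_error l p) <= l ^+ 2 * (32 * normsq (Gx p) + (2 * 80 ^+ 2) * normsq (G p)).
Proof.
move=> /andP[l0 l1]; rewrite /cut_error; apply: (le_trans (normsqD_le _ _)).
have N (k : R) z : normsq (k%:C * z) = k ^+ 2 * normsq z.
  by rewrite normsqM; congr (_ * _); rewrite /normsq /= expr0n addr0.
have -> : 2 * Gx p = 2%:C * Gx p.
  by congr (_ * _); apply: complex_ext => //=; rewrite addr0.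
rewrite !N.
have d1 : dcut (l * p.1) ^+ 2 <= 4.
  rewrite -real_normK ?num_real// (_ : 4 = 2 ^+ 2 :> R); last by ring.
  by rewrite ler_sqr ?nnegrE// dcut_norm.
have d2 : ddcut (l * p.1) ^+ 2 <= 80 ^+ 2.
  by rewrite -real_normK ?num_real// ler_sqr ?nnegrE ?ler0n// ddcut_norm.
have l2 : 0 <= l ^+ 2 by exact: sqr_ge0.
have l21 : l ^+ 2 <= 1 by rewrite expr_le1// ltW.
have n1 := normsq_ge0 (Gx p); have n2 := normsq_ge0 (G p).
move: d1 d2 l2 l21 n1 n2; set A := dcut _; set B := ddcut _.
set n1 := normsq _; set n2 := normsq _; rewrite !exprMn.
set L := l ^+ 2; set A2 := A ^+ 2; set B2 := B ^+ 2 => d1 d2 l2 l21 n10 n20.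
have A0 : 0 <= A2 by exact: sqr_ge0.
have B0 : 0 <= B2 by exact: sqr_ge0.
rewrite [X in _ <= X]mulrDr; apply: lerD.
  rewrite (_ : 2 * (L * A2 * (2 ^+ 2 * n1)) = L * (8 * n1) * A2); last by ring.
  rewrite (_ : L * (32 * n1) = L * (8 * n1) * 4); last by ring.
  by rewrite ler_wpM2l// mulr_ge0// mulr_ge0.
rewrite (_ : 2 * (L * L * B2 * n2) = L * (2 * n2) * (L * B2)); last by ring.
rewrite (_ : L * ((2 * 80 ^+ 2) * n2) = L * (2 * n2) * 80 ^+ 2); last by ring.
rewrite ler_wpM2l//; first by rewrite mulr_ge0// mulr_ge0.
by rewrite -[leRHS]mul1r ler_pM.
Qed.

(** The arithmetic-geometric inequality [2 |z w| <= l |z|^2 + |w|^2 / l],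
    applied to a factor [w] of size [O (l)]. *)
Lemma product_bound l (E : R) (z w : R[i]) : 0 < l -> normsq w <= l ^+ 2 * E ->
  `|cRe (z * w)| <= l * ((normsq z + E) / 2) /\
  `|cIm (z * w)| <= l * ((normsq z + E) / 2).
Proof.
case: z w => [a b] [c' d] l0; rewrite /normsq !cReIm /= => H.
have S (r s : R) : 0 <= (l * r - s) ^+ 2 by exact: sqr_ge0.
have S' (r s : R) : 0 <= (l * r + s) ^+ 2 by exact: sqr_ge0.
have K (r : R) : l * r <= l * (l * ((a ^+ 2 + b ^+ 2 + E) / 2)) ->
    r <= l * ((a ^+ 2 + b ^+ 2 + E) / 2) by rewrite ler_pM2l.
split; rewrite ler_norml lerNl; apply/andP; split; apply: K.
- by have := S' a c'; have := S b d; nra.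
- by have := S a c'; have := S' b d; nra.
- by have := S' a d; have := S' b c'; nra.
- by have := S a d; have := S b c'; nra.
Qed.

(** The cutoff error is [O (l)] in L^2, uniformly on bounded time
    intervals, and the solution is bounded there. *)
Lemma cut_error_small T : exists2 K : R, 0 <= K & forall l t, 0 < l <= 1 ->
  `|t| <= T -> `|cRe (cpairing (cut_error l) t)| <= K * l /\
  `|cIm (cpairing (cut_error l) t)| <= K * l.
Proof.
have [C1 [d1 [C10 d10 H1]]] := bGx T; have [C2 [d2 [C20 d20 H2]]] := bG T.
have [K1 K10 HK1] := cL2_bounded T cu; have [K2 K20 HK2] := cL2_bounded T cv.
pose E x := 32 * (C1 * expR (- (d1 * (x - c) ^+ 2)))
  + (2 * 80 ^+ 2) * (C2 * expR (- (d2 * (x - c) ^+ 2))).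
have IE : L1 E by apply: L1D; apply: L1Z; apply: L1Z; exact: L1_gauss.
have E0 : 0 <= rint E.
  have e0 (C d x : R) : 0 < C -> 0 <= C * expR (- (d * (x - c) ^+ 2)).
    by move=> C0; rewrite mulr_ge0 ?expR_ge0// ltW.
  apply: rint_ge0 => x; apply: addr_ge0; apply: mulr_ge0; rewrite ?e0 ?ler0n//.
exists ((K1 + K2 + rint E) / 2) => [|l t l01 tT].
  by rewrite divr_ge0// !addr_ge0.
have [l0 _] := andP l01.
have B x := @product_bound l (E x) (psi x t) (cut_error l (x, t)) l0.
have HB x : normsq (cut_error l (x, t)) <= l ^+ 2 * E x.
  apply: (le_trans (cut_error_normsq (x, t) l01)).
  apply: ler_wpM2l; first exact: sqr_ge0.
  apply: lerD; apply: ler_wpM2l; rewrite ?ler0n ?H1 ?H2//.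
have [F1 F2] := cxsupported_L2 t (csmooth_cut_error l) (cxsupported_cut_error l0).
have [I1 I2] := L1_product t F1 F2.
have IN : L1 (fun x => l * ((normsq (psi x t) + E x) / 2)).
  apply: L1Z; under eq_fun do rewrite mulrC; apply: L1Z; apply: L1D => //.
  by apply: L1D; apply: L2_sqr; [exact: (cu.1 t)|exact: (cv.1 t)].
have RN : rint (fun x => l * ((normsq (psi x t) + E x) / 2)) <=
    (K1 + K2 + rint E) / 2 * l.
  have In : L1 (fun x => normsq (psi x t)).
    by apply: L1D; apply: L2_sqr; [exact: (cu.1 t)|exact: (cv.1 t)].
  have -> : (fun x => l * ((normsq (psi x t) + E x) / 2)) =
      (fun x => (l / 2) * (normsq (psi x t) + E x)).
    by apply/funext => x; ring.
  rewrite rintZ; last exact: L1D.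
  rewrite rintD//; rewrite [leRHS]mulrC mulrCA mulrA mulrC.
  rewrite -!mulrA ler_pM2r ?divr_gt0// lerD2r.
  rewrite /normsq rintD; [|exact: (L2_sqr (cu.1 t))|exact: (L2_sqr (cv.1 t))].
  by apply: lerD; [exact: HK1|exact: HK2].
split; apply: (le_trans _ RN); apply: rint_norm_le => // x.
- by have [] := B x (HB x).
- by have [] := B x (HB x).
Qed.

Hypothesis weak : forall phi, test_function phi -> schrodinger_on psi phi.

(** Testing the equation against the cut-off adjoint solution times a
    window: the main terms of [cutoff_test_function] cancel and the rest is
    one-dimensional in time. *)
Lemma window_identity a b e l : 0 < e <= 1 -> 0 < l ->
  let w t := tstep a e t - tstep b e t in
  let dw t := dtstep a e t - dtstep b e t in
  let q := cpairing (cut_error l) in let s := cpairing (cutG l) in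
  rint (fun t => w t * cRe (q t)) = - rint (fun t => dw t * cIm (s t)) /\
  rint (fun t => w t * cIm (q t)) = rint (fun t => dw t * cRe (s t)).
Proof.
move=> e01 l0 w dw q s; have [e0 e1] := andP e01.
have sw : smooth (fun p : R * R => w p.2).
  by apply: smoothB; exact: smooth_tstep.
have dwE p : is_derive p (dir_t R) (fun q : R * R => w q.2) (dw p.2).
  by apply: is_deriveB; exact: is_derive_tstep_plane.
pose phi p := (w p.2)%:C * cutG l p.
pose main p := (w p.2)%:C * ((cutoff l p)%:C * cderive (dir_x R) Gx p).
pose M := `|a| + `|b| + 1 + l^-1.
have lM : l^-1 <= M by rewrite lerDr !addr_ge0.
have li0 : 0 < l^-1 by rewrite invr_gt0.
have a0 := normr_ge0 a; have b0 := normr_ge0 b.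
have aM : `|a| + 1 <= M by rewrite /M; lra.
have bM : `|b| + 1 <= M by rewrite /M; lra.
have wM t : M < `|t| -> w t = 0 by exact: window_out e01 aM bM.
have dwM t : M < `|t| -> dw t = 0.
  by move=> tM; rewrite /dw !dtstep_supported ?subrr//; move: tM; rewrite /M; lra.
have xG := cxsupported_le lM (cxsupported_cutG l0).
have xW := cxsupported_le lM (cxsupported_cut_error l0).
have sphi : csmooth phi by apply: csmoothM; [exact: csmooth_real|exact: csmooth_cutG].
have uphi : csupported M phi by exact: csupported_window.
have := weak (supported_test_function sphi uphi).
have sGxx := csmooth_cderive ax (csmooth_cderive ax sG).
have smain : csmooth main.
  apply: csmoothM; first exact: csmooth_real.
  by apply: csmoothM => //; apply: csmooth_real; exact: smooth_cutoff.
have umain : csupported M main.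
  apply: csupported_window => //; apply: (cxsupported_le lM).
  by apply: cxsupported_scale; exact: xsupported_cutoff.
have uW := csupported_window wM xW; have udG := csupported_window dwM xG.
have sW := csmoothM (csmooth_real sw) (csmooth_cut_error l).
have sdw : smooth (fun p : R * R => dw p.2).
  have -> : (fun p : R * R => dw p.2) = 'D_(dir_t R) (fun p => w p.2).
    by apply/funext => p; have [] := dwE p.
  by apply: smooth_derive_axis.
have sdG := csmoothM (csmooth_real sdw) (csmooth_cutG l).
have sidG := csmoothM (csmooth_cst 'i%C) sdG; have uidG := csupported_i udG.
have st := csmooth_cderive at_ sphi; have ut := csupported_cderive at_ sphi uphi.
rewrite /schrodinger_on /distr_derive opprK mulrN => /oppr_inj.
rewrite -(distr_ofi st ut).
have -> : (fun p => 'i%C * cderive (dir_t R) phi p) =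
    (fun p => main p + 'i%C * ((dw p.2)%:C * cutG l p)).
  by apply/funext => p; have [] := cutoff_test_function l p sw dwE.
have -> : cderive (dir_x R) (cderive (dir_x R) phi) =
    (fun p => main p + (w p.2)%:C * cut_error l p).
  by apply/funext => p; have [] := cutoff_test_function l p sw dwE.
rewrite (distr_ofD smain sidG umain uidG) (distr_ofD smain sW umain uW).
move=> /addrI; rewrite (distr_ofi sdG udG).
rewrite (distr_of_window w (csmooth_cut_error l) xW).
rewrite (distr_of_window dw (csmooth_cutG l) xG) => E.
have E1 := congr1 (@complex.Re R) E; have E2 := congr1 (@complex.Im R) E.
by move: E1 E2; rewrite cReM cImM /= !mul0r !mul1r sub0r add0r => <- <-.
Qed.

(** Only a one-sided bound is available, for [0 < l <= 1], while the limit
    is two-sided. *)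
Lemma limit_zero (D : R -> R) (L K : R) : D l @[l --> (0 : R)] --> L ->
  (forall l, 0 < l <= 1 -> `|D l| <= K * l) -> L = 0.
Proof.
move=> DL DK; apply/eqP; apply: contraT => L0.
have nL : 0 < `|L| / 2 by rewrite divr_gt0// normr_gt0.
have /cvgrPdist_lt /(_ _ nL) [e /= e0 He] := DL.
pose l := Num.min (Num.min (e / 2) 1) (`|L| / 2 / (`|K| + 1)).
have K1 : 0 < `|K| + 1 by rewrite ltr_wpDl.
have l0 : 0 < l by rewrite !lt_min divr_gt0//= ltr01 divr_gt0.
have le_ : l <= e / 2 by rewrite !ge_min lexx.
have l1 : l <= 1 by rewrite !ge_min lexx orbT.
have lK : l <= `|L| / 2 / (`|K| + 1) by rewrite ge_min lexx orbT.
have A : `|L - D l| < `|L| / 2.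
  by apply: He; rewrite /= sub0r normrN gtr0_norm//; lra.
have B : `|D l| <= `|L| / 2.
  apply: (le_trans (DK l _)); first by rewrite l0.
  move: lK; rewrite ler_pdivlMr// => lK; apply: le_trans lK.
  rewrite mulrC ler_pM2l//; apply: (le_trans (ler_norm K)); lra.
have : `|L| < `|L|.
  rewrite [X in _ < X]splitr -[X in `|X| < _](subrK (D l)).
  by apply: (le_lt_trans (ler_normD _ _)); exact: ltr_leD.
by rewrite ltxx.
Qed.

(** Between two times the cut-off pairing drifts by [O (l)]; as [l] tends
    to [0] it tends to [cut 0] times the full pairing, and [cut 0] is not
    zero. *)
Lemma pairing_constant a b : cpairing G a = cpairing G b.
Proof.
pose T := `|a| + `|b| + 1.
have a0 := normr_ge0 a; have b0 := normr_ge0 b.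
have aT : `|a| + 1 <= T by rewrite /T; lra.
have bT : `|b| + 1 <= T by rewrite /T; lra.
have [K K0 HK] := cut_error_small T.
have [cG1 cG2] := gauss_cL2 sG bG.
have lim (pr : R[i] -> R) (t : R) : (pr = @complex.Re R \/ pr = @complex.Im R) ->
    pr (cpairing (cutG l) t) @[l --> (0 : R)] --> cut 0 * pr (cpairing G t).
  have [I1 I2] := L1_product t (cG1.1 t) (cG2.1 t).
  move=> [->|->].
  - have := cut_limit I1; have -> // : (fun l => rint (fun x => cut (l * x) *
        cRe (psi x t * G (x, t)))) = (fun l => cRe (cpairing (cutG l) t)).
    apply/funext => l; rewrite /cpairing /=; congr rint; apply/funext => x.
    by rewrite /cutG mulrCA cRe_scale.
  - have := cut_limit I2; have -> // : (fun l => rint (fun x => cut (l * x) *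
        cIm (psi x t * G (x, t)))) = (fun l => cIm (cpairing (cutG l) t)).
    apply/funext => l; rewrite /cpairing /=; congr rint; apply/funext => x.
    by rewrite /cutG mulrCA cIm_scale.
have drift l : 0 < l <= 1 ->
    `|cRe (cpairing (cutG l) a) - cRe (cpairing (cutG l) b)| <= K * rint (boxf T) * l /\
    `|cIm (cpairing (cutG l) a) - cIm (cpairing (cutG l) b)| <= K * rint (boxf T) * l.
  move=> l01; have [l0 l1] := andP l01.
  have [cs1 cs2] := cpairing_continuous (csmooth_cutG l) (cxsupported_cutG l0).
  have [cq1 cq2] := cpairing_continuous (csmooth_cut_error l) (cxsupported_cut_error l0).
  have Kl : 0 <= K * l by rewrite mulr_ge0// ltW.
  rewrite mulrAC; split.
  - apply: (@window_drift R (fun t => cRe (cpairing (cutG l) t))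
      (fun t => cIm (cpairing (cut_error l) t)) a b T (K * l) 1 cs1 cq2
      (normr1 _) aT bT Kl (fun t tT => (HK l t l01 tT).2)) => e e01.
    by rewrite mul1r; have [_ ->] := window_identity a b e01 l0.
  - apply: (@window_drift R (fun t => cIm (cpairing (cutG l) t))
      (fun t => cRe (cpairing (cut_error l) t)) a b T (K * l) (-1) cs2 cq1
      _ aT bT Kl (fun t tT => (HK l t l01 tT).1)); first by rewrite normrN normr1.
    by move=> e e01; have [-> _] := window_identity a b e01 l0; rewrite mulN1r opprK.
have c0 : cut 0 != 0 :> R by rewrite gt_eqF// cut0_gt0.
apply: complex_ext.
- have L : cRe (cpairing (cutG l) a) - cRe (cpairing (cutG l) b) @[l --> (0 : R)]
      --> cut 0 * cRe (cpairing G a) - cut 0 * cRe (cpairing G b).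
    by apply: cvgB; apply: (lim (@complex.Re R)); left.
  have Z := limit_zero L (fun l l01 => (drift l l01).1).
  by apply: (mulfI c0); apply/eqP; rewrite -subr_eq0; apply/eqP.
- have L : cIm (cpairing (cutG l) a) - cIm (cpairing (cutG l) b) @[l --> (0 : R)]
      --> cut 0 * cIm (cpairing G a) - cut 0 * cIm (cpairing G b).
    by apply: cvgB; apply: (lim (@complex.Im R)); right.
  have Z := limit_zero L (fun l l01 => (drift l l01).2).
  by apply: (mulfI c0); apply/eqP; rewrite -subr_eq0; apply/eqP.
Qed.

End Adjoint.
End Solution.
End ConservationLaw.

(** * From Gaussians to indicator functions of balls *)

Section PowerLimits.
Context {R : realType}.
Implicit Types v w : R.

Lemma bernoulli_le v N : 0 <= v <= 1 -> 1 - (1 - v) ^+ N <= N%:R * v.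
Proof.
move=> v01; elim: N => [|N IH]; first by rewrite expr0 subrr mul0r.
have p0 : 0 <= (1 - v) ^+ N by rewrite exprn_ge0//; lra.
have p1 : (1 - v) ^+ N <= 1 by rewrite exprn_ile1//; lra.
by rewrite exprS -natr1; nra.
Qed.

(** From [1 + N v <= (1 + v)^N] and [(1 + v) (1 - v) <= 1]. *)
Lemma geom_decay_le v N : 0 <= v <= 1 -> N%:R * v * (1 - v) ^+ N <= 1.
Proof.
move=> v01; suff : (1 + N%:R * v) * (1 - v) ^+ N <= 1.
  have : 0 <= (1 - v) ^+ N by rewrite exprn_ge0//; lra.
  by nra.
elim: N => [|N IH]; first by rewrite expr0 mul0r addr0 mulr1.
apply: le_trans IH; rewrite exprS mulrA ler_wpM2r//.
  by rewrite exprn_ge0//; lra.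
have N0 : 0 <= N%:R :> R by [].
rewrite -natr1; move: (N%:R : R) N0 => n n0.
have : 0 <= (n + 1) * v ^+ 2 by rewrite mulr_ge0 ?sqr_ge0//; lra.
by nra.
Qed.

(** A polynomial in [w] without constant term, close to [1] for [2 w > 1]
    and to [0] for [2 w < 1]: [w^m] is small compared with [2^(-m)] in the
    second case and large in the first, and [(1 - v)^N] changes from [1] to
    [0] where [v] passes [1 / N]. *)
Definition bell_power w (m : nat) : R := 1 - (1 - w ^+ m.+1) ^+ (2 ^ m.+1).

Lemma bell_power_ge0 w m : 0 <= w <= 1 -> 0 <= bell_power w m.
Proof.
move=> w01; have v1 : w ^+ m.+1 <= 1 by rewrite exprn_ile1//; lra.
have v0 : 0 <= w ^+ m.+1 by rewrite exprn_ge0//; lra.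
by rewrite /bell_power subr_ge0 exprn_ile1//; lra.
Qed.

Lemma bell_power_le1 w m : 0 <= w <= 1 -> bell_power w m <= 1.
Proof.
move=> w01; have v1 : w ^+ m.+1 <= 1 by rewrite exprn_ile1//; lra.
by rewrite /bell_power gerBl exprn_ge0//; lra.
Qed.

Lemma bell_power_le_geom w m : 0 <= w <= 1 -> bell_power w m <= (2 * w) ^+ m.+1.
Proof.
move=> w01; have v1 : w ^+ m.+1 <= 1 by rewrite exprn_ile1//; lra.
have v0 : 0 <= w ^+ m.+1 by rewrite exprn_ge0//; lra.
by rewrite exprMn -natrX; apply: bernoulli_le; rewrite v0.
Qed.

(** An integrable majorant that does not depend on [m]. *)
Lemma bell_power_le w m : 0 <= w <= 1 -> bell_power w m <= 2 * w.
Proof.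
move=> w01; have [w2|w2] := leP (2 * w) 1.
  apply: (le_trans (bell_power_le_geom m w01)); rewrite exprS.
  by rewrite ler_piMr ?exprn_ile1//; lra.
exact: le_trans (bell_power_le1 m w01) (ltW w2).
Qed.

Lemma bell_power_cvg w : 0 < w <= 1 -> 2 * w != 1 ->
  bell_power w m @[m --> \oo] --> (if 1 < 2 * w then 1 else 0 : R).
Proof.
move=> /andP[w0 w1] w2; have w01 : 0 <= w <= 1 by rewrite ltW.
have geom0 (z : R) : 0 <= z -> z < 1 -> z ^+ m.+1 @[m --> \oo] --> (0 : R).
  move=> z0 z1; have := @cvg_expr _ z; rewrite ger0_norm// => /(_ z1).
  by rewrite -cvg_shiftS.
case: ifPn => [w2'|]; last first.
  rewrite -leNgt le_eqVlt (negbTE w2)/= => w2'.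
  apply: (@squeeze_cvgr _ _ _ _ (fun=> 0) (fun m => (2 * w) ^+ m.+1)).
  - by apply: nearW => m; rewrite bell_power_ge0// bell_power_le_geom.
  - exact: cvg_cst.
  - by apply: geom0 => //; rewrite mulr_ge0// ltW.
have z0 : 0 < (2 * w)^-1 by rewrite invr_gt0; lra.
apply: (@squeeze_cvgr _ _ _ _ (fun m => 1 - (2 * w)^-1 ^+ m.+1) (fun=> 1)).
- apply: nearW => m; rewrite bell_power_le1// andbT /bell_power lerB//.
  have v1 : w ^+ m.+1 <= 1 by rewrite exprn_ile1// ltW.
  have v0 : 0 <= w ^+ m.+1 by rewrite exprn_ge0// ltW.
  have P : 0 < (2 * w) ^+ m.+1 by rewrite exprn_gt0; lra.
  rewrite exprVn -[leRHS]mul1r ler_pdivlMr// mulrC exprMn -natrX.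
  by apply: geom_decay_le; rewrite v0.
- rewrite -[X in _ --> X]subr0; apply: cvgB; first exact: cvg_cst.
  by apply: geom0; [exact: ltW|rewrite invf_lt1//; lra].
- exact: cvg_cst.
Qed.

End PowerLimits.
Section GaussianMoments.
Context {R : realType} (f : R -> R).
Local Notation mu := (@lebesgue_measure R).
Implicit Types s c x rho : R.
Hypothesis f2 : L2 f.
Hypothesis f_gauss : forall s c : R, 0 < s ->
  rint (fun x => f x * expR (- (s * (x - c) ^+ 2))) = 0.

Definition bell (s c x : R) : R := expR (- (s * (x - c) ^+ 2)).

Lemma bellX s c n x : bell s c x ^+ n = bell (n%:R * s) c x.
Proof. by rewrite /bell -expRM_natl mulrN mulrA. Qed.

Lemma bell_gt0 s c x : 0 < bell s c x. Proof. exact: expR_gt0. Qed.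

Lemma bell_le1 s c x : 0 < s -> bell s c x <= 1.
Proof. by move=> s0; rewrite -expR0 ler_expR oppr_le0 mulr_ge0 ?sqr_ge0// ltW. Qed.

(** Powers of a Gaussian are Gaussians with the same centre, and each
    factor [1 - w^m] is expanded in turn; keeping at least one power of [w]
    makes every term a Gaussian. *)
Lemma bell_powers_orthogonal s c j m N : 0 < s ->
  let g x := f x * (bell s c x ^+ j.+1 * (1 - bell s c x ^+ m) ^+ N) in
  L1 g /\ rint g = 0.
Proof.
move=> s0 /=; elim: N j => [|N IH] j.
  have js : 0 < j.+1%:R * s by rewrite mulr_gt0.
  have -> : (fun x => f x * (bell s c x ^+ j.+1 * (1 - bell s c x ^+ m) ^+ 0)) =
            (fun x => f x * expR (- (j.+1%:R * s * (x - c) ^+ 2))).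
    by apply/funext => x; rewrite expr0 mulr1 bellX.
  by split; [apply: L2_mul => //; exact: L2_gauss|exact: f_gauss].
have [i1 r1] := IH j; have [i2 r2] := IH (j + m)%N.
have -> : (fun x => f x * (bell s c x ^+ j.+1 * (1 - bell s c x ^+ m) ^+ N.+1)) =
  (fun x => f x * (bell s c x ^+ j.+1 * (1 - bell s c x ^+ m) ^+ N) -
            f x * (bell s c x ^+ (j + m).+1 * (1 - bell s c x ^+ m) ^+ N)).
  by apply/funext => x; rewrite -addSn exprD (exprS (1 - _) N); ring.
by split; [exact: L1B|rewrite rintB// r1 r2 subr0].
Qed.

(** The telescoping expansion [1 - (1 - v)^N = sum_(i < N) v (1 - v)^i]
    shows that no constant term survives. *)
Lemma bell_power_orthogonal s c m : 0 < s ->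
  let g x := f x * bell_power (bell s c x) m in L1 g /\ rint g = 0.
Proof.
move=> s0; rewrite /bell_power; elim: (2 ^ m.+1)%N => [|N /= [i1 r1]].
  have -> : (fun x => f x * (1 - (1 - bell s c x ^+ m.+1) ^+ 0)) = fun=> 0.
    by apply/funext => x; rewrite expr0 subrr mulr0.
  by split; [exact: L10|exact: rint0].
have [i2 r2] := bell_powers_orthogonal c m m.+1 N s0.
have -> : (fun x => f x * (1 - (1 - bell s c x ^+ m.+1) ^+ N.+1)) =
  (fun x => f x * (1 - (1 - bell s c x ^+ m.+1) ^+ N) +
            f x * (bell s c x ^+ m.+1 * (1 - bell s c x ^+ m.+1) ^+ N)).
  by apply/funext => x; rewrite (exprS (1 - _) N); ring.
by split; [exact: L1D|rewrite rintD// r1 r2 addr0].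
Qed.

(** With this width the Gaussian takes the value [1 / 2] exactly on the
    sphere of radius [rho]. *)
Lemma bell_half (c rho x : R) : 0 < rho ->
  let w := bell (ln 2 / rho ^+ 2) c x in
  ((1 < 2 * w) = (`|x - c| < rho)) * ((2 * w == 1) = (`|x - c| == rho)).
Proof.
move=> rho0 w; have l2 : 0 < ln 2 :> R by rewrite ln_gt0// ltr1n.
have -> : 2 * w = expR (ln 2 * (1 - (x - c) ^+ 2 / rho ^+ 2)).
  rewrite mulrBr mulr1 expRD lnK ?posrE//; congr (_ * expR _).
  by rewrite -mulrA (mulrC (rho ^+ 2)^-1).
have r2 : 0 < rho ^+ 2 by rewrite exprn_gt0.
have n2 : (x - c) ^+ 2 = `|x - c| ^+ 2 by rewrite real_normK ?num_real.
have -> : (`|x - c| < rho) = (0 < 1 - (x - c) ^+ 2 / rho ^+ 2).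
  by rewrite subr_gt0 ltr_pdivrMr// mul1r n2 ltr_sqr ?nnegrE ?(ltW rho0).
have -> : (`|x - c| == rho) = (1 - (x - c) ^+ 2 / rho ^+ 2 == 0).
  rewrite subr_eq0 [RHS]eq_sym -[X in _ = (_ == X)]divr1 eqr_div ?oner_neq0 ?(lt0r_neq0 r2)//.
  rewrite mulr1 mul1r n2.
  by rewrite eqrXn2 ?(ltW rho0).
move: (1 - _ / _) => E; split.
  by rewrite -[X in X < _]expR0 ltr_expR pmulr_rgt0.
by rewrite -[X in _ == X]expR0 (inj_eq (@expR_inj R)) mulf_eq0 gt_eqF.
Qed.

Lemma sphere_negligible (c rho : R) : {ae mu, forall x, `|x - c| != rho}.
Proof.
have null (a : R) : mu.-negligible [set a].
  by exists [set a]; split => //; exact: lebesgue_measure_set1.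
apply: negligibleS (negligibleU (null (c + rho)) (null (c - rho))).
move=> x /= /negP/negPn/eqP <-; have [x0|x0] := leP 0 (x - c : R).
  by left; rewrite /= ger0_norm// addrC subrK.
by right; rewrite /= ltr0_norm// opprK addrC subrK.
Qed.

(** Dominated convergence along [bell_power], which tends to the indicator
    function of the ball outside the sphere. *)
Lemma ball_moment (c rho : R) : 0 < rho ->
  L1 (f \_ (ball c rho)) /\ rint (f \_ (ball c rho)) = 0.
Proof.
move=> rho0; pose s := ln 2 / rho ^+ 2.
have s0 : 0 < s by rewrite divr_gt0 ?exprn_gt0// ln_gt0// ltr1n.
have w01 x : 0 < bell s c x <= 1 by rewrite bell_gt0 bell_le1.
have w01' x : 0 <= bell s c x <= 1 by rewrite ltW ?bell_gt0// bell_le1.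
have mf := L2_measurable f2.
have fB x : (f \_ (ball c rho)) x = f x * (if `|x - c| < rho then 1 else 0).
  rewrite patchE -ball_normE /=; case: ifPn.
    by move=> /set_mem /=; rewrite distrC => ->; rewrite mulr1.
  by move=> /negP nb; case: ifPn => [xb|]; rewrite ?mulr0//; case: nb; rewrite inE /= distrC.
pose g m x := f x * bell_power (bell s c x) m.
have [//|||||If _ cvg] := @dominated_convergence _ _ R mu setT measurableT
  (fun m => EFin \o g m) (EFin \o f \_ (ball c rho))
  (EFin \o (fun x => `|f x * (2 * bell s c x)|)).
- move=> m; have [ig _] := bell_power_orthogonal c m s0.
  exact: measurable_int ig.
- apply/measurable_EFinP; apply: (proj1 (measurable_restrictT f _)) => //.
    exact: measurable_ball.
  exact: measurable_funTS.
- have [N [mN N0 sub]] := sphere_negligible c rho.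
  exists N; split => // x /= h; apply: sub => /= xr; apply: h => _.
  apply: cvg_EFin; first exact: nearW.
  have := bell_power_cvg (w01 x); rewrite bell_half // bell_half // => /(_ xr) h.
  by rewrite fB; apply: cvgM => //; exact: cvg_cst.
- apply: L1_norm; have -> : (fun x => f x * (2 * bell s c x)) = (fun x => 2 * (f x * bell s c x)).
    by apply/funext => x; rewrite mulrCA.
  by apply/L1Z/L2_mul => //; exact: L2_gauss.
- apply: aeW => x m _ /=; rewrite lee_fin !normrM ler_wpM2l//.
  rewrite ger0_norm ?bell_power_ge0// -normrM ger0_norm ?bell_power_le//.
  by rewrite mulr_ge0 ?ltW ?bell_gt0.
split; first exact: If.
have E m : (\int[mu]_x (EFin \o g m) x = 0)%E.
  have [ig rg] := bell_power_orthogonal c m s0.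
  by rewrite -[LHS](fineK (integrable_fin_num measurableT ig)); exact: (congr1 EFin rg).
move: cvg; under eq_fun do rewrite E.
move=> cvg0; rewrite /rint /Rintegral.
by have /= <- := cvg_unique (@ereal_hausdorff R) (cvg_cst 0%E) cvg0.
Qed.

Lemma ball_integrable (c rho : R) : 0 < rho -> mu.-integrable (ball c rho) (EFin \o f).
Proof.
move=> rho0; apply: (proj2 (integrable_mkcond _ _)); first exact: measurable_ball.
by rewrite restrict_EFin; have [] := ball_moment c rho0.
Qed.

Lemma gaussian_locally_integrable : locally_integrable setT f.
Proof.
split; [exact: L2_measurable|exact: openT|move=> K _ cK].
have [M [_ KM]] := compact_bounded cK.
have M0 : 0 < `|M| + 2 by rewrite ltr_wpDl.
have KB : K `<=` ball (0 : R) (`|M| + 2).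
  move=> x Kx; rewrite -ball_normE /= sub0r normrN.
  have M1 : M < `|M| + 1 by rewrite (le_lt_trans (ler_norm _))// ltrDl.
  have /(_ _ Kx) /= := KM _ M1; move=> /le_lt_trans; apply.
  by rewrite ltrD2l ltr1n.
have If := ball_integrable 0 M0.
have /integrableP[_ fB] := If.
apply: le_lt_trans fB; apply: ge0_subset_integral => //.
- exact: compact_measurable.
- exact: measurable_ball.
- exact: measurable_int (integrable_norm If).
Qed.

(** Since [f] has mean zero over the ball, [|f x|] is the modulus of the
    mean of [f x - f y] over [y]. *)
Lemma norm_le_davg (x r : R) : 0 < r -> (`|f x|%:E <= davg f x r)%E.
Proof.
move=> r0; have If := ball_integrable x r0.
have mB : @measurable _ (measurableTypeR R) (ball x r) by exact: measurable_ball.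
have muB : mu (ball x r) = (r *+ 2)%:E by rewrite lebesgue_measure_ball ?ltW.
have Ic : mu.-integrable (ball x r) (EFin \o (fun=> f x)).
  apply/integrableP; split; first exact: measurable_cst.
  have -> : (\int[mu]_(y in ball x r) `|(EFin \o (fun=> f x)) y| =
             `|f x|%:E * mu (ball x r))%E by apply: integral_cst.
  by rewrite muB -EFinM ltry.
have B0 : (\int[mu]_(y in ball x r) (f y)%:E = 0)%E.
  rewrite -(fineK (integrable_fin_num mB If)); congr EFin.
  by rewrite -/(Rintegral _ _ _) Rintegral_mkcond; have [] := ball_moment x r0.
have C0 : (\int[mu]_(y in ball x r) (f x)%:E = (f x)%:E * mu (ball x r))%E.
  exact: integral_cst.
have Id := integrableB mB If Ic.
have := le_abse_integral mu mB (measurable_int mu Id).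
rewrite (integralB mB If Ic) B0 sub0e abseN C0 muB.
rewrite -EFinM /= normrM => le.
have r2 : 0 < r *+ 2 by rewrite mulrn_wgt0.
rewrite /davg /iavg muB inver gt_eqF// -[leLHS]mul1e -(mulVf (lt0r_neq0 r2)) EFinM.
rewrite -muleA lee_wpmul2l ?lee_fin ?invr_ge0 ?(ltW r2)//.
by apply: le_trans le; rewrite -EFinM lee_fin (gtr0_norm r2) mulrC.
Qed.

(** At a Lebesgue point the averaged deviation tends to [0] and bounds [|f
    x|]. *)
Lemma gaussians_determine : {ae mu, forall x, f x = 0}.
Proof.
have [N [mN N0 sub]] := lebesgue_differentiation gaussian_locally_integrable.
exists N; split => // x /= fx0; apply: sub => /= lx; apply: fx0.
have : (`|f x|%:E <= 0 :> \bar R)%E.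
  apply: (cvge_ge _ lx).
  by near=> r; apply: norm_le_davg; near: r; exact: nbhs_right_gt.
by rewrite lee_fin normr_le0 => /eqP.
Unshelve. all: by end_near. Qed.

End GaussianMoments.

(** * Uniqueness of solutions *)

Section Uniqueness.
Context {R : realType}.
Implicit Types (psi phi : R -> R -> R[i]).
Local Notation mu := (@lebesgue_measure R).

Lemma ae_combine (P Q S : R -> Prop) : {ae mu, forall x, P x} ->
  {ae mu, forall x, Q x} -> (forall x, P x -> Q x -> S x) -> {ae mu, forall x, S x}.
Proof.
move=> p q pq; apply: negligibleS (negligibleU p q) => x /= nS.
by apply: contrapT => /not_orP[/contrapT px /contrapT qx]; exact: nS (pq _ px qx).
Qed.

(** The choice [beta = 2 t0], [gamma = -2] cancels the imaginary part of
    the variance at time [t0]. *)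
Lemma kernel_focus (sigma t0 c x : R) : 0 < sigma ->
  kernel sigma (2 * t0) (-2) c 0 (x, t0) =
  (expR (- ((2 * sigma)^-1 * (x - c) ^+ 2)) / Num.sqrt sigma)%:C.
Proof.
move=> s0; rewrite /kernel.
have -> : kvar sigma (2 * t0) (-2) (x, t0).2 = sigma%:C.
  by rewrite /kvar mulNr subrr.
have -> : karg c 0 (x, t0).1 = (x - c)%:C by rewrite /karg oppr0.
have -> : - ((x - c)%:C ^+ 2 / (2 * sigma%:C)) =
          (- ((2 * sigma)^-1 * (x - c) ^+ 2))%:C.
  by rewrite mulrC rmorphN rmorphM fmorphV rmorphM rmorphXn /= rmorph_nat.
rewrite sqrtc_sqrtr ?lecR ?ltW// [cRe sigma%:C]/= -[RHS]/((_ * _)%:C) rmorphM fmorphV /=; congr (_ * _).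
by apply: complex_ext; rewrite /cexp /= ?cos0 ?sin0 ?mulr1 ?mulr0.
Qed.

Lemma cpairing_focus psi (s t0 c : R) : 0 < s -> cL2 (reP psi) -> cL2 (imP psi) ->
  let q := (Num.sqrt (2 * s)^-1)^-1 in let w x := expR (- (s * (x - c) ^+ 2)) in
  cpairing psi (kernel (2 * s)^-1 (2 * t0) (-2) c 0) t0 =
  (q * rint (fun x => reP psi x t0 * w x)) +i* (q * rint (fun x => imP psi x t0 * w x)).
Proof.
move=> s0 cu cv q w; have k0 : 0 < (2 * s)^-1 by rewrite invr_gt0 mulr_gt0.
have gE x : kernel (2 * s)^-1 (2 * t0) (-2) c 0 (x, t0) = (q * w x)%:C.
  have e : (2 * (2 * s)^-1)^-1 = s by field; rewrite gt_eqF.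
  by rewrite (kernel_focus t0 c x k0) e (mulrC q).
have g2 := L2_gauss c s0.
have Lu := L2_mul (cu.1 t0) g2; have Lv := L2_mul (cv.1 t0) g2.
rewrite /cpairing /cintegral -(rintZ q Lu) -(rintZ q Lv).
congr (_ +i* _); congr rint; apply/funext => x.
  by rewrite gE cReM /= /reP mulr0 subr0 mulrCA.
by rewrite gE cImM /= /imP mulr0 add0r mulrCA.
Qed.

(** For [gamma = -2] the kernel solves the time-reversed equation. *)
Lemma kernel_adjoint (sigma t0 c : R) : 0 < sigma -> forall p,
  let G := kernel sigma (2 * t0) (-2) c 0 in
  'i%C * cderive (dir_t R) G p = cderive (dir_x R) (cderive (dir_x R) G) p.
Proof.
move=> s0 p /=; rewrite cderive_kernel_t// mulrA.
move: (cderive _ (cderive _ _) _) => z.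
suff -> : 'i%C * (0 +i* (-2 / 2)) = 1 :> R[i] by rewrite mul1r.
by apply: complex_ext; rewrite !cReIm /=; field.
Qed.

(** At time [0] the pairings with the adjoint kernels agree because the
    initial data do; they are conserved, and at time [t0] the kernels are
    all real Gaussians. *)
Lemma schrodinger_unique (psi0 : R -> R[i]) psi phi : is_solution psi0 psi ->
  is_solution psi0 phi -> forall t, {ae mu, forall x, psi x t = phi x t}.
Proof.
move=> [/continuous_L2P[u1 v1] [weak1 init1]] [/continuous_L2P[u2 v2] [weak2 init2]] t0.
have same (s c : R) : 0 < s -> cpairing psi (kernel (2 * s)^-1 (2 * t0) (-2) c 0) t0 =
    cpairing phi (kernel (2 * s)^-1 (2 * t0) (-2) c 0) t0.
  move=> s0; have k0 : 0 < (2 * s)^-1 by rewrite invr_gt0 mulr_gt0.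
  have sG := csmooth_kernel (2 * t0) (-2) c 0 k0.
  have bG := gauss_bounded_kernel (2 * t0) (-2) c 0 k0.
  have bG' := gauss_bounded_kernel_x (2 * t0) (-2) c 0 k0.
  have aG := kernel_adjoint t0 c k0.
  rewrite (pairing_constant u1 v1 sG aG bG bG' weak1 t0 0).
  rewrite (pairing_constant u2 v2 sG aG bG bG' weak2 t0 0).
  have [g1 g2] := gauss_cL2 sG bG.
  have [a1 a2] := L1_product u1 v1 0 (g1.1 0) (g2.1 0).
  have [b1 b2] := L1_product u2 v2 0 (g1.1 0) (g2.1 0).
  have eq0 : {ae mu, forall x, psi x 0 = phi x 0}.
    by apply: (ae_combine init1 init2) => x -> ->.
  by rewrite /cpairing /cintegral; congr (_ +i* _); apply: rint_ae => //;
    apply: (ae_combine eq0 eq0) => x ->.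
have part (u v : R -> R) : L2 u -> L2 v -> (forall s c : R, 0 < s ->
    rint (fun x => u x * expR (- (s * (x - c) ^+ 2))) =
    rint (fun x => v x * expR (- (s * (x - c) ^+ 2)))) ->
    {ae mu, forall x, u x = v x}.
  move=> hu hv uv.
  have : {ae mu, forall x, u x - v x = 0}.
    apply: (gaussians_determine (L2B hu hv)) => s c s0.
    under eq_fun do rewrite mulrBl.
    by rewrite rintB ?uv ?subrr//; apply: L2_mul => //; exact: L2_gauss.
  by move=> z; apply: (ae_combine z z) => x /subr0_eq.
have focus (s c : R) : 0 < s ->
    rint (fun x => reP psi x t0 * expR (- (s * (x - c) ^+ 2))) =
    rint (fun x => reP phi x t0 * expR (- (s * (x - c) ^+ 2))) /\
    rint (fun x => imP psi x t0 * expR (- (s * (x - c) ^+ 2))) =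
    rint (fun x => imP phi x t0 * expR (- (s * (x - c) ^+ 2))).
  move=> s0; have := same s c s0.
  rewrite (cpairing_focus t0 c s0 u1 v1) (cpairing_focus t0 c s0 u2 v2).
  have q0 : (Num.sqrt (2 * s)^-1)^-1 != 0.
    by rewrite invr_eq0 gt_eqF// sqrtr_gt0 invr_gt0 mulr_gt0.
  by move=> [/(mulfI q0) re /(mulfI q0) im]; split; [exact: re|exact: im].
have re := part _ _ (u1.1 t0) (u2.1 t0) (fun s c s0 => (focus s c s0).1).
have im := part _ _ (v1.1 t0) (v2.1 t0) (fun s c s0 => (focus s c s0).2).
by apply: (ae_combine re im) => x; exact: complex_ext.
Qed.

End Uniqueness.

(** * The explicit solution *)

Section Packet.
Context {R : realType} (n : nat) (h : 'I_n.+1 -> R) (Z : 'I_n.+1 -> R[i]).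
Implicit Types (x t : R).

(** The factor [exp (- h^2 / 2)] compensates the one that comes from
    completing the square. *)
Definition packet_coef j := Z j * cexp (- (h j ^+ 2 / 2)%:C).

Definition packet (p : R * R) : R[i] :=
  \sum_(j < n.+1) packet_coef j * kernel 1 0 2 0 (h j) p.

Lemma csmooth_packet_kernel j : csmooth (kernel (1 : R) 0 2 0 (h j)).
Proof. exact: csmooth_kernel. Qed.

Lemma csmooth_packet_term j : csmooth (fun p => packet_coef j * kernel 1 0 2 0 (h j) p).
Proof. by apply: csmoothM; [exact: csmooth_cst|exact: csmooth_packet_kernel]. Qed.

Lemma csmooth_packet : csmooth packet.
Proof. exact: (csmooth_sum csmooth_packet_term). Qed.

Lemma gauss_bounded_packet : gauss_bounded 0 packet.
Proof.
apply: (@gauss_bounded_sum R 0 n.+1 (fun j p => packet_coef j * kernel 1 0 2 0 (h j) p)).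
by move=> j; apply: gauss_boundedZ; exact: gauss_bounded_kernel.
Qed.

Lemma cderive_packet v p : axis v -> cderive v packet p =
  \sum_(j < n.+1) packet_coef j * cderive v (kernel 1 0 2 0 (h j)) p.
Proof.
move=> av; rewrite (cderive_sum av p csmooth_packet_term); apply: eq_bigr => j _.
exact: (cderiveZ av (packet_coef j) p (csmooth_packet_kernel j)).
Qed.

Lemma packet_schrodinger p : cderive (dir_t R) packet p =
  'i%C * cderive (dir_x R) (cderive (dir_x R) packet) p.
Proof.
have ax : axis (dir_x R) by left.
have at_ : axis (dir_t R) by right.
have sx j : csmooth (cderive (dir_x R) (kernel 1 0 2 0 (h j))).
  by apply: csmooth_cderive (csmooth_packet_kernel j).
have -> : cderive (dir_x R) packet = fun q =>
    \sum_(j < n.+1) packet_coef j * cderive (dir_x R) (kernel 1 0 2 0 (h j)) q.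
  by apply/funext => q; exact: (cderive_packet q ax).
rewrite (cderive_packet p at_) (cderive_sum ax p (fun j => csmoothM (csmooth_cst (packet_coef j)) (sx j))).
rewrite big_distrr; apply: eq_bigr => j _.
rewrite (cderiveZ ax (packet_coef j) p (sx j)).
rewrite (cderive_kernel_t 0 2 0 (h j) ltr01).
move: (cderive _ (cderive _ _) _) (packet_coef j) => z w.
have -> : (2 / 2 : R) = 1 by field.
by rewrite mulrCA.
Qed.

Definition frequency_packet x t : R[i] :=
  cexp (- ((x ^+ 2)%:C / (2 * (1 + 2 * 'i%C * t%:C))))
      / sqrtc (1 + 2 * 'i%C * t%:C) *
    \sum_(j < n.+1) Z j *
      cexp (- (h j ^+ 2 / 2)%:C
            + (h j ^+ 2)%:C / (2 * (1 + 2 * 'i%C * t%:C))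
            + 'i%C * x%:C * ((h j)%:C / (1 + 2 * 'i%C * t%:C))).

(** Completing the square: [- (x - i h)^2 / (2 s) = - x^2 / (2 s) + h^2 /
    (2 s) + i x h / s] with [s = 1 + 2 i t]. *)
Lemma frequency_packetE x t : frequency_packet x t = packet (x, t).
Proof.
have -> : packet (x, t) =
   \sum_(j < n.+1) packet_coef j * (cexp (- (karg 0 (h j) x ^+ 2 / (2 * kvar 1 0 2 t)))
     / sqrtc (kvar 1 0 2 t)) by [].
have kE : 1 + 2 * 'i%C * t%:C = kvar 1 0 2 t.
  by apply: complex_ext; rewrite !cReIm /=; ring.
rewrite /frequency_packet kE big_distrr; apply: eq_bigr => j _.
have s0 : kvar 1 0 2 t != 0 :> R[i] by exact: kvar_neq0.
have -> : karg 0 (h j) x ^+ 2 =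
    (x ^+ 2)%:C - (h j ^+ 2)%:C - 2 * ('i%C * x%:C * (h j)%:C).
  by apply: complex_ext; rewrite expr2 !cReIm /=; ring.
rewrite /packet_coef; move: (kvar _ _ _ _) s0 => s s0.
move: (x ^+ 2)%:C ('i%C * x%:C) (h j ^+ 2)%:C (h j)%:C (h j ^+ 2 / 2)%:C => X I H k A.
have -> : - A + H / (2 * s) + I * (k / s) = - A + (H / (2 * s) + I * (k / s)).
  by rewrite addrA.
have -> : - ((X - H - 2 * (I * k)) / (2 * s)) =
          - (X / (2 * s)) + (H / (2 * s) + I * (k / s)).
  by field; exact: s0.
move: (H / _ + _) => B; rewrite !cexpD.
by move: (cexp _) (cexp (- A)) (cexp B) (sqrtc s)^-1 (Z j) => a b c d z /=; ring.
Qed.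

Lemma frequency_packet0 x : frequency_packet x 0 =
  cexp (- (x ^+ 2 / 2)%:C) * \sum_(j < n.+1) Z j * cexp ('i%C * (h j * x)%:C).
Proof.
have e : 1 + 2 * 'i%C * (0 : R)%:C = 1 by rewrite mulr0 addr0.
have half (a : R) : a%:C / (2 * 1) = (a / 2)%:C.
  by rewrite mulr1 rmorphM fmorphV rmorph_nat.
rewrite /frequency_packet e sqrtc1 divr1 half; congr (_ * _); apply: eq_bigr => j _.
rewrite half addNr add0r divr1 -mulrA; congr (_ * cexp (_ * _)).
by rewrite -rmorphM mulrC.
Qed.

End Packet.

Theorem theorem7p1 (R : realType) (n : nat) (a : R) (ha : 1 < a)
    (h : 'I_n.+1 -> R) (hh : forall j, `|h j| <= 1) (Z : 'I_n.+1 -> R[i]) :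
  let psi0 : R -> R[i] := fun x =>
    cexp (- (x ^+ 2 / 2)%:C) * \sum_(j < n.+1) Z j * cexp ('i%C * (h j * x)%:C) in
  let psi_n : R -> R -> R[i] := fun x t =>
    cexp (- ((x ^+ 2)%:C / (2 * (1 + 2 * 'i%C * t%:C))))
      / sqrtc (1 + 2 * 'i%C * t%:C) *
    \sum_(j < n.+1) Z j *
      cexp (- (h j ^+ 2 / 2)%:C
            + (h j ^+ 2)%:C / (2 * (1 + 2 * 'i%C * t%:C))
            + 'i%C * x%:C * ((h j)%:C / (1 + 2 * 'i%C * t%:C))) in
  is_solution psi0 psi_n /\
  (forall psi : R -> R -> R[i], is_solution psi0 psi ->
     forall t, {ae @lebesgue_measure R, forall x, psi x t = psi_n x t}).
Proof.
move=> psi0 psi_n.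
have packetE : psi_n = fun x t => packet h Z (x, t).
  by apply/funext => x; apply/funext => t; exact: frequency_packetE.
have [c1 c2] := gauss_cL2 (csmooth_packet h Z) (gauss_bounded_packet h Z).
have sol : is_solution psi0 psi_n.
  split; first by rewrite packetE; apply/continuous_L2P.
  split; last by apply: aeW => x; exact: frequency_packet0.
  move=> phi phiT; rewrite packetE.
  exact: (classical_schrodinger (csmooth_packet h Z) (packet_schrodinger h Z) c1 c2 phiT).
by split => // psi solp; exact: (schrodinger_unique solp sol).
Qed.
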